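(* Let $\mathbb K=\mathbb R$ or $\mathbb C$, let $f=(f^1,\dots,f^p):\mathbb K^n\to\mathbb K^p$ be a real polynomial map (if $\mathbb K=\mathbb R$) or a mixed polynomial map (if $\mathbb K=\mathbb C$), and let $F:\mathbb K^n\times\mathbb K\to\mathbb K^p$ be a deformation of $f$. Suppose there exist $C$-face diagrams $D_1,\dots,D_p$ in $\mathbb R^n$ such that: (i) $f$ is SIKND with respect to $D_1,\dots,D_p$; (ii) for each $j=1,\dots,p$ and each $\varepsilon\in\mathbb K$, $d(w;F^j_\varepsilon-f^j)\ge d(w;D_j)$ for all $w\in\mathcal P(D_j)$; (iii) $F$ has a $\rho$-uniform Milnor radius. Then $F$ is topologically trivial along some neighborhood $T\subset\mathbb K$ of the origin. If the inequalities in (ii) are all strict, then $F$ is topologically trivial.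
   Context: Notation. $[n]=\{1,\dots,n\}$. A real polynomial map $f:\mathbb R^n\to\mathbb R^p$ has real polynomial components and $f(0)=0$. A mixed polynomial map $f:\mathbb C^n\to\mathbb C^p$ has components that are finite sums $\sum c_{\nu,\mu}x^\nu\bar x^\mu$, $c_{\nu,\mu}\in\mathbb C$, and $f(0)=0$. For a component $g$, $\mathrm{supp}(g)=\{\nu: c_\nu\ne0\}$ in the real case and $\mathrm{supp}(g)=\{\nu+\mu: c_{\nu,\mu}\neq0\}$ in the mixed case. For $A\subset\mathbb R^n$, $g_A$ is the sum of the terms of $g$ whose exponent $\nu$ (resp. $\nu+\mu$) lies in $A$. For $w\in(\mathbb Q_{>0})^n$, $d(w;g)=\min\{\langle w,\nu\rangle:\nu\in\mathrm{supp}(g)\}$ ($+\infty$ if $g=0$). $V(f)=f^{-1}(0)$; $\Sigma(f)$ is the set of points where the real Jacobian matrix of $f$ has rank $<p$ if $\mathbb K=\mathbb R$, and rank $<2p$ if $\mathbb K=\mathbb C$ (identifying $\mathbb C=\mathbb R^2$). For $I\subset[n]$, $\mathbb K^I=\{x\in\mathbb K^n:x_i=0\ \forall i\notin I\}$ and $(\mathbb K^* )^I=\{x\in\mathbb K^I:x_i\ne0\ \forall i\in I\}$. $C$-face diagrams. A $C$-face diagram is a set $D=D(J)=\{\nu\in(\mathbb R_{\ge0})^n:\min_{\ell\in J}\ell(\nu)=1\}$, with $J$ a nonempty finite set of linear forms with positive rational coefficients. For $w\in(\mathbb Q_{>0})^n$, $d(w;D)=\min_{\nu\in D}\langle w,\nu\rangle$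 and $\Delta(w;D)$ is the subset of $D$ where this minimum is attained. $\mathcal P(D)=\{w_1,\dots,w_N\}\subset(\mathbb Q_{>0})^n$ consists of one weight vector for each $(n-1)$-dimensional face $\Delta(w_i;D)$ of $D$, and $D$ is the union of these faces. A face of $D$ is a nonempty set $\Delta=\{\nu\in D:\nu_i=0\ (i\notin I_\Delta),\ \ell(\nu)=1\ (\ell\in J_\Delta)\}$ with $I_\Delta\subset[n]$, $\emptyset\ne J_\Delta\subset J$; it is inner if it is not contained in any proper coordinate subspace. For $C$-face diagrams $D_1,\dots,D_p$, $D=D_1+\dots+D_p$ denotes the union of the compact faces of the Minkowski sum of the polyhedra $D_j+(\mathbb R_{\ge0})^n$; it is again a $C$-face diagram, and each face $\Delta$ of $D$ decomposes uniquely as a Minkowski sum $\Delta=\Delta_1+\dots+\Delta_p$ with $\Delta_j$ a face of $D_j$. Put $f_\Delta=(f^1_{\Delta_1},\dots,f^p_{\Delta_p})$. SIKND. $f$ is SIKND with respect to $D_1,\dots,D_p$ if (a) $d(w;f^j)\ge d(w;D_j)$ for all $j$ and $w\in\mathcal P(D_j)$; and (b) for every inner face $\Delta$ of $D=D_1+\dots+D_p$ and every nonempty $I\subset[n]$ with $\Delta\cap\mathbb R^I\neq\emptyset$, $\Sigma(f_\Delta)\cap(\mathbb K^* )^I=\emptyset$. Deformations. A deformation of $f$ is a map $F:\mathbb K^n\times\mathbb K\to\mathbb K^p$, $F_\varepsilon(x)=F(x,\varepsilon)$, with $F_0=f$, $F_\varepsilon(0)=0$ for all $\varepsilon$, each $F_\varepsilon$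 being a real (resp. mixed) polynomial map with coefficients depending real-analytically on $\varepsilon$. For a connected $T\subset\mathbb K$ containing $0$, $F$ is topologically trivial along $T$ if there is a continuous family of homeomorphism germs $h_\varepsilon:(\mathbb K^n,0)\to(\mathbb K^n,0)$ with $F_0=F_\varepsilon\circ h_\varepsilon$ for all $\varepsilon\in T$; if $T=\mathbb K$ one says simply topologically trivial. Uniform Milnor radius. $\rho:U\to\mathbb R_{\ge0}$ is a proper, nonnegative, real analytic function on an open neighborhood $U$ of the origin in $\mathbb K^n$ (regarded as a real vector space) with $\rho^{-1}(0)=\{0\}$. $F$ has $\rho$-uniform Milnor radius along a connected compact set $T\ni0$ if there is $\epsilon_0>0$ such that for all $0<\epsilon\le\epsilon_0$ and $\varepsilon\in T$, $V(F_\varepsilon)$ is transversal to $\rho^{-1}(\epsilon)$ (at each point of $V(F_\varepsilon)\cap\rho^{-1}(\epsilon)$ the real Jacobian of $(F_\varepsilon,\rho)$ has maximal rank). $F$ has a $\rho$-uniform Milnor radius if this holds along every connected compact $T\subset\mathbb K$ containing $0$. *)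

(* Defs.v *)
From mathcomp Require Import all_boot all_order all_algebra.
From mathcomp Require Import complex.
From mathcomp Require Import all_classical all_reals all_analysis.
(* The notations of mpoly clash with those of mathcomp-analysis. *)
From mathcomp Require Import -(notations) mpoly.

Set Implicit Arguments.
Unset Strict Implicit.
Unset Printing Implicit Defensive.

Import Order.TTheory GRing.Theory Num.Theory numFieldNormedType.Exports.
Local Open Scope classical_set_scope.
Local Open Scope ring_scope.
Local Open Scope complex_scope.

(** * Polynomial maps over K = R or K = C *)

(* [ground] is the choice K = R or K = C.  The space K^n is always handled as
   the real vector space 'rV[R]_(kdim K n): for K = C the first n coordinates
   are the real parts and the last n ones the imaginary parts.  In particular
   K itself is 'rV[R]_(kdim K 1). *)
Variant ground := RealGround | ComplexGround.

Definition kdim (K : ground) (n : nat) : nat :=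
  match K with RealGround => n | ComplexGround => (n + n)%N end.

Definition gfield (R : realType) (K : ground) : fieldType :=
  match K with RealGround => R : fieldType | ComplexGround => R[i] : fieldType end.

Definition kspace (R : realType) (K : ground) (n : nat) := 'rV[R]_(kdim K n).

Definition coordinate (R : realType) (K : ground) (n : nat) :
    kspace R K n -> 'I_n -> gfield R K :=
  match K return kspace R K n -> 'I_n -> gfield R K with
  | RealGround => fun x i => x 0 i
  | ComplexGround => fun x i =>
      (lsubmx (x : 'rV[R]_(n + n)) 0 i) +i* (rsubmx (x : 'rV[R]_(n + n)) 0 i)
  end.

Definition realify (R : realType) (K : ground) (n : nat) :
    ('I_n -> gfield R K) -> kspace R K n :=
  match K return ('I_n -> gfield R K) -> kspace R K n with
  | RealGround => fun z => \row_i (z i : R)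
  | ComplexGround => fun z =>
      row_mx (\row_i complex.Re (z i : R[i])) (\row_i complex.Im (z i : R[i]))
  end.

(* Real polynomials in x_1, .., x_n, resp. mixed polynomials, which are
   polynomials in x_1, .., x_n and their conjugates: a monomial in n + n
   variables is a pair (nu, mu), and stands for x^nu (conj x)^mu. *)
Definition kpoly (R : realType) (K : ground) (n : nat) :=
  mpoly (kdim K n) (gfield R K).

Definition var_values (R : realType) (K : ground) (n : nat) :
    kspace R K n -> 'I_(kdim K n) -> gfield R K :=
  match K return kspace R K n -> 'I_(kdim K n) -> gfield R K with
  | RealGround => fun x i => @coordinate R RealGround n x i
  | ComplexGround => fun x (i : 'I_(n + n)) =>
      match fintype.split i with
      | inl j => @coordinate R ComplexGround n x j
      | inr j => conjc (@coordinate R ComplexGround n x j)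
      end
  end.

Definition peval (R : realType) (K : ground) (n : nat) (g : kpoly R K n)
    (x : kspace R K n) : gfield R K :=
  meval (var_values x) g.

(* nu for a real monomial, nu + mu for a mixed one. *)
Definition exponent (R : realType) (K : ground) (n : nat) :
    multinom (kdim K n) -> 'rV[R]_n :=
  match K return multinom (kdim K n) -> 'rV[R]_n with
  | RealGround => fun m => \row_i (m i)%:R
  | ComplexGround => fun m => \row_i (m (lshift n i) + m (rshift n i))%:R
  end.

Definition supp (R : realType) (K : ground) (n : nat) (g : kpoly R K n) :
    set 'rV[R]_n :=
  [set exponent R m | m in [set m | mcoeff m g != 0]].

Definition restrict_poly (R : realType) (K : ground) (n : nat)
    (A : set 'rV[R]_n) (g : kpoly R K n) : kpoly R K n :=
  \sum_(m <- msupp g | `[< A (exponent R m) >]) mcoeff m g *: mpolyX _ m.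

Definition kmap (R : realType) (K : ground) (n p : nat) := 'I_p -> kpoly R K n.

Definition eval_map (R : realType) (K : ground) (n p : nat) (f : kmap R K n p)
    (x : kspace R K n) : kspace R K p :=
  realify (fun j => peval (f j) x).

Definition fixes_origin (R : realType) (K : ground) (n p : nat)
    (f : kmap R K n p) : Prop :=
  eval_map f 0 = 0.

Definition zero_locus (R : realType) (K : ground) (n p : nat)
    (f : kmap R K n p) : set (kspace R K n) :=
  [set x | eval_map f x = 0].

Definition singular_locus (R : realType) (K : ground) (n p : nat)
    (f : kmap R K n p) : set (kspace R K n) :=
  [set x | (\rank (jacobian (eval_map f) x) < kdim K p)%N].

(* Points of K^n whose nonzero coordinates are exactly those in I. *)
Definition torus (R : realType) (K : ground) (n : nat) (I : {set 'I_n}) :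
    set (kspace R K n) :=
  [set x | forall i, (coordinate x i != 0) = (i \in I)].

(** * C-face diagrams *)

(* Linear forms with rational coefficients and weight vectors are both
   represented by their rational coordinates. *)
Definition dot (R : realType) (n : nat) (u nu : 'rV[R]_n) : R :=
  \sum_i u 0 i * nu 0 i.

Definition pairing (R : realType) (n : nat) (w : 'rV[rat]_n) (nu : 'rV[R]_n) : R :=
  dot (map_mx ratr w) nu.

Definition positive_vec (n : nat) (w : 'rV[rat]_n) : Prop :=
  forall i, 0 < w 0 i.

Definition orthant (R : realType) (n : nat) : set 'rV[R]_n :=
  [set nu | forall i, 0 <= nu 0 i].

Definition coord_subspace (R : realType) (n : nat) (I : {set 'I_n}) :
    set 'rV[R]_n :=
  [set nu | forall i, i \notin I -> nu 0 i = 0].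

Definition diagram_of (R : realType) (n : nat) (J : seq 'rV[rat]_n) :
    set 'rV[R]_n :=
  [set nu | [/\ orthant nu, exists2 l, l \in J & pairing l nu = 1 &
                forall l, l \in J -> 1 <= pairing l nu]].

Definition presents (R : realType) (n : nat) (J : seq 'rV[rat]_n)
    (D : set 'rV[R]_n) : Prop :=
  [/\ J <> [::], forall l, l \in J -> positive_vec l & D = diagram_of J].

Definition is_Cface_diagram (R : realType) (n : nat) (D : set 'rV[R]_n) : Prop :=
  exists J, presents J D.

(* On a C-face diagram the infimum is attained. *)
Definition weight_diagram (R : realType) (n : nat) (w : 'rV[rat]_n)
    (D : set 'rV[R]_n) : R :=
  inf [set pairing w nu | nu in D].

Definition Delta (R : realType) (n : nat) (w : 'rV[rat]_n) (D : set 'rV[R]_n) :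
    set 'rV[R]_n :=
  [set nu | D nu /\ pairing w nu = weight_diagram w D].

(* The support is finite, and the infimum of the empty set is +oo. *)
Definition weight_poly (R : realType) (K : ground) (n : nat) (w : 'rV[rat]_n)
    (g : kpoly R K n) : \bar R :=
  ereal_inf [set (pairing w nu)%:E | nu in supp g].

(* The faces do not depend on the presentation J of D: a form that is
   redundant in J only cuts out intersections of faces given by the others. *)
Definition is_face (R : realType) (n : nat) (D Phi : set 'rV[R]_n) : Prop :=
  exists J (I : {set 'I_n}) (J' : seq 'rV[rat]_n),
    [/\ presents J D, J' <> [::], {subset J' <= J},
        Phi = [set nu | [/\ D nu, coord_subspace I nu &
                           forall l, l \in J' -> pairing l nu = 1]] &
        Phi !=set0].

Definition inner (R : realType) (n : nat) (Phi : set 'rV[R]_n) : Prop :=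
  forall I : {set 'I_n}, I != [set: 'I_n]%SET -> ~ (Phi `<=` coord_subspace I).

(* The rows of M form a basis of the direction of the affine span of A. *)
Definition has_dim (R : realType) (n : nat) (A : set 'rV[R]_n) (d : nat) : Prop :=
  exists2 a, A a &
    exists M : 'M[R]_(d, n),
      [/\ row_free M, forall i, A (a + row i M) &
          forall nu, A nu -> (nu - a <= M)%MS].

(* P is a possible choice of the set P(D); the weight vectors are determined
   only up to positive multiples. *)
Definition facet_weights (R : realType) (n : nat) (D : set 'rV[R]_n)
    (P : seq 'rV[rat]_n) : Prop :=
  [/\ forall w, w \in P ->
        [/\ positive_vec w, is_face D (Delta w D) & has_dim (Delta w D) n.-1],
      forall w w', w \in P -> w' \in P -> Delta w D = Delta w' D -> w = w' &
      forall Phi, is_face D Phi -> has_dim Phi n.-1 ->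
        exists2 w, w \in P & Delta w D = Phi].

Definition minkowski_sum (R : realType) (n p : nat) (A : 'I_p -> set 'rV[R]_n) :
    set 'rV[R]_n :=
  [set \sum_j nu j | nu in [set nu : 'I_p -> 'rV[R]_n | forall j, A j (nu j)]].

Definition polyhedron_face (R : realType) (n : nat) (Q Phi : set 'rV[R]_n) : Prop :=
  Phi !=set0 /\
  exists u : 'rV[R]_n,
    Phi = [set nu | Q nu /\ forall mu, Q mu -> dot u nu <= dot u mu].

Definition diagram_sum (R : realType) (n p : nat) (D : 'I_p -> set 'rV[R]_n) :
    set 'rV[R]_n :=
  let Q := minkowski_sum
    (fun j => [set nu + mu | nu in D j & mu in @orthant R n]) in
  [set nu | exists Phi, [/\ polyhedron_face Q Phi, compact Phi & Phi nu]].

Definition restrict_map (R : realType) (K : ground) (n p : nat)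
    (A : 'I_p -> set 'rV[R]_n) (f : kmap R K n p) : kmap R K n p :=
  fun j => restrict_poly (A j) (f j).

Definition SIKND (R : realType) (K : ground) (n p : nat)
    (D : 'I_p -> set 'rV[R]_n) (P : 'I_p -> seq 'rV[rat]_n)
    (f : kmap R K n p) : Prop :=
  (forall j w, w \in P j ->
     ((weight_diagram w (D j))%:E <= weight_poly w (f j))%E) /\
  (forall (Phi : set 'rV[R]_n) (Phis : 'I_p -> set 'rV[R]_n),
     is_face (diagram_sum D) Phi -> inner Phi ->
     (forall j, is_face (D j) (Phis j)) -> Phi = minkowski_sum Phis ->
     forall I : {set 'I_n}, I != finset.set0 ->
       Phi `&` coord_subspace I !=set0 ->
       singular_locus (restrict_map Phis f) `&` torus I = set0).

(** * Deformations *)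

Definition power_sum (R : realType) (m : nat) (c : multinom m -> R)
    (x : 'rV[R]_m) (N : nat) : R :=
  \sum_(k : bmultinom m N) c (bmnm k) * \prod_i x 0 i ^+ (bmnm k) i.

Definition analytic_on (R : realType) (m : nat) (U : set 'rV[R]_m)
    (g : 'rV[R]_m -> R) : Prop :=
  forall a, U a ->
    exists (c : multinom m -> R) (r : R), 0 < r /\
      forall x, ball a r x ->
        cvgn (power_sum (fun k => `|c k|) (map_mx Num.norm (x - a))) /\
        power_sum c (x - a) N @[N --> \oo] --> g x.

Definition kfamily (R : realType) (K : ground) (n p : nat) :=
  kspace R K 1 -> kmap R K n p.

Definition is_deformation (R : realType) (K : ground) (n p : nat)
    (f : kmap R K n p) (F : kfamily R K n p) : Prop :=
  [/\ forall j, F 0 j = f j,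
      forall e, fixes_origin (F e) &
      forall j (m : multinom (kdim K n)) (i : 'I_(kdim K 1)),
        analytic_on setT
          (fun e : kspace R K 1 =>
             realify (fun _ : 'I_1 => mcoeff m (F e j)) 0 i)].

Definition homeomorphic_on (R : realType) (d : nat) (A : set 'rV[R]_d)
    (h : 'rV[R]_d -> 'rV[R]_d) : Prop :=
  exists k : 'rV[R]_d -> 'rV[R]_d,
    [/\ {within A, continuous h}, {within h @` A, continuous k} &
        forall x, A x -> k (h x) = x].

(* W is a common domain for representatives of the germs h_e. *)
Definition topologically_trivial_along (R : realType) (K : ground) (n p : nat)
    (F : kfamily R K n p) (T : set (kspace R K 1)) : Prop :=
  exists (W : set (kspace R K n * kspace R K 1))
         (h : kspace R K n * kspace R K 1 -> kspace R K n),
    [/\ open W,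
        {within W `&` [set z | T z.2], continuous h} &
        forall e, T e ->
          let We := [set x | W (x, e)] in
          let he := fun x => h (x, e) in
          [/\ We 0 /\ he 0 = 0, homeomorphic_on We he, open (he @` We) &
              forall x, We x -> eval_map (F 0) x = eval_map (F e) (he x)]].

Definition topologically_trivial (R : realType) (K : ground) (n p : nat)
    (F : kfamily R K n p) : Prop :=
  topologically_trivial_along F setT.

(** * Uniform Milnor radius *)

(* rho is a total function of which only the restriction to U matters;
   properness is that of rho : U -> [0, +oo[. *)
Definition control_function (R : realType) (d : nat) (U : set 'rV[R]_d)
    (rho : 'rV[R]_d -> R) : Prop :=
  [/\ open U /\ U 0, analytic_on U rho,
      forall x, U x -> 0 <= rho x,
      forall x, U x -> (rho x = 0 <-> x = 0) &
      forall C : set R, C `<=` [set t | 0 <= t] -> compact C ->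
        compact (U `&` rho @^-1` C)].

(* Transversality of V(f) and rho^-1(s): the real Jacobian of (f, rho) has
   rank dim_R K^p + 1. *)
Definition transversal_level (R : realType) (K : ground) (n p : nat)
    (U : set (kspace R K n)) (rho : kspace R K n -> R) (f : kmap R K n p)
    (s : R) : Prop :=
  forall x, U x -> zero_locus f x -> rho x = s ->
    \rank (jacobian (fun y => row_mx (eval_map f y) (rho y)%:M) x)
      = (kdim K p).+1.

Definition uniform_Milnor_radius_along (R : realType) (K : ground) (n p : nat)
    (U : set (kspace R K n)) (rho : kspace R K n -> R) (F : kfamily R K n p)
    (T : set (kspace R K 1)) : Prop :=
  exists2 s0 : R, 0 < s0 &
    forall s e, 0 < s <= s0 -> T e -> transversal_level U rho (F e) s.

Definition uniform_Milnor_radius (R : realType) (K : ground) (n p : nat)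
    (U : set (kspace R K n)) (rho : kspace R K n -> R) (F : kfamily R K n p) :
    Prop :=
  forall T : set (kspace R K 1), connected T -> compact T -> T 0 ->
    uniform_Milnor_radius_along U rho F T.

(* Main.v *)
From HB Require Import structures.
Require Import Defs.
From mathcomp Require Import all_boot all_order all_algebra.
From mathcomp Require Import complex.
From mathcomp Require Import all_classical all_reals all_analysis.
From mathcomp Require Import ring lra.
From mathcomp Require Import -(notations) mpoly.
Set Implicit Arguments.
Unset Strict Implicit.
Unset Printing Implicit Defensive.
Import Order.TTheory GRing.Theory Num.Theory numFieldNormedType.Exports.
Local Open Scope classical_set_scope.
Local Open Scope ring_scope.

(** The deformation is trivialised by a flow.  While the parameter moves from
    one value to another with constant velocity [u], a point [x] near the origin
    is moved by a vector field [v] such that the value [F e x] does not change.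
    This asks that [v], applied to the differential of [F e], cancel the change
    [u *m Je] caused by the parameter.  If [v] also changes [rho] only by a
    multiple of the squared norm [sq] of the value, then a trajectory starting
    near the origin stays there up to time 1, because [sq] is small near the
    origin and constant along the trajectory; and it does not run into the
    origin, because [sq] vanishes there, whereas for [sq = 0] the function [rho]
    is constant ([joined_small]).  Moving along the trajectories is then a
    homeomorphism, whose inverse moves back ([admissible_trivial]).

    The field is found by solving a linear system with the Gram matrix of the
    differentials of the components and of [rho], to whose last entry [sq] is
    added ([Mmat]).  The system is solvable as soon as the components have
    independent differentials and, on the zero fibre only, [rho] is independent
    of them ([Mmat_det]).  The second condition is the uniform Milnor radius.
    The first one says that [F e] has no critical points near the origin other
    than the origin, and comes from the Newton diagrams ([no_critical]).

    To see it, let critical points [x] of [F e] tend to the origin, with [e]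
    tending to [es].  The orders at which the coordinates of [x] decay, measured
    by their logarithms, are extended to a weight vector whose face is inner and
    meets the coordinate subspace of [x] ([adapted_weight]).  Rescaling the
    coordinates by the weights keeps the points bounded, and in the rescaled map
    only the terms on the face survive in the limit.  If the terms of [F es] on
    the diagrams are those of [f], the limit point is a singular point of a face
    part of [f] excluded by the nondegeneracy condition.  The assumption on the
    diagrams holds for [es = 0], which yields triviality for small parameters.
    It holds for every [es] when the inequalities are strict; then compactness
    yields a uniform neighbourhood over each ball of parameters, and triviality
    along all of them.

    The convex geometry behind this is rational and elementary: Fourier-Motzkin
    elimination shows that sums of polyhedra above C-face diagrams are again of
    this kind ([upper_sum2]) and have finitely many vertices ([upper_vertices]),
    and a presentation by as few forms as possible consists of facet forms
    ([facet_forms]), so that the conditions at the facet weights say that the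
    exponents lie above the diagrams ([supp_upper]).  Of real analyticity two
    consequences are used: gradients are locally Lipschitz, so that trajectories
    exist and depend continuously on their start ([analytic_c11]); and countably
    many nonzero functions have a common nonzero point, so that the degrees of
    the polynomials in the family are bounded ([deformation_degree]).  Limits
    are taken along ultrafilters, where bounded families converge without
    passing to subsequences. *)

(** * Linear forms and the elimination of unknowns *)

Lemma dotDr (R : realType) n (u v w : 'rV[R]_n) : dot u (v + w) = dot u v + dot u w.
Proof. by rewrite /dot -big_split; apply: eq_bigr => i _; rewrite mxE mulrDr. Qed.

Lemma dotC (R : realType) n (u v : 'rV[R]_n) : dot u v = dot v u.
Proof. by rewrite /dot; apply: eq_bigr => i _; rewrite mulrC. Qed.

Lemma dotZr (R : realType) n (u v : 'rV[R]_n) c : dot u (c *: v) = c * dot u v.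
Proof. by rewrite /dot mulr_sumr; apply: eq_bigr => i _; rewrite mxE; ring. Qed.

Lemma dotDl (R : realType) n (u v w : 'rV[R]_n) : dot (u + v) w = dot u w + dot v w.
Proof. by rewrite dotC dotDr dotC (dotC w). Qed.

Lemma dotZl (R : realType) n (u v : 'rV[R]_n) c : dot (c *: u) v = c * dot u v.
Proof. by rewrite dotC dotZr dotC. Qed.

Lemma dotNr (R : realType) n (u v : 'rV[R]_n) : dot u (- v) = - dot u v.
Proof. by rewrite -scaleN1r dotZr mulN1r. Qed.

Lemma dotBr (R : realType) n (u v w : 'rV[R]_n) : dot u (v - w) = dot u v - dot u w.
Proof. by rewrite dotDr dotNr. Qed.

Lemma dotBl (R : realType) n (u v w : 'rV[R]_n) : dot (u - v) w = dot u w - dot v w.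
Proof. by rewrite dotC dotBr dotC (dotC w). Qed.

Lemma dot0r (R : realType) n (u : 'rV[R]_n) : dot u 0 = 0.
Proof. by rewrite /dot big1// => i _; rewrite mxE mulr0. Qed.

Lemma dot0l (R : realType) n (u : 'rV[R]_n) : dot 0 u = 0.
Proof. by rewrite dotC dot0r. Qed.

Lemma dot_sumr (R : realType) n I (r : seq I) (P : pred I) (u : 'rV[R]_n) F :
  dot u (\sum_(i <- r | P i) F i) = \sum_(i <- r | P i) dot u (F i).
Proof. by elim/big_rec2: _ => [|i x y _ <-]; rewrite ?dot0r ?dotDr. Qed.

Lemma dot_deltar (R : realType) n (u : 'rV[R]_n) i : dot u (delta_mx 0 i) = u 0 i.
Proof.
rewrite /dot (bigD1 i)//= big1 ?addr0 ?mxE ?eqxx ?mulr1// => j ji.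
by rewrite mxE (negbTE ji) andbF mulr0.
Qed.

Lemma dot_mulmx (R : realType) n (u v : 'rV[R]_n) : dot u v = (u *m v^T) 0 0.
Proof. by rewrite /dot mxE; apply: eq_bigr => i _; rewrite mxE. Qed.

Lemma dot_ge0 (R : realType) n (u v : 'rV[R]_n) :
  orthant u -> orthant v -> 0 <= dot u v.
Proof. by move=> u0 v0; apply: sumr_ge0 => i _; apply: mulr_ge0. Qed.

Lemma dot_gt0 (R : realType) n (u v : 'rV[R]_n) :
  (forall i, 0 < u 0 i) -> orthant v -> v != 0 -> 0 < dot u v.
Proof.
move=> u0 v0 vn0; have uo : orthant u by move=> i; exact: ltW.
rewrite lt_neqAle dot_ge0// andbT eq_sym; apply: contra vn0 => /eqP.
move=> uv; apply/eqP/rowP => i; rewrite mxE; apply/eqP.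
have := psumr_eq0P (fun i _ => mulr_ge0 (uo i) (v0 i)) uv.
by move/(_ i isT)/eqP; rewrite mulf_eq0 gt_eqF.
Qed.

Lemma orthant0 (R : realType) n : orthant (0 : 'rV[R]_n).
Proof. by move=> i; rewrite mxE. Qed.

Lemma orthantD (R : realType) n (u v : 'rV[R]_n) :
  orthant u -> orthant v -> orthant (u + v).
Proof. by move=> u0 v0 i; rewrite mxE addr_ge0. Qed.

Lemma orthantZ (R : realType) n c (u : 'rV[R]_n) :
  0 <= c -> orthant u -> orthant (c *: u).
Proof. by move=> c0 u0 i; rewrite mxE mulr_ge0. Qed.

Lemma orthant_delta (R : realType) n (i : 'I_n) : orthant (delta_mx 0 i : 'rV[R]_n).
Proof. by move=> j; rewrite mxE ler0n. Qed.

Lemma ratr_mx_ge0 (R : realType) n (a : 'rV[rat]_n) :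
  (forall i, 0 <= a 0 i) -> orthant (map_mx ratr a : 'rV[R]_n).
Proof. by move=> a0 i; rewrite mxE ler0q. Qed.

Lemma positive_orthant (R : realType) n (a : 'rV[rat]_n) :
  positive_vec a -> orthant (map_mx ratr a : 'rV[R]_n).
Proof. by move=> a0; apply: ratr_mx_ge0 => i; exact: ltW. Qed.

Lemma positive_ratr (R : realType) n (a : 'rV[rat]_n) :
  positive_vec a -> forall i, 0 < (map_mx ratr a : 'rV[R]_n) 0 i.
Proof. by move=> a0 i; rewrite mxE ltr0q. Qed.

Lemma small_enough (R : realType) (T : eqType) (s : seq T) (Q : R -> T -> Prop) :
  (forall x, x \in s -> exists2 d, 0 < d & forall e, 0 < e <= d -> Q e x) ->
  exists2 d, 0 < d & forall e, 0 < e <= d -> forall x, x \in s -> Q e x.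
Proof.
elim: s => [|a s IH] H; first by exists 1.
have [x xs|d1 d10 H1] := IH; first by apply: H; rewrite inE xs orbT.
have [|d2 d20 H2] := H a; first by rewrite inE eqxx.
exists (Num.min d1 d2); first by rewrite lt_min d10.
move=> e /andP[e0]; rewrite le_min => /andP[e1 e2] x.
rewrite inE => /orP[/eqP->|xs]; first by apply: H2; rewrite e0.
by apply: H1 => //; rewrite e0.
Qed.

Lemma large_enough (R : realType) (T : eqType) (s : seq T) (Q : R -> T -> Prop) :
  (forall x, x \in s -> exists d, forall e, d <= e -> Q e x) ->
  exists2 d, 0 < d & forall e, d <= e -> forall x, x \in s -> Q e x.
Proof.
elim: s => [|a s IH] H; first by exists 1.
have [x xs|d1 d10 H1] := IH; first by apply: H; rewrite inE xs orbT.
have [|d2 H2] := H a; first by rewrite inE eqxx.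
exists (Num.max d1 d2); first by rewrite lt_max d10.
move=> e; rewrite ge_max => /andP[e1 e2] x.
by rewrite inE => /orP[/eqP->|xs]; [apply: H2 | apply: H1].
Qed.

Lemma exists_argmin (R : realType) (T : eqType) (s : seq T) (f : T -> R) :
  s <> [::] -> exists2 x, x \in s & forall y, y \in s -> f x <= f y.
Proof.
elim: s => // a s IH _; have [->|/eqP/IH[x xs xm]] := eqVneq s [::].
  by exists a; rewrite ?inE// => y; rewrite inE => /eqP->.
have [fax|fxa] := leP (f a) (f x).
  exists a; first by rewrite inE eqxx.
  by move=> y; rewrite inE => /orP[/eqP->//|/xm]; exact: le_trans.
exists x; first by rewrite inE xs orbT.
by move=> y; rewrite inE => /orP[/eqP->|/xm//]; exact: ltW.
Qed.

Lemma exists_between (R : realType) (A B : seq R) :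
  (forall a b, a \in A -> b \in B -> a <= b) ->
  exists y, (forall a, a \in A -> a <= y) /\ (forall b, b \in B -> y <= b).
Proof.
move=> AB; have [->|/eqP A0] := eqVneq A [::].
  have [->|/eqP B0] := eqVneq B [::]; first by exists 0; split.
  by have [x xB xm] := exists_argmin id B0; exists x; split => // b /xm.
have [x xA xm] := exists_argmin (fun x => - x) A0.
exists x; split=> [a /xm|b bB]; first by rewrite lerN2.
exact: AB.
Qed.

Definition sat (R : realType) k (s : 'rV[rat]_k * rat) (x : 'rV[R]_k) :=
  ratr s.2 <= pairing s.1 x.

Lemma pairing_row (R : realType) k k' (a : 'rV[rat]_k) (b : 'rV[rat]_k')
    (z : 'rV[R]_(k + k')) :
  pairing (row_mx a b) z = pairing a (lsubmx z) + pairing b (rsubmx z).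
Proof.
rewrite /pairing /dot big_split_ord /=; congr (_ + _); apply: eq_bigr => i _.
  by rewrite !mxE (unsplitK (inl _)).
by rewrite !mxE (unsplitK (inr _)).
Qed.

Lemma pairingDr (R : realType) n w (u v : 'rV[R]_n) :
  pairing w (u + v) = pairing w u + pairing w v.
Proof. exact: dotDr. Qed.

Lemma pairingZr (R : realType) n w c (u : 'rV[R]_n) :
  pairing w (c *: u) = c * pairing w u.
Proof. exact: dotZr. Qed.

Lemma pairingBr (R : realType) n w (u v : 'rV[R]_n) :
  pairing w (u - v) = pairing w u - pairing w v.
Proof. exact: dotBr. Qed.

Lemma pairingDl (R : realType) n w w' (u : 'rV[R]_n) :
  pairing (w + w') u = pairing w u + pairing w' u.
Proof. by rewrite /pairing map_mxD dotDl. Qed.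

Lemma pairingZl (R : realType) n c w (u : 'rV[R]_n) :
  pairing (c *: w) u = ratr c * pairing w u.
Proof. by rewrite /pairing map_mxZ dotZl. Qed.

Lemma pairingNl (R : realType) n w (u : 'rV[R]_n) :
  pairing (- w) u = - pairing w u.
Proof. by rewrite -scaleN1r pairingZl rmorphN1 mulN1r. Qed.

Lemma pairingBl (R : realType) n w w' (u : 'rV[R]_n) :
  pairing (w - w') u = pairing w u - pairing w' u.
Proof. by rewrite pairingDl pairingNl. Qed.

Lemma pairing0r (R : realType) n w : pairing w (0 : 'rV[R]_n) = 0.
Proof. exact: dot0r. Qed.

Lemma pairing0l (R : realType) n (u : 'rV[R]_n) : pairing 0 u = 0.
Proof. by rewrite /pairing map_mx0 dot0l. Qed.

Lemma pairing_deltal (R : realType) n i (u : 'rV[R]_n) :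
  pairing (delta_mx 0 i) u = u 0 i.
Proof. by rewrite /pairing map_delta_mx dotC dot_deltar. Qed.

Lemma pairing_ge0 (R : realType) n w (u : 'rV[R]_n) :
  positive_vec w -> orthant u -> 0 <= pairing w u.
Proof. by move=> /(positive_orthant R) w0 u0; exact: dot_ge0. Qed.

(** Fourier-Motzkin: an unknown is eliminated by comparing each of its lower
    bounds with each of its upper bounds. *)
Lemma eliminate_one (R : realType) k (S : seq ('rV[rat]_(1 + k) * rat)) :
  exists S' : seq ('rV[rat]_k * rat), forall x : 'rV[R]_k,
    (forall s, s \in S' -> sat s x) <->
    exists z : 'rV[R]_(1 + k), rsubmx z = x /\ forall s, s \in S -> sat s z.
Proof.
pose h (s : 'rV[rat]_(1 + k) * rat) : rat := lsubmx s.1 0 0.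
pose r (s : 'rV[rat]_(1 + k) * rat) := rsubmx s.1.
pose Sp := [seq s <- S | 0 < h s]; pose Sn := [seq s <- S | h s < 0].
pose cmb (a b : 'rV[rat]_(1 + k) * rat) :=
  (h a *: r b - h b *: r a, h a * b.2 - h b * a.2).
exists ([seq (r s, s.2) | s <- S & h s == 0] ++ [seq cmb a b | a <- Sp, b <- Sn]).
move=> x.
have pE (s : 'rV[rat]_(1 + k) * rat) (z : 'rV[R]_(1 + k)) : rsubmx z = x ->
    pairing s.1 z = ratr (h s) * lsubmx z 0 0 + pairing (r s) x.
  move=> <-; rewrite -[s.1 in LHS]hsubmxK pairing_row; congr (_ + _).
  by rewrite /pairing /dot big_ord1 mxE.
split=> [H|[z [zx H]] s]; last first.
  rewrite mem_cat => /orP[/mapP[s' + ->]|/allpairsP[[a b] [/= + + ->]]].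
    rewrite mem_filter => /andP[/eqP h0 /H]; rewrite /sat (pE _ _ zx).
    by rewrite h0 rmorph0 mul0r add0r.
  rewrite !mem_filter => /andP[ha /H] + /andP[hb /H].
  rewrite /sat !(pE _ _ zx) /= pairingBl !pairingZl rmorphB !rmorphM /=.
  set y := lsubmx z 0 0.
  have {}ha : 0 < ratr (h a) :> R by rewrite ltr0q.
  have {}hb : ratr (h b) < 0 :> R by rewrite ltrq0.
  nra.
pose bd s : R := (ratr s.2 - pairing (r s) x) / ratr (h s).
have [|y [ylo yup]] := @exists_between R [seq bd s | s <- Sp] [seq bd s | s <- Sn].
  move=> _ _ /mapP[a aS ->] /mapP[b bS ->].
  have : sat (cmb a b) x.
    by apply: H; rewrite mem_cat allpairs_f ?orbT.
  move: aS bS; rewrite !mem_filter => /andP[ha _] /andP[hb _].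
  rewrite /sat /= pairingBl !pairingZl rmorphB !rmorphM /= /bd.
  have {}ha : 0 < ratr (h a) :> R by rewrite ltr0q.
  have {}hb : ratr (h b) < 0 :> R by rewrite ltrq0.
  move=> cab; rewrite ler_pdivrMr// mulrAC ler_ndivlMr//; nra.
exists (row_mx y%:M x); rewrite row_mxKr; split=> // s sS.
rewrite /sat (pE _ _ (row_mxKr _ _)) row_mxKl mxE eqxx mulr1n.
have [h0|h0|h0] := ltgtP (h s) 0.
- have : y <= bd s by apply: yup; apply: map_f; rewrite mem_filter h0.
  by rewrite /bd ler_ndivlMr ?ltrq0//; lra.
- have : bd s <= y by apply: ylo; apply: map_f; rewrite mem_filter h0.
  by rewrite /bd ler_pdivrMr ?ltr0q//; lra.
- have : sat (r s, s.2) x.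
    apply: H; rewrite mem_cat; apply/orP; left.
    by apply/mapP; exists s => //; rewrite mem_filter h0 eqxx.
  by rewrite /sat /= h0 rmorph0 mul0r add0r.
Qed.

Lemma eliminate (R : realType) k' k (S : seq ('rV[rat]_(k' + k) * rat)) :
  exists S' : seq ('rV[rat]_k * rat), forall x : 'rV[R]_k,
    (forall s, s \in S' -> sat s x) <->
    exists z : 'rV[R]_(k' + k), rsubmx z = x /\ forall s, s \in S -> sat s z.
Proof.
elim: k' S => [|k' IH] S.
  exists S => x; split=> [H|[z [<- H]] s /H].
    exists x; split=> //; apply/rowP => i; rewrite mxE.
    by congr (x _ _); exact/val_inj.
  by congr (sat _ _); apply/rowP => i; rewrite mxE; congr (z _ _); exact/val_inj.
have [S1 H1] := @eliminate_one R (k' + k) S.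
have [S' H'] := IH S1; exists S' => x; rewrite H'; split.
  move=> [z1 [z1x /H1[z [zz1 zS]]]]; exists z; split => //.
  rewrite -z1x -zz1; apply/rowP => i; rewrite !mxE.
  by congr (z _ _); exact/val_inj.
move=> [z [zx zS]]; exists (@rsubmx R 1 1 (k' + k) z); split; last first.
  by apply/H1; exists z.
rewrite -zx; apply/rowP => i; rewrite !mxE.
by congr (z _ _); exact/val_inj.
Qed.

(** * Polyhedra above C-face diagrams and their vertices *)

(** The region above the diagram presented by [J], that is, the sum of the diagram
    and the orthant, as [upperE] shows. *)
Definition upper (R : realType) n (J : seq 'rV[rat]_n) : set 'rV[R]_n :=
  [set nu | orthant nu /\ forall l, l \in J -> 1 <= pairing l nu].
Arguments upper : clear implicits.

Definition positive_forms n (J : seq 'rV[rat]_n) :=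
  forall l, l \in J -> positive_vec l.

Lemma upperD (R : realType) n (J : seq 'rV[rat]_n) (u h : 'rV[R]_n) :
  positive_forms J -> upper R n J u -> orthant h -> upper R n J (u + h).
Proof.
move=> Jp [u0 uJ] h0; split=> [|l lJ]; first exact: orthantD.
rewrite pairingDr; apply: le_trans (uJ _ lJ) _.
by rewrite lerDl pairing_ge0//; exact: Jp.
Qed.

Lemma upper_axis (R : realType) n (J : seq 'rV[rat]_n) (i : 'I_n) :
  positive_forms J -> exists2 c : R, 0 < c & upper R n J (c *: delta_mx 0 i).
Proof.
move=> Jp.
have [|d d0 H] := @large_enough R _ J (fun e l => 1 <= pairing l (e *: delta_mx 0 i)).
  move=> l lJ; exists (map_mx ratr l 0 i)^-1 => e.
  have l0 := positive_ratr R (Jp _ lJ) i.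
  by rewrite pairingZr /pairing dot_deltar -ler_pdivrMr// div1r.
exists d => //; split; first exact: orthantZ (ltW d0) (@orthant_delta _ _ _).
by move=> l; apply: H.
Qed.

(** A form with a negative coefficient would be violated far out on an axis.  So
    all coefficients are nonnegative, an inequality with a nonpositive bound holds
    on the whole orthant, and the other ones can be scaled to have the bound 1. *)
Lemma upward_block (R : realType) n (S : seq ('rV[rat]_n * rat)) :
  let B := [set x : 'rV[R]_n | forall s, s \in S -> sat s x] in
  B !=set0 -> (forall x h, B x -> orthant h -> B (x + h)) ->
  exists A : seq 'rV[rat]_n,
    (forall a, a \in A -> forall i, 0 <= a 0 i) /\
    forall x, orthant x -> (B x <-> forall a, a \in A -> 1 <= pairing a x).
Proof.
move=> B [x0 Bx0] Bup.
have S0 s : s \in S -> forall i, 0 <= s.1 0 i.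
  move=> sS i; rewrite leNgt; apply/negP => si.
  have si' : ratr (s.1 0 i) < 0 :> R by rewrite ltrq0.
  pose t := (ratr s.2 - pairing s.1 x0 - 1) / ratr (s.1 0 i).
  have t0 : 0 <= t.
    rewrite /t -mulrNN mulr_ge0//; last by rewrite -invrN invr_ge0 oppr_ge0 ltW.
    by have := Bx0 _ sS; rewrite /sat; lra.
  have := Bup _ (t *: delta_mx 0 i) Bx0 (orthantZ t0 (@orthant_delta _ _ _)).
  move=> /(_ _ sS); rewrite /sat pairingDr pairingZr {2}/pairing dot_deltar mxE.
  by rewrite /t divfK ?lt_eqF//; lra.
exists [seq s.2^-1 *: s.1 | s <- S & 0 < s.2]; split.
  move=> a /mapP[s]; rewrite mem_filter => /andP[s2 sS] -> i.
  by rewrite mxE mulr_ge0 ?S0// invr_ge0 ltW.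
move=> x x0'; split=> [Bx a /mapP[s]|H s sS].
  rewrite mem_filter => /andP[s2 sS] ->; rewrite pairingZl fmorphV.
  by rewrite mulrC ler_pdivlMr ?ltr0q// mul1r; exact: Bx.
rewrite /sat; have [s2|s2] := ltP 0 s.2; last first.
  rewrite (@le_trans _ _ 0) ?lerq0// dot_ge0//.
  by apply: ratr_mx_ge0 => i; exact: S0.
have : s.2^-1 *: s.1 \in [seq s.2^-1 *: s.1 | s <- S & 0 < s.2].
  by apply/mapP; exists s => //; rewrite mem_filter s2.
move=> /H; rewrite pairingZl fmorphV mulrC ler_pdivlMr ?ltr0q//.
by rewrite mul1r.
Qed.

Lemma pairing_row0 (R : realType) k k' (a : 'rV[rat]_k) (z : 'rV[R]_(k + k')) :
  pairing (row_mx a 0) z = pairing a (lsubmx z).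
Proof. by rewrite pairing_row pairing0l addr0. Qed.

(** The sum is the projection of a polyhedron in twice as many unknowns, hence
    again given by finitely many rational inequalities.  The coefficients are
    positive, because the sum contains a point of each axis. *)
Lemma upper_sum2 (R : realType) n (J1 J2 : seq 'rV[rat]_n) :
  (0 < n)%N -> positive_forms J1 -> positive_forms J2 ->
  exists J3, positive_forms J3 /\ forall nu, upper R n J3 nu <->
    exists mu, upper R n J1 mu /\ upper R n J2 (nu - mu).
Proof.
move=> n0 J1p J2p.
(* The pairs (mu, nu) with mu in the first polyhedron and nu - mu in the second. *)
pose S : seq ('rV[rat]_(n + n) * rat) :=
  [seq (row_mx (delta_mx 0 i) 0, 0) | i <- enum 'I_n] ++
  [seq (row_mx (- delta_mx 0 i) (delta_mx 0 i), 0) | i <- enum 'I_n] ++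
  [seq (row_mx l 0, 1) | l <- J1] ++ [seq (row_mx (- l) l, 1) | l <- J2].
have SE (z : 'rV[R]_(n + n)) : (forall s, s \in S -> sat s z) <->
    upper R n J1 (lsubmx z) /\ upper R n J2 (rsubmx z - lsubmx z).
  split=> [H|[[u0 uJ] [v0 vJ]] s].
    split; split=> [i|l lJ].
    - have : sat (row_mx (delta_mx 0 i) 0, 0) z.
        by apply: H; rewrite mem_cat map_f ?mem_enum.
      by rewrite /sat /= pairing_row0 pairing_deltal rmorph0.
    - have : sat (row_mx l 0, 1) z by apply: H; rewrite !mem_cat map_f ?orbT.
      by rewrite /sat /= pairing_row0 rmorph1.
    - have : sat (row_mx (- delta_mx 0 i) (delta_mx 0 i), 0) z.
        by apply: H; rewrite !mem_cat (map_f _ (mem_enum _ i)) ?orbT.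
      rewrite /sat /= pairing_row pairingNl !pairing_deltal rmorph0 !mxE.
      lra.
    - have : sat (row_mx (- l) l, 1) z by apply: H; rewrite !mem_cat map_f ?orbT.
      rewrite /sat /= pairing_row pairingNl rmorph1 pairingBr; lra.
  rewrite !mem_cat /sat => /or4P[] /mapP[x xs ->] /=.
  - by rewrite pairing_row0 pairing_deltal rmorph0; exact: u0.
  - rewrite pairing_row pairingNl !pairing_deltal rmorph0.
    have := v0 x; rewrite !mxE; lra.
  - by rewrite pairing_row0 rmorph1; exact: uJ.
  - rewrite pairing_row pairingNl rmorph1; have := vJ _ xs.
    rewrite pairingBr; lra.
have [S' S'E] := @eliminate R n n S.
have BE (x : 'rV[R]_n) : (forall s, s \in S' -> sat s x) <->
    exists mu, upper R n J1 mu /\ upper R n J2 (x - mu).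
  rewrite S'E; split=> [[z [<- /SE[H1 H2]]]|[mu [H1 H2]]].
    by exists (lsubmx z).
  exists (row_mx mu x); rewrite row_mxKr; split=> //; apply/SE.
  by rewrite row_mxKr row_mxKl.
have ax (i : 'I_n) : exists2 c : R, 0 < c &
    forall s, s \in S' -> sat s (c *: delta_mx 0 i).
  have [c1 c10 H1] := @upper_axis R _ _ i J1p.
  have [c2 c20 H2] := @upper_axis R _ _ i J2p.
  exists (c1 + c2); first exact: addr_gt0.
  apply/BE; exists (c1 *: delta_mx 0 i); split=> //.
  by rewrite scalerDl addrC addKr.
have [i0 _] : exists i0 : 'I_n, true by exists (Ordinal n0).
have [|x h /BE[mu [H1 H2]] h0|A [A0 AE]] := @upward_block R n S'.
- by have [c _ Hc] := ax i0; exists (c *: delta_mx 0 i0).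
- by apply/BE; exists mu; split=> //; rewrite addrAC; exact: upperD.
have Apos : positive_forms A.
  move=> a aA i; rewrite lt_neqAle A0// andbT; apply/negP => /eqP ai0.
  have [c c0 Hc] := ax i.
  have /(AE _ (orthantZ (ltW c0) (@orthant_delta _ _ _)))/(_ _ aA) := Hc.
  by rewrite pairingZr /pairing dot_deltar mxE -ai0 rmorph0 mulr0 ler10.
exists A; split=> // nu; split=> [[nu0 nuA]|[mu [H1 H2]]].
  by apply/BE/AE.
have nu0 : orthant nu.
  by rewrite -(subrK mu nu); apply: orthantD; [case: H2 | case: H1].
by split=> //; apply/AE => //; apply/BE; exists mu.
Qed.

(** The support function of an upper polyhedron is the minimum over finitely
    many of its points: they are the forms that present its blocking
    polyhedron, the set of weights that are at least one on it. *)
Lemma upper_vertices (R : realType) n (J : seq 'rV[rat]_n) :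
  (0 < n)%N -> J <> [::] -> positive_forms J ->
  exists V : seq 'rV[R]_n,
    [/\ V <> [::], forall v, v \in V -> upper R n J v &
        forall w c, orthant w -> (forall v, v \in V -> c <= dot w v) ->
          forall nu, upper R n J nu -> c <= dot w nu].
Proof.
move=> n0 J0 Jp; pose k := size J; pose L (i : 'I_k) := tnth (in_tuple J) i.
have LJ i : L i \in J by exact: mem_tnth.
(* The pairs (lam, w) such that w is at least the combination of the forms with
   coefficients lam >= 0 of total at least 1; the weights w of such pairs form
   the blocking polyhedron. *)
pose S : seq ('rV[rat]_(k + n) * rat) :=
  (row_mx (const_mx 1) 0, 1) ::
  [seq (row_mx (delta_mx 0 i) 0, 0) | i <- enum 'I_k] ++
  [seq (row_mx (\row_l - L l 0 i) (delta_mx 0 i), 0) | i <- enum 'I_n].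
have SE (z : 'rV[R]_(k + n)) : (forall s, s \in S -> sat s z) <->
    [/\ 1 <= \sum_i lsubmx z 0 i, orthant (lsubmx z) &
        forall i, \sum_l lsubmx z 0 l * ratr (L l 0 i) <= rsubmx z 0 i].
  have e1 : pairing (row_mx (const_mx 1) 0) z = \sum_i lsubmx z 0 i.
    by rewrite pairing_row0; apply: eq_bigr => i _; rewrite [X in X * _]mxE mxE rmorph1 mul1r.
  have e2 i : pairing (row_mx (\row_l - L l 0 i) (delta_mx 0 i)) z =
      rsubmx z 0 i - \sum_l lsubmx z 0 l * ratr (L l 0 i).
    rewrite pairing_row pairing_deltal addrC; congr (_ + _).
    rewrite -sumrN; apply: eq_bigr => l _.
    by rewrite [X in X * _]mxE [X in ratr X]mxE rmorphN /= mulNr mulrC.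
  split=> [H|[H1 H2 H3] s].
    split=> [|i|i].
    - have : sat (row_mx (const_mx 1) 0, 1) z by apply: H; rewrite inE eqxx.
      by rewrite /sat /= e1 rmorph1.
    - have : sat (row_mx (delta_mx 0 i) 0, 0) z.
        by apply: H; rewrite inE mem_cat (map_f _ (mem_enum _ i)) ?orbT.
      by rewrite /sat /= pairing_row0 pairing_deltal rmorph0.
    - have : sat (row_mx (\row_l - L l 0 i) (delta_mx 0 i), 0) z.
        apply: H; rewrite inE mem_cat.
        by rewrite (map_f (fun i => (row_mx (\row_l - L l 0 i) _, 0)) (mem_enum _ i)) ?orbT.
      by rewrite /sat /= e2 rmorph0 subr_ge0.
  rewrite inE mem_cat /sat => /or3P[/eqP->/=|/mapP[i _ ->]/=|/mapP[i _ ->]/=].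
  - by rewrite e1 rmorph1.
  - by rewrite pairing_row0 pairing_deltal rmorph0; exact: H2.
  - by rewrite e2 rmorph0 subr_ge0; exact: H3.
have [S' S'E] := @eliminate R k n S.
have BE (x : 'rV[R]_n) : (forall s, s \in S' -> sat s x) <->
    exists lam : 'rV[R]_k, [/\ 1 <= \sum_i lam 0 i, orthant lam &
        forall i, \sum_l lam 0 l * ratr (L l 0 i) <= x 0 i].
  rewrite S'E; split=> [[z [<- /SE]]|[lam H]]; first by exists (lsubmx z).
  exists (row_mx lam x); rewrite row_mxKr; split=> //; apply/SE.
  by rewrite row_mxKr row_mxKl.
have BJ l : l \in J -> forall s, s \in S' -> sat s (map_mx ratr l : 'rV[R]_n).
  move=> lJ; apply/BE; have /tnthP[i li] : l \in in_tuple J by [].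
  exists (delta_mx 0 i); split=> [||j].
  - rewrite (bigD1 i)//= big1 ?addr0 ?mxE ?eqxx// => j ji.
    by rewrite mxE (negbTE ji) andbF.
  - exact: orthant_delta.
  - rewrite (bigD1 i)//= big1 ?addr0 => [|l' li'].
      by rewrite !mxE !eqxx /= mul1r /L -li.
    by rewrite mxE (negbTE li') andbF mul0r.
have [l0 l0J] : exists l0, l0 \in J.
  by case: (J) J0 => // a ? _; exists a; rewrite inE eqxx.
have [|x h /BE[lam [H1 H2 H3]] h0|A [A0 AE]] := @upward_block R n S'.
- by exists (map_mx ratr l0) => s; exact: BJ.
- apply/BE; exists lam; split=> // i; rewrite [leRHS]mxE.
  by apply: le_trans (H3 i) _; rewrite lerDl.
have AB w : orthant w -> (forall a, a \in A -> 1 <= pairing a w) ->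
    forall nu, upper R n J nu -> 1 <= dot w nu.
  move=> w0 /(AE _ w0)/BE[lam [H1 H2 H3]] nu [nu0 nuJ].
  apply: (@le_trans _ _ (\sum_i (\sum_l lam 0 l * ratr (L l 0 i)) * nu 0 i)).
    rewrite (eq_bigr (fun i => \sum_l lam 0 l * (ratr (L l 0 i) * nu 0 i))).
      rewrite exchange_big /=; apply: le_trans H1 _.
      apply: ler_sum => l _; rewrite -mulr_sumr ler_peMr ?H2//.
      apply: le_trans (nuJ _ (LJ l)) _; rewrite le_eqVlt; apply/orP; left.
      by apply/eqP/eq_bigr => i _; rewrite mxE.
    by move=> i _; rewrite mulr_suml; apply: eq_bigr => l _; rewrite -[LHS]mulrA.
  by apply: ler_sum => i _; exact: ler_wpM2r.
exists [seq map_mx ratr a | a <- A]; split.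
- move=> A00; have An : A = [::] by case: (A) A00.
  have [c _ Hc] := @upper_axis R n J (Ordinal n0) Jp.
  have := AB 0 (@orthant0 R n) _ _ Hc; rewrite dot0l ler10 => H.
  by apply/notF/H => a; rewrite An.
- move=> _ /mapP[a aA ->]; split; first exact/ratr_mx_ge0/A0.
  move=> l lJ; rewrite /pairing dotC.
  have /(AE _ (positive_orthant R (Jp _ lJ))) := BJ _ lJ.
  by apply.
- move=> w c w0 wc nu nuJ; have [c0|c0] := leP c 0.
    by apply: le_trans c0 _; apply: dot_ge0 => //; case: nuJ.
  suff : 1 <= dot (c^-1 *: w) nu by rewrite dotZl mulrC ler_pdivlMr// mul1r.
  apply: AB => //; first by apply: orthantZ => //; rewrite invr_ge0 ltW.
  move=> a aA; rewrite pairingZr mulrC ler_pdivlMr// mul1r /pairing dotC.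
  by apply: wc; exact: map_f.
Qed.

(** * Faces and facets of a C-face diagram *)

Definition minimizers (R : realType) n (J : seq 'rV[rat]_n) (w : 'rV[R]_n) :
    set 'rV[R]_n :=
  [set nu | upper R n J nu /\ forall mu, upper R n J mu -> dot w nu <= dot w mu].

Lemma diagramE (R : realType) n (J : seq 'rV[rat]_n) (nu : 'rV[R]_n) :
  diagram_of J nu <-> upper R n J nu /\ exists2 l, l \in J & pairing l nu = 1.
Proof. by split=> [[? ? ?]|[[? ?] ?]]; split. Qed.

Lemma upper_neq0 (R : realType) n (J : seq 'rV[rat]_n) (nu : 'rV[R]_n) :
  J <> [::] -> upper R n J nu -> nu != 0.
Proof.
case: J => // l J _ [_ /(_ l)]; rewrite inE eqxx => /(_ isT) H.
by apply: contraTneq H => ->; rewrite pairing0r -ltNge ltr01.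
Qed.

(** A point of the polyhedron at which no form is tight can be pushed towards
    the origin, and the values of positive forms decrease strictly. *)
Lemma shrink_upper (R : realType) n (J : seq 'rV[rat]_n) (nu : 'rV[R]_n) :
  upper R n J nu -> (forall l, l \in J -> pairing l nu != 1) ->
  exists2 t, 0 < t < 1 & upper R n J (t *: nu).
Proof.
move=> [nu0 nuJ] nuN.
have [l lJ|d d0 H] := @small_enough R _ J (fun e l => 1 <= pairing l ((1 - e) *: nu)).
  have lnu : 1 < pairing l nu by rewrite lt_neqAle eq_sym nuN//= nuJ.
  exists (1 - (pairing l nu)^-1); first by rewrite subr_gt0 invf_lt1// (lt_trans _ lnu).
  move=> e /andP[_ ed]; rewrite pairingZr -ler_pdivrMr ?(lt_trans _ lnu)// div1r.
  lra.
pose e := Num.min d (1 / 2).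
have e0 : 0 < e by rewrite lt_min d0/= divr_gt0.
have e1 : e <= 1 / 2 by rewrite ge_min lexx orbT.
exists (1 - e); first by apply/andP; split; lra.
split; first by apply: orthantZ => //; lra.
by move=> l lJ; apply: H => //; rewrite e0 ge_min lexx.
Qed.

Lemma minimizers_diagram (R : realType) n (J : seq 'rV[rat]_n) (w nu : 'rV[R]_n) :
  J <> [::] -> (forall i, 0 < w 0 i) -> minimizers J w nu -> diagram_of J nu.
Proof.
move=> J0 w0 [nuJ numin]; apply/diagramE; split=> //.
apply: contrapT => N.
have [||t /andP[t0 t1] /numin] := @shrink_upper R n J nu => //.
  by move=> l lJ; apply/eqP => l1; apply: N; exists l.
have nu_gt0 : 0 < dot w nu by apply: dot_gt0 (upper_neq0 J0 nuJ) => //; case: nuJ.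
by rewrite dotZr; nra.
Qed.

Definition affine_form (R : realType) n (c : 'rV[R]_n * R) (nu : 'rV[R]_n) :=
  dot c.1 nu - c.2.

Definition constraints (R : realType) n (J : seq 'rV[rat]_n) : seq ('rV[R]_n * R) :=
  [seq (map_mx ratr l, 1) | l <- J] ++ [seq (delta_mx 0 i, 0) | i <- enum 'I_n].

Lemma constraintsP (R : realType) n (J : seq 'rV[rat]_n) (nu : 'rV[R]_n) :
  upper R n J nu <-> forall c, c \in constraints R J -> 0 <= affine_form c nu.
Proof.
split=> [[nu0 nuJ] c|H].
  rewrite mem_cat => /orP[/mapP[l lJ ->]|/mapP[i _ ->]]; rewrite /affine_form /=.
    by rewrite subr_ge0; exact: nuJ.
  by rewrite subr0 dotC dot_deltar; exact: nu0.
split=> [i|l lJ].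
  have : 0 <= affine_form (delta_mx 0 i, 0) nu.
    by apply: H; rewrite mem_cat (map_f _ (mem_enum _ i)) orbT.
  by rewrite /affine_form /= subr0 dotC dot_deltar.
have : 0 <= affine_form (map_mx ratr l, 1) nu.
  by apply: H; rewrite mem_cat (map_f (fun l => (map_mx ratr l, 1)) lJ).
by rewrite /affine_form /= subr_ge0.
Qed.

(** At a midpoint every constraint that is slack at one of the end points is
    slack; so the constraints can be treated one after the other. *)
Lemma relative_interior (R : realType) n (Phi : set 'rV[R]_n)
    (L : seq ('rV[R]_n * R)) :
  Phi !=set0 -> (forall u v, Phi u -> Phi v -> Phi (2^-1 *: (u + v))) ->
  (forall c, c \in L -> forall u, Phi u -> 0 <= affine_form c u) ->
  exists2 u, Phi u & forall c, c \in L -> affine_form c u = 0 ->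
    forall v, Phi v -> affine_form c v = 0.
Proof.
move=> [u0 Pu0] Pm; elim: L => [|c L IH] H; first by exists u0.
have [c' c'L|u Pu Hu] := IH; first by apply: H; rewrite inE c'L orbT.
have mid (c' : 'rV[R]_n * R) v : affine_form c' (2^-1 *: (u + v)) =
    2^-1 * (affine_form c' u + affine_form c' v).
  by rewrite /affine_form dotZr dotDr; field.
have [cN|/existsNP[v /not_implyP[Pv cv]]] :=
    pselect (forall v, Phi v -> affine_form c v = 0).
  exists u => // c'; rewrite inE => /orP[/eqP->//|]; exact: Hu.
have cv0 : 0 < affine_form c v.
  by rewrite lt_neqAle eq_sym (H c) ?inE ?eqxx// andbT; exact/eqP.
exists (2^-1 *: (u + v)); first exact: Pm.
move=> c'; rewrite inE mid => /orP[/eqP->|c'L].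
  have : 0 <= affine_form c u by apply: H; rewrite ?inE ?eqxx.
  by move=> cu0 E; exfalso; lra.
have cL : c' \in c :: L by rewrite inE c'L orbT.
move=> E; apply: Hu => //.
by have := H _ cL _ Pu; have := H _ cL _ Pv; lra.
Qed.

(** The constraints that are tight along the whole set of minimizers cut it
    out: from a point where the other constraints are slack one may go a little
    way beyond, away from any point satisfying them. *)
Lemma minimizers_face (R : realType) n (J : seq 'rV[rat]_n) (w : 'rV[R]_n) :
  (0 < n)%N -> J <> [::] -> positive_forms J -> (forall i, 0 < w 0 i) ->
  is_face (diagram_of J) (minimizers J w).
Proof.
move=> n0 J0 Jp w0; set Phi := minimizers J w.
have Phi0 : Phi !=set0.
  have [V [V0 VJ Vmin]] := @upper_vertices R n J n0 J0 Jp.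
  have [v vV vm] := exists_argmin (dot w) V0.
  exists v; split; first exact: VJ.
  by move=> mu muJ; apply: (Vmin w _ _ _ mu) => // i; exact: ltW.
have Phim u v : Phi u -> Phi v -> Phi (2^-1 *: (u + v)).
  move=> [uJ um] [vJ vm]; split=> [|mu muJ]; last first.
    by rewrite dotZr dotDr; have := um _ muJ; have := vm _ muJ; lra.
  apply/constraintsP => c cJ.
  have := (constraintsP J u).1 uJ c cJ; have := (constraintsP J v).1 vJ c cJ.
  by rewrite /affine_form dotZr dotDr; lra.
have [c cJ nu [/constraintsP H _]|u Pu uint] :=
    relative_interior Phi0 Phim (L := constraints R J); first exact: H.
have PhiD nu : Phi nu -> diagram_of J nu by exact: minimizers_diagram.
pose tight l := `[< forall nu, Phi nu -> pairing l nu = 1 >].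
pose I := [set i | ~~ `[< forall nu, Phi nu -> nu 0 i = 0 >]]%SET.
have uform l : l \in J -> pairing l u = 1 -> forall v, Phi v -> pairing l v = 1.
  move=> lJ lu v Pv; have := uint (map_mx ratr l, 1) _ _ v Pv.
  rewrite mem_cat (map_f (fun l => (map_mx ratr l, 1)) lJ) => /(_ isT).
  rewrite /affine_form /= -!/(pairing l _) lu subrr => /(_ erefl)/eqP.
  by rewrite subr_eq0 => /eqP.
exists J, I, [seq l <- J | tight l]; split => //.
- have [_ [l lJ lu]] := (diagramE _ _).1 (PhiD _ Pu).
  move=> E; have : l \in [seq l <- J | tight l].
    by rewrite mem_filter lJ andbT; apply/asboolP; exact: uform.
  by rewrite E.
- by move=> l; rewrite mem_filter => /andP[].
apply/seteqP; split=> nu.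
  move=> Pnu; split; first exact: PhiD.
    by move=> i; rewrite inE negbK => /asboolP; apply.
  by move=> l; rewrite mem_filter => /andP[/asboolP H _]; apply: H.
move=> [/diagramE[nuJ _] nuI nuJ']; split=> // mu muJ.
have [uJ um] := Pu.
have [c cJ|d d0 Hd] := @small_enough R _ (constraints R J)
    (fun e c => 0 <= affine_form c (u + e *: (u - nu))).
  have cE e : affine_form c (u + e *: (u - nu)) =
      affine_form c u + e * (affine_form c u - affine_form c nu).
    by rewrite /affine_form dotDr dotZr dotBr; ring.
  have cu0 := (constraintsP J u).1 uJ c cJ.
  have cnu0 := (constraintsP J nu).1 nuJ c cJ.
  have [cu|cu] := eqVneq (affine_form c u) 0; last first.
    have {}cu0 : 0 < affine_form c u by rewrite lt_neqAle eq_sym cu.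
    exists (affine_form c u / (1 + affine_form c nu)); first by rewrite divr_gt0// ltr_wpDr.
    move=> e /andP[e0]; rewrite ler_pdivlMr ?ltr_wpDr// cE; nra.
  exists 1 => // e _; rewrite cE.
  suff -> : affine_form c nu = 0 by rewrite cu subrr mulr0 addr0.
  have cPhi := uint c cJ cu.
  move: cJ cPhi; rewrite mem_cat => /orP[/mapP[l lJ ->]|/mapP[i _ ->]] cPhi.
    rewrite /affine_form /= -/(pairing l nu) nuJ' ?subrr// mem_filter lJ andbT.
    apply/asboolP => v Pv; apply/eqP; rewrite -subr_eq0; apply/eqP.
    exact: cPhi.
  rewrite /affine_form /= subr0 dotC dot_deltar; apply: nuI.
  rewrite inE negbK; apply/asboolP => v Pv.
  by have := cPhi v Pv; rewrite /affine_form /= subr0 dotC dot_deltar.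
have : upper R n J (u + d *: (u - nu)).
  by apply/constraintsP => c; apply: Hd; rewrite d0 lexx.
move=> /um; rewrite dotDr dotZr dotBr => Hw.
by have := um _ muJ; nra.
Qed.

(** In a presentation of least length no form follows from the other ones on the
    orthant: leaving it out would present the same diagram, because by
    [shrink_upper] the lower boundary of the region is where a form is tight. *)
Lemma minimal_presentation (R : realType) n (D : set 'rV[R]_n) :
  is_Cface_diagram D -> exists2 J, presents J D & forall l, l \in J ->
    exists nu : 'rV[R]_n, [/\ orthant nu, pairing l nu < 1 &
      forall l', l' \in J -> l' != l -> 1 <= pairing l' nu].
Proof.
move=> [J0 J0D].
have [k kP kmin] := @ex_minnP (fun k => `[< exists J, size J = k /\ presents J D >])
  (ex_intro _ (size J0) (asboolT (ex_intro _ J0 (conj erefl J0D)))).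
move/asboolP: kP => [J [sJ [Jn Jp JD]]]; exists J => // l lJ.
apply: contrapT => N.
have lN (nu : 'rV[R]_n) : orthant nu -> (forall l', l' \in J -> l' != l -> 1 <= pairing l' nu) ->
    1 <= pairing l nu.
  by move=> nu0 H; rewrite leNgt; apply/negP => l1; apply: N; exists nu.
pose J' := [seq l' <- J | l' != l].
have J'P l' : l' \in J' = (l' != l) && (l' \in J) by rewrite mem_filter.
have upJ (nu : 'rV[R]_n) : upper R n J' nu -> upper R n J nu.
  move=> [nu0 H]; split=> // l' l'J; have [->|l'l] := eqVneq l' l; last first.
    by apply: H; rewrite J'P l'l.
  by apply: lN => // l2 ? ?; apply: H; rewrite J'P; apply/andP.
have J'n : J' <> [::].
  move=> J'E; have /(lN 0) : orthant (0 : 'rV[R]_n) by exact: orthant0.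
  rewrite pairing0r ler10 => H; apply/notF/H => l' l'J l'l.
  by have := J'P l'; rewrite l'J l'l J'E.
have : presents J' D.
  split=> //; first by move=> l'; rewrite J'P => /andP[_ /Jp].
  rewrite JD; apply/seteqP; split=> nu /diagramE[H [l' l'J l'1]]; apply/diagramE.
    have nuJ' : upper R n J' nu.
      by case: H => ? H; split=> // l2; rewrite J'P => /andP[_ /H].
    split=> //; apply: contrapT => M.
    have [||t /andP[t0 t1] /upJ[_ /(_ _ lJ)]] := @shrink_upper R n J' nu => //.
      by move=> l2 l2J; apply/eqP => l21; apply: M; exists l2.
    have [ll|ll] := eqVneq l' l; last first.
      by exfalso; apply: M; exists l' => //; rewrite J'P ll.
    by rewrite pairingZr -ll l'1; lra.
  split; first exact: upJ.
  by exists l' => //; move: l'J; rewrite J'P => /andP[].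
move=> PJ'; have := kmin (size J'); rewrite leqNgt.
rewrite (_ : (size J' < k)%N) => [H|]; last first.
  rewrite -sJ size_filter -(count_predC (pred1 l)) -[ltnLHS]add0n ltn_add2r.
  by rewrite -has_count has_pred1.
by apply/notF/H/asboolP; exists J'.
Qed.

(** In a presentation without superfluous forms every form cuts out a facet,
    on which it is, up to a positive factor, the only constant form. *)
Lemma facet_forms (R : realType) n (D : set 'rV[R]_n) (P : seq 'rV[rat]_n) :
  (0 < n)%N -> is_Cface_diagram D -> facet_weights D P ->
  exists2 J, presents J D & forall l, l \in J -> exists w d,
    [/\ w \in P, 0 < d, weight_diagram w D = d &
        forall nu : 'rV[R]_n, pairing w nu = d * pairing l nu].
Proof.
move=> n0 DC [Pw _ Pfacet].
have [J PJ Jmin] := minimal_presentation DC; exists J => // l lJ.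
have [Jn Jp JD] := PJ.
have [nu1 [nu10 l1 oth1]] := Jmin _ lJ.
(* On the way from a point violating only [l] to a point far inside, the region is
   entered at a point [a] where [l] alone is tight. *)
have [|T T0 HT] := @large_enough R _ J (fun e l' => 1 < pairing l' (e *: const_mx 1)).
  move=> l' l'J; exists (2 / pairing l' (const_mx 1)) => e.
  have p0 : 0 < pairing l' (const_mx 1 : 'rV[R]_n).
    apply: dot_gt0; first exact: positive_ratr (Jp _ l'J).
      by move=> i; rewrite mxE.
    apply/eqP => /rowP/(_ (Ordinal n0)); rewrite !mxE => /eqP.
    by rewrite oner_eq0.
  by rewrite ler_pdivrMr// pairingZr; lra.
pose nu2 : 'rV[R]_n := T *: const_mx 1.
have l2 : 1 < pairing l nu2 by exact: HT.
pose t := (1 - pairing l nu1) / (pairing l nu2 - pairing l nu1).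
have t01 : 0 < t < 1.
  have den : 0 < pairing l nu2 - pairing l nu1 by rewrite subr_gt0 (lt_trans l1).
  apply/andP; split; first by apply: divr_gt0 => //; rewrite subr_gt0.
  by rewrite /t ltr_pdivrMr//; lra.
have [t0 t1] := andP t01.
pose a := (1 - t) *: nu1 + t *: nu2.
have aE l' : pairing l' a = (1 - t) * pairing l' nu1 + t * pairing l' nu2.
  by rewrite pairingDr !pairingZr.
have la : pairing l a = 1.
  by rewrite aE /t; field; rewrite subr_eq0 gt_eqF// (lt_trans l1).
have a_gt0 i : 0 < a 0 i.
  rewrite !mxE mulr1; have := nu10 i; have := mulr_gt0 t0 T0; nra.
have oth l' : l' \in J -> l' != l -> 1 < pairing l' a.
  move=> l'J l'l; rewrite aE; have := oth1 _ l'J l'l; have := HT _ (lexx _) _ l'J.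
  rewrite -/nu2; nra.
pose Lc : 'M[R]_(n, 1) := (map_mx ratr l)^T.
have Ker (u : 'rV[R]_n) : (u <= kermx Lc)%MS <-> pairing l u = 0.
  rewrite /pairing dotC dot_mulmx -/Lc; split=> [/sub_kermxP->|H].
    by rewrite mxE.
  by apply/sub_kermxP/matrixP => i j; rewrite !ord1 H mxE.
have rk : \rank (kermx Lc) = n.-1.
  rewrite mxrank_ker -subn1; congr (_ - _)%N; apply/eqP.
  rewrite eqn_leq rank_leq_col /= lt0n mxrank_eq0.
  apply/eqP => /matrixP/(_ (Ordinal n0) 0).
  by rewrite mxE [RHS]mxE => /eqP; rewrite gt_eqF// positive_ratr//; exact: Jp.
have [M Mfree MK] : exists2 M : 'M[R]_(n.-1, n), row_free M & (M :=: kermx Lc)%MS.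
  have := eq_row_base (kermx Lc); have := row_base_free (kermx Lc).
  by move: (row_base _); rewrite rk => M ? ?; exists M.
have lrow i : pairing l (row i M) = 0.
  by apply/Ker; rewrite -MK row_sub.
pose Phi := [set nu | [/\ D nu, coord_subspace [set: 'I_n]%SET nu &
  forall l', l' \in [:: l] -> pairing l' nu = 1]].
have PhiE nu : Phi nu <-> upper R n J nu /\ pairing l nu = 1.
  rewrite /Phi /=; split=> [[+ _ H]|[H1 H2]].
    by rewrite JD => /diagramE[H1 _]; split=> //; apply: H; rewrite inE.
  split; first by rewrite JD; apply/diagramE; split=> //; exists l.
    by move=> i; rewrite inE.
  by move=> l'; rewrite inE => /eqP->.
have Phia : Phi a.
  apply/PhiE; split=> //; split=> [i|l' l'J]; first exact: ltW.
  by have [->|l'l] := eqVneq l' l; [rewrite la | rewrite ltW// oth].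
have Phiface : is_face D Phi.
  exists J, [set: 'I_n]%SET, [:: l]; split=> //; last by exists a.
  by move=> l'; rewrite inE => /eqP->.
have [i _|d d0 Hd] := @small_enough R _ (enum 'I_n.-1)
    (fun e i => upper R n J (a + e *: row i M)).
  have [c cJ|d d0 Hd] := @small_enough R _ (constraints R J)
      (fun e c => 0 <= affine_form c (a + e *: row i M)).
    have cE e : affine_form c (a + e *: row i M) =
        affine_form c a + e * dot c.1 (row i M).
      by rewrite /affine_form dotDr dotZr; ring.
    have [ca|[ca cM]] : 0 < affine_form c a \/
        affine_form c a = 0 /\ dot c.1 (row i M) = 0.
      move: cJ; rewrite mem_cat => /orP[/mapP[l' l'J ->]|/mapP[j _ ->]].
        have [->|l'l] := eqVneq l' l; [right | left].
          by rewrite /affine_form /= -!/(pairing l _) la subrr lrow.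
        by rewrite /affine_form /= subr_gt0; exact: oth.
      by left; rewrite /affine_form /= subr0 dotC dot_deltar.
      exists (affine_form c a / (1 + `|dot c.1 (row i M)|)).
        by rewrite divr_gt0// ltr_wpDr.
      move=> e /andP[e0]; rewrite ler_pdivlMr ?ltr_wpDr// cE.
      have := ler_norm (- dot c.1 (row i M)); rewrite normrN; nra.
    by exists 1 => // e _; rewrite cE ca cM mulr0 addr0.
  by exists d => // e ed; apply/constraintsP => c; apply: Hd.
have Phirow i : Phi (a + d *: row i M).
  apply/PhiE; rewrite pairingDr pairingZr lrow mulr0 addr0; split=> //.
  by apply: Hd; rewrite ?d0 ?lexx ?mem_enum.
have Phidim : has_dim Phi n.-1.
  exists a => //; exists (d *: M); split=> [|i|nu /PhiE[_ nu1']].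
  - rewrite /row_free (eqmx_scale _ (lt0r_neq0 d0)); exact: Mfree.
  - by rewrite linearZ; exact: Phirow.
  - rewrite eqmx_scale ?gt_eqF// MK; apply/Ker.
    by rewrite pairingBr nu1' la subrr.
have [w wP wPhi] := Pfacet _ Phiface Phidim.
have [wp _ _] := Pw _ wP.
exists w, (weight_diagram w D).
have PhiW nu : Phi nu -> pairing w nu = weight_diagram w D.
  by rewrite -wPhi => -[].
(* The kernel of [l] is the direction of the facet, on which [w] is constant. *)
have wE nu : pairing w nu = weight_diagram w D * pairing l nu.
  have : (nu - pairing l nu *: a <= M)%MS.
    by rewrite MK; apply/Ker; rewrite pairingBr pairingZr la; ring.
  move=> /submxP[c cE].
  have : pairing w (nu - pairing l nu *: a) = 0.
    rewrite cE mulmx_sum_row /pairing dot_sumr big1// => i _.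
    rewrite dotZr; have := PhiW _ (Phirow i); rewrite -(PhiW _ Phia) pairingDr.
    rewrite pairingZr => /eqP; rewrite -subr_eq0 addrC addKr mulf_eq0 gt_eqF//=.
    by rewrite /pairing => /eqP->; rewrite mulr0.
  by rewrite pairingBr pairingZr (PhiW _ Phia) => /eqP; rewrite subr_eq0 mulrC => /eqP.
split=> //; rewrite -(PhiW _ Phia); apply: dot_gt0.
- exact: positive_ratr.
- by move=> i; exact: ltW.
- by apply: (upper_neq0 Jn); case/PhiE: Phia.
Qed.

(** * Minkowski sums of C-face diagrams *)

Lemma normrv_le (R : realType) n (v : 'rV[R]_n) i : `|v 0 i| <= `|v|.
Proof.
rewrite [leRHS]/Num.Def.normr/= mx_normrE.
exact: (@le_bigmax _ _ _ 0 (fun ij => `|v ij.1 ij.2|) (0, i)).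
Qed.

Lemma normrv_leP (R : realType) n (v : 'rV[R]_n) c :
  0 <= c -> (forall i, `|v 0 i| <= c) -> `|v| <= c.
Proof.
move=> c0 H; rewrite [leLHS]/Num.Def.normr/= mx_normrE.
by apply: bigmax_le => // -[i j] _ /=; rewrite ord1.
Qed.

Lemma dot_continuous (R : realType) n (u : 'rV[R]_n) : continuous (dot u).
Proof.
apply: (@continuous_big R _ +%R 0 xpredT) => [|i _ v]; first exact: add_continuous.
by apply: (@continuousM R _ (fun=> u 0 i) (fun v : 'rV_n => v 0 i)); [exact: cst_continuous | exact: coord_continuous].
Qed.

Lemma compact_rV (R : realType) n (A : set 'rV[R]_n) c :
  closed A -> (forall v, A v -> `|v| <= c) -> compact A.
Proof.
move=> Acl Ac; apply: bounded_closed_compact => //.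
by exists c; split; rewrite ?num_real// => x cx v /Ac /le_trans; apply; exact: ltW.
Qed.

Lemma closed_upper (R : realType) n (J : seq 'rV[rat]_n) : closed (upper R n J).
Proof.
rewrite (_ : upper R n J = \bigcap_(c in [set c | c \in constraints R J])
    (dot c.1 @^-1` [set x | c.2 <= x])); last first.
  apply/seteqP; split=> nu.
    by move=> /constraintsP H c /H; rewrite /affine_form subr_ge0.
  by move=> H; apply/constraintsP => c cJ; rewrite /affine_form subr_ge0; exact: H.
apply: closed_bigI => c _; apply: (closed_comp _ (@closed_ge _ _)).
by move=> x _; exact: dot_continuous.
Qed.

Lemma upperE (R : realType) n (J : seq 'rV[rat]_n) :
  J <> [::] -> positive_forms J ->
  upper R n J = [set nu + mu | nu in diagram_of J & mu in @orthant R n].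
Proof.
move=> J0 Jp; apply/seteqP; split=> [nu nuJ|_ [nu /diagramE[nuJ _] [mu mu0 <-]]].
  have [l lJ lmin] := exists_argmin (fun l => pairing l nu) J0.
  have [nu0 nuJ'] := nuJ; have l1 := nuJ' _ lJ.
  have l0 : 0 < pairing l nu by apply: lt_le_trans l1.
  exists ((pairing l nu)^-1 *: nu).
    apply/diagramE; split; last first.
      by exists l => //; rewrite pairingZr mulVf ?gt_eqF.
    split; first by apply: orthantZ => //; rewrite invr_ge0 ltW.
    by move=> l' /lmin; rewrite pairingZr mulrC ler_pdivlMr// mul1r.
  exists ((1 - (pairing l nu)^-1) *: nu).
    by apply: orthantZ => //; rewrite subr_ge0 invf_le1.
  by rewrite -scalerDl addrCA subrr addr0 scale1r.
exact: upperD.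
Qed.

(** The upper sets absorb the orthant, so that the difference may be any point of
    it; this form of the statement also covers the empty sum. *)
Lemma upper_sum (R : realType) n p (Js : 'I_p -> seq 'rV[rat]_n) :
  (0 < n)%N -> (forall j, positive_forms (Js j)) ->
  exists J, positive_forms J /\ forall nu, upper R n J nu <->
    exists nus : 'I_p -> 'rV[R]_n,
      (forall j, upper R n (Js j) (nus j)) /\ orthant (nu - \sum_j nus j).
Proof.
move=> n0; elim: p Js => [|p IH] Js Jsp.
  exists [::]; split=> // nu; split=> [[nu0 _]|[nus [_]]].
    by exists (fun=> 0); split=> [[]//|]; rewrite big_ord0 subr0.
  by rewrite big_ord0 subr0.
have [J' [J'p J'E]] := IH (fun j => Js (lift ord0 j)) (fun j => Jsp _).
have [J [Jp JE]] := @upper_sum2 R n _ _ n0 (Jsp ord0) J'p.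
exists J; split=> // nu; rewrite JE; split.
  move=> [mu [H0 /J'E[nus [H1 H2]]]].
  exists (fun j => if unlift ord0 j is Some k then nus k else mu); split.
    move=> j; case: unliftP => [k ->|->] //; exact: H1.
  rewrite big_ord_recl unlift_none opprD addrA.
  by under eq_bigr do rewrite liftK.
move=> [nus [H1 H2]]; exists (nus ord0); split; first exact: H1.
apply/J'E; exists (fun j => nus (lift ord0 j)); split=> //.
by move: H2; rewrite big_ord_recl opprD addrA.
Qed.

Lemma upper_sum_exact (R : realType) n p (Js : 'I_p -> seq 'rV[rat]_n) :
  (0 < n)%N -> (0 < p)%N -> (forall j, positive_forms (Js j)) ->
  (forall j, Js j <> [::]) ->
  exists J, [/\ J <> [::], positive_forms J & forall nu, upper R n J nu <->
    exists nus : 'I_p -> 'rV[R]_n,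
      (forall j, upper R n (Js j) (nus j)) /\ nu = \sum_j nus j].
Proof.
move=> n0 p0 Jsp Js0; have [J [Jp JE]] := @upper_sum R n p Js n0 Jsp.
have JE' nu : upper R n J nu <-> exists nus : 'I_p -> 'rV[R]_n,
    (forall j, upper R n (Js j) (nus j)) /\ nu = \sum_j nus j.
  rewrite JE; split=> [[nus [H1 H2]]|[nus [H1 ->]]]; last first.
    by exists nus; split=> //; rewrite subrr; exact: orthant0.
  have [j0 _] : exists j0 : 'I_p, true by exists (Ordinal p0).
  exists (fun j => if j == j0 then nus j0 + (nu - \sum_j nus j) else nus j); split.
    by move=> j; case: eqVneq => [->|_] //; exact: upperD.
  rewrite (bigD1 j0)//= eqxx [in LHS](_ : nu = (\sum_j nus j) + (nu - \sum_j nus j)).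
    rewrite (bigD1 j0)//= [RHS]addrAC; congr (_ + _ + _).
    by apply: eq_bigr => j /negbTE ->.
  by rewrite addrC subrK.
exists J; split=> // J0; have : upper R n J 0.
  by rewrite J0; split=> //; exact: orthant0.
move=> /JE'[nus [H1 /esym H2]].
have H3 j i : 0 <= nus j 0 i by case: (H1 j).
have := upper_neq0 (Js0 (Ordinal p0)) (H1 (Ordinal p0)).
move/eqP; apply; apply/rowP => i; move/rowP/(_ i): H2; rewrite summxE !mxE.
by move=> /psumr_eq0P/= ->.
Qed.

Lemma compact_tight (R : realType) n (J : seq 'rV[rat]_n) l :
  positive_forms J -> l \in J ->
  compact [set nu | upper R n J nu /\ pairing l nu = 1].
Proof.
move=> Jp lJ.
have [|c c0 Hc] := @large_enough R _ (enum 'I_n)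
    (fun c i => 1 <= c * map_mx ratr l 0 i).
  move=> i _; exists (map_mx ratr l 0 i)^-1 => e.
  by have l0 := positive_ratr R (Jp _ lJ) i; rewrite -ler_pdivrMr// div1r.
apply: (@compact_rV _ _ _ c).
  apply: closedI; first exact: closed_upper.
  apply: (closed_comp _ (@closed_eq _ 1)) => x _; exact: dot_continuous.
move=> nu [[nu0 _] lnu]; apply: normrv_leP; first exact: ltW.
move=> i; rewrite ger0_norm//.
have : map_mx ratr l 0 i * nu 0 i <= 1.
  rewrite -lnu /pairing /dot (bigD1 i)//= lerDl sumr_ge0// => j _.
  by rewrite mulr_ge0// ltW// positive_ratr//; exact: Jp.
have := Hc _ (lexx _) i (mem_enum _ _).
have := positive_ratr R (Jp _ lJ) i; have := nu0 i.
set a := _ 0 i; set x := nu 0 i => x0 a0 ca ax.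
by rewrite -(ler_pM2l a0); apply: le_trans ax _; rewrite mulrC.
Qed.

(** A linear function with a nonpositive coefficient is minimal along an
    unbounded set or not at all, so that the compact faces are those on which a
    positive form is minimal. *)
Lemma diagram_sum_presents (R : realType) n p (D : 'I_p -> set 'rV[R]_n)
    (Js : 'I_p -> seq 'rV[rat]_n) :
  (0 < n)%N -> (0 < p)%N -> (forall j, presents (Js j) (D j)) ->
  exists J, presents J (diagram_sum D) /\ forall nu, upper R n J nu <->
    exists nus : 'I_p -> 'rV[R]_n,
      (forall j, upper R n (Js j) (nus j)) /\ nu = \sum_j nus j.
Proof.
move=> n0 p0 JsD.
have Js0 j : Js j <> [::] by case: (JsD j).
have Jsp j : positive_forms (Js j) by case: (JsD j).
have [J [J0 Jp JE]] := @upper_sum_exact R n p Js n0 p0 Jsp Js0.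
exists J; split=> //; split=> //.
pose Q := minkowski_sum (fun j => [set nu + mu | nu in D j & mu in @orthant R n]).
have QE : Q = upper R n J.
  apply/seteqP; split=> nu.
    move=> [nus Hnus <-]; apply/JE; exists nus; split=> // j.
    by rewrite upperE//; case: (JsD j) => _ _ <-; exact: Hnus.
  move=> /JE[nus [Hnus ->]]; exists nus => // j.
  by case: (JsD j) => _ _ ->; rewrite -upperE//; exact: Hnus.
apply/seteqP; split=> nu.
  rewrite /diagram_sum /= -/Q QE => -[Phi [[_ [u PhiE]] Phic Phinu]].
  have [nuJ numin] : upper R n J nu /\ forall mu, upper R n J mu -> dot u nu <= dot u mu.
    by move: Phinu; rewrite PhiE.
  suff u0 i : 0 < u 0 i by apply: (minimizers_diagram J0 u0); split.
  rewrite ltNge; apply/negP => ui.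
  have [M [_ HM]] := compact_bounded Phic.
  pose t := `|M| + 1 + `|nu|.
  have t0 : 0 <= t by rewrite !addr_ge0.
  have : Phi (nu + t *: delta_mx 0 i).
    rewrite PhiE; split; first by apply: upperD => //; apply: orthantZ => //; exact: orthant_delta.
    move=> mu muJ; apply: le_trans (numin _ muJ).
    by rewrite dotDr dotZr dot_deltar gerDl mulr_ge0_le0.
  have MM : M < `|M| + 1 / 2 by have := ler_norm M; lra.
  move=> /(HM _ MM); apply/negP; rewrite -ltNge.
  apply: (@lt_le_trans _ _ (nu 0 i + t)).
    have := ler_norm (- nu 0 i); rewrite normrN; have := normrv_le nu i.
    rewrite /t; lra.
  apply: le_trans (normrv_le _ i); rewrite !mxE !eqxx /= mulr1.
  exact: ler_norm.
move=> /diagramE[nuJ [l lJ lnu]].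
rewrite /diagram_sum /= -/Q QE.
exists [set nu | upper R n J nu /\ pairing l nu = 1]; split.
- split; first by exists nu.
  exists (map_mx ratr l); apply/seteqP; split=> mu [muJ].
    by move=> lmu; split=> // mu' [_ /(_ _ lJ)]; rewrite -/(pairing l mu) lmu.
  move=> /(_ _ nuJ); rewrite -!/(pairing l _) lnu => lmu; split=> //.
  by apply/eqP; rewrite eq_le lmu /=; case: muJ => _; apply.
- exact: compact_tight.
- by [].
Qed.

(** * Supports of polynomials, and weights adapted to a point *)

Lemma exponent_orthant (R : realType) K n (m : multinom (kdim K n)) :
  orthant (exponent R m).
Proof. by case: K m => m i; rewrite mxE ler0n. Qed.

Lemma weight_polyP (R : realType) K n (w : 'rV[rat]_n) (g : kpoly R K n) m :
  mcoeff m g != 0 -> (weight_poly w g <= (pairing w (exponent R m))%:E)%E.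
Proof.
by move=> gm; apply: ereal_inf_lbound; exists (exponent R m) => //; exists m.
Qed.

(** The facet weights are, up to positive factors, the forms of a presentation
    ([facet_forms]), so that conditions on them bound every single exponent. *)
Lemma supp_upper (R : realType) K n (D : set 'rV[R]_n) P :
  (0 < n)%N -> is_Cface_diagram D -> facet_weights D P ->
  exists2 J, presents J D & forall g : kpoly R K n,
    ((forall w, w \in P -> ((weight_diagram w D)%:E <= weight_poly w g)%E) ->
      forall m, mcoeff m g != 0 -> upper R n J (exponent R m)) /\
    ((forall w, w \in P -> ((weight_diagram w D)%:E < weight_poly w g)%E) ->
      forall m, mcoeff m g != 0 -> ~ D (exponent R m)).
Proof.
move=> n0 DC DP; have [J PJ JH] := facet_forms n0 DC DP; exists J => // g.
split=> H m gm.
  split=> [|l lJ]; first exact: exponent_orthant.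
  have [w [d [wP d0 dE wE]]] := JH _ lJ.
  have := le_trans (H _ wP) (weight_polyP w gm).
  by rewrite lee_fin wE dE ler_pMr.
case: PJ => _ _ -> /diagramE[_ [l lJ l1]].
have [w [d [wP d0 dE wE]]] := JH _ lJ.
have := lt_le_trans (H _ wP) (weight_polyP w gm).
by rewrite lte_fin wE dE l1 mulr1 ltxx.
Qed.

(** Choices from several lists are indexed by a finite type, so that an
    ultrafilter singles out one of them. *)
Lemma selections (T : eqType) p (V : 'I_p -> seq T) :
  (forall j, V j <> [::]) ->
  exists (S : finType) (sel : S -> 'I_p -> T), (forall s j, sel s j \in V j) /\
    forall v : 'I_p -> T, (forall j, v j \in V j) -> exists s, sel s =1 v.
Proof.
move=> V0; have /choice[v0 v0V] : forall j, exists x, x \in V j.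
  by move=> j; case: (V j) (V0 j) => // a s _; exists a; rewrite inE eqxx.
pose k := (\sum_j size (V j))%N.
exists {ffun 'I_p -> 'I_k}, (fun (f : {ffun 'I_p -> 'I_k}) j => nth (v0 j) (V j) (f j)); split.
  move=> f j; have [fj|fj] := ltnP (f j) (size (V j)); first exact: mem_nth.
  by rewrite nth_default.
move=> v vV; have ik j : (index (v j) (V j) < k)%N.
  rewrite (leq_trans (_ : _ < size (V j))%N) ?index_mem// /k (bigD1 j)//=.
  exact: leq_addr.
by exists [ffun j => Ordinal (ik j)] => j; rewrite ffunE /= nth_index.
Qed.

(** Lowering a weight one coordinate at a time, as far as the inequalities
    allow: an inequality that has become an equality remains one, and at the end
    each coordinate occurs in some equality. *)
Lemma lower_weight (R : realType) n (V : seq 'rV[R]_n) d (L : seq 'I_n) (u : 'rV[R]_n) :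
  (forall v : 'rV[R]_n, v \in V -> orthant v) ->
  (forall i, exists2 v : 'rV[R]_n, v \in V & 0 < v 0 i /\ forall k, k != i -> v 0 k = 0) ->
  0 < d -> orthant u -> (forall v, v \in V -> d <= dot u v) ->
  exists w : 'rV[R]_n, [/\ orthant w, forall i, w 0 i <= u 0 i,
    forall v, v \in V -> d <= dot w v &
    forall i, i \in L -> exists2 v : 'rV[R]_n, v \in V & dot w v = d /\ 0 < v 0 i].
Proof.
move=> V0 ax d0 u0 ud; elim: L => [|i L [w [w0 wu wd wt]]].
  by exists u; split.
pose T := [seq v : 'rV[R]_n <- V | 0 < v 0 i].
have [a aV [ai aN]] := ax i.
have aT : a \in T by rewrite mem_filter ai.
have T0 : T <> [::] by move=> E; rewrite E in aT.
(* The coordinate is lowered by the largest amount [t] compatible with all the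
   inequalities. *)
have [b] := exists_argmin (fun v : 'rV[R]_n => (dot w v - d) / v 0 i) T0.
rewrite mem_filter => /andP[bi bV]; set t := (_ - d) / _ => tm.
have t0 : 0 <= t by rewrite divr_ge0 ?subr_ge0 ?wd// ltW.
have wE v : dot (w - t *: delta_mx 0 i) v = dot w v - t * v 0 i.
  by rewrite dotBl dotZl (dotC (delta_mx _ _)) dot_deltar.
have w'u k : (w - t *: delta_mx 0 i) 0 k <= w 0 k.
  by rewrite !mxE gerBl mulr_ge0.
have w'd v : v \in V -> d <= dot (w - t *: delta_mx 0 i) v.
  move=> vV; rewrite wE; have [vi|vi] := ltP 0 (v 0 i).
    have : t <= (dot w v - d) / v 0 i by apply: tm; rewrite mem_filter vi.
    by rewrite ler_pdivlMr//; lra.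
  have -> : v 0 i = 0 by apply/eqP; rewrite eq_le vi (V0 v).
  by rewrite mulr0 subr0 wd.
exists (w - t *: delta_mx 0 i); split=> //.
- move=> k; rewrite !mxE eqxx /=; have [->|ki] := eqVneq k i; last first.
    by rewrite mulr0 subr0.
  rewrite mulr1 subr_ge0.
  have := tm _ aT; rewrite ler_pdivlMr//.
  have -> : dot w a = w 0 i * a 0 i.
    by rewrite /dot (bigD1 i)//= big1 ?addr0// => j ji; rewrite aN ?mulr0.
  by rewrite -(ler_pM2r ai); lra.
- by move=> k; apply: le_trans (w'u k) (wu k).
- move=> k; rewrite inE => /orP[/eqP->|/wt[v vV [vd vk]]].
    by exists b => //; split=> //; rewrite wE /t divfK ?gt_eqF//; ring.
  exists v => //; split=> //; apply/eqP; rewrite eq_le w'd// andbT -vd.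
  by apply: ler_sum => k' _; apply: ler_wpM2r; rewrite ?w'u ?V0.
Qed.

(** From the exponents of decay of the nonzero coordinates of a point to a
    weight vector for all the coordinates, whose face is inner and still meets
    the coordinate subspace of the point. *)
Lemma adapted_weight (R : realType) n (V : seq 'rV[R]_n) :
  (forall v : 'rV[R]_n, v \in V -> orthant v) -> (forall v : 'rV[R]_n, v \in V -> v != 0) ->
  (forall i, exists2 v : 'rV[R]_n, v \in V & 0 < v 0 i /\ forall k, k != i -> v 0 k = 0) ->
  exists2 kap : R, 0 < kap & forall (I : {set 'I_n}) (u : 'rV[R]_n),
    I != finset.set0 -> (forall i, i \in I -> 0 < u 0 i) ->
    exists (w : 'rV[R]_n) (d : R),
    [/\ (forall i, 0 < w 0 i) /\ (forall i, i \in I -> w 0 i <= u 0 i),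
        forall v, v \in V -> d <= dot w v,
        exists2 v : 'rV[R]_n, v \in V & dot w v = d /\
          forall i, v 0 i != 0 -> i \in I /\ w 0 i = u 0 i,
        forall i, exists2 v : 'rV[R]_n, v \in V & dot w v = d /\ 0 < v 0 i &
        forall c, 0 <= c -> (forall i, i \in I -> c <= u 0 i) ->
          forall i, kap * c <= w 0 i].
Proof.
move=> V0 Vn ax.
have sum_gt0 v : v \in V -> 0 < \sum_i v 0 i.
  move=> vV; have := @dot_gt0 R n (const_mx 1) v _ (V0 _ vV) (Vn _ vV).
  rewrite /dot; under eq_bigr do rewrite mxE mul1r.
  by apply=> i; rewrite mxE.
have [v vV|m m0 Hm] := @small_enough R _ V (fun e (v : 'rV[R]_n) => e <= \sum_i v 0 i).
  by exists (\sum_i v 0 i) => [|e /andP[]//]; exact: sum_gt0.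
have {}Hm := Hm m; rewrite m0 lexx in Hm; have {}Hm := Hm isT.
(* [kap] compares the elements of [V] on the axes, which bound the coordinates of
   the weight from below, with the least coordinate sum [m] in [V]. *)
have [i _|kap kap0 Hk] := @small_enough R _ (enum 'I_n)
    (fun e i => exists2 v : 'rV[R]_n, v \in V & [/\ 0 < v 0 i,
       forall k, k != i -> v 0 k = 0 & e * v 0 i <= m]).
  have [v vV [vi vN]] := ax i; exists (m / v 0 i); first exact: divr_gt0.
  by move=> e /andP[e0]; rewrite ler_pdivlMr// => em; exists v.
have {}Hk i : exists2 v : 'rV[R]_n, v \in V & [/\ 0 < v 0 i,
    forall k, k != i -> v 0 k = 0 & kap * v 0 i <= m].
  by apply: (Hk kap); rewrite ?kap0 ?lexx ?mem_enum.
exists kap => // I u /set0Pn[i0 i0I] uI.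
(* The minimum [d] is taken over the elements supported in [I]; the coordinates
   outside [I] start from a value [B] so large that all other elements reach it. *)
pose VI := [seq v : 'rV[R]_n <- V | [forall i, (i \notin I) ==> (v 0 i == 0)]].
have VI0 : VI <> [::].
  have [v vV [vi vN]] := ax i0 => E.
  have : v \in VI; last by rewrite E.
  rewrite mem_filter vV andbT; apply/forallP => i; apply/implyP => iI.
  by apply/eqP/vN; apply: contraNneq iI => ->.
have [a] := exists_argmin (dot u) VI0.
rewrite mem_filter => /andP[/forallP aI aV]; set d := dot u a => amin.
have {}aI i : i \notin I -> a 0 i = 0.
  by move=> iI; have := aI i; rewrite iI => /eqP.
have Vr i v : v \in V -> 0 <= v 0 i by move/V0; apply.
have dm c : 0 <= c -> (forall i, i \in I -> c <= u 0 i) -> m * c <= d.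
  move=> c0 cu; apply: (@le_trans _ _ (\sum_i c * a 0 i)).
    by rewrite -mulr_sumr mulrC ler_wpM2l// Hm.
  apply: ler_sum => i _; have [iI|iI] := boolP (i \in I); last first.
    by rewrite aI// !mulr0.
  by rewrite ler_wpM2r// ?cu// Vr.
have d0 : 0 < d.
  have [i iI|c c0 Hc] := @small_enough R _ (enum I) (fun e i => e <= u 0 i).
    by exists (u 0 i) => [|e /andP[]//]; apply: uI; rewrite -mem_enum.
  apply: lt_le_trans (dm c (ltW c0) _); first exact: mulr_gt0.
  by move=> i iI; apply: Hc; rewrite ?c0 ?lexx ?mem_enum.
have [v vV|B B0 HB] := @large_enough R _ V
    (fun e (v : 'rV[R]_n) => forall i, 0 < v 0 i -> d <= e * v 0 i).
  have [i _|e e0 He] := @large_enough R _ (enum 'I_n)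
      (fun e i => 0 < v 0 i -> d <= e * v 0 i).
    by exists (d / v 0 i) => e + vi; rewrite ler_pdivrMr.
  by exists e => e' ee' i; apply: He => //; rewrite mem_enum.
pose u' : 'rV[R]_n := \row_i (if i \in I then u 0 i else B).
have u'0 i : 0 < u' 0 i by rewrite mxE; case: ifPn => // /uI.
have u'd v : v \in V -> d <= dot u' v.
  move=> vV; have [vI|] := boolP (v \in VI).
    apply: le_trans (amin _ vI) _; rewrite le_eqVlt; apply/orP; left.
    move: vI; rewrite mem_filter vV andbT => /forallP vI.
    apply/eqP/eq_bigr => i _; rewrite [u' 0 i]mxE; case: ifPn => // iI.
    by have := vI i; rewrite iI => /eqP->; rewrite !mulr0.
  rewrite mem_filter vV andbT => vN.
  have [i iI vi] : exists2 i, i \notin I & v 0 i != 0.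
    apply: contrapT => H; move/negP: vN; apply; apply/forallP => i.
    by apply/implyP => iI; apply: contraT => vi; exfalso; apply: H; exists i.
  apply: (@le_trans _ _ (B * v 0 i)).
    by apply: HB; rewrite ?lexx// lt_neqAle eq_sym vi Vr.
  rewrite /dot (bigD1 i)//= [u' 0 i]mxE (negbTE iI) lerDl.
  by apply: sumr_ge0 => k _; apply: mulr_ge0; [exact: ltW | exact: Vr].
have [w [w0 wu wd wt]] :=
  lower_weight (enum 'I_n) V0 ax d0 (fun i => ltW (u'0 i)) u'd.
have wv i v : v \in V -> (forall k, k != i -> v 0 k = 0) -> d <= w 0 i * v 0 i.
  move=> vV vN; have := wd _ vV.
  by rewrite /dot (bigD1 i)//= big1 ?addr0// => k ki; rewrite vN ?mulr0.
exists w, d; split=> //.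
- split=> i; last by move=> iI; have := wu i; rewrite mxE iI.
  have [v vV [vi vN]] := ax i; have := lt_le_trans d0 (wv i v vV vN).
  by rewrite pmulr_lgt0.
- exists a => //.
  have u'a : dot u' a = d.
    apply: eq_bigr => i _; rewrite [u' 0 i]mxE; case: ifPn => // iI.
    by rewrite aI// !mulr0.
  have termle i : w 0 i * a 0 i <= u' 0 i * a 0 i by rewrite ler_wpM2r ?wu// Vr.
  have wa : dot w a = d.
    apply/eqP; rewrite eq_le wd// andbT -u'a; exact: ler_sum.
  split=> // i ai; have iI : i \in I by apply: contraNT ai => /aI ->.
  split=> //; have sum0 : \sum_k (u' 0 k * a 0 k - w 0 k * a 0 k) = 0.
    by rewrite sumrB -!/(dot _ _) u'a wa subrr.
  have ge0 k : true -> 0 <= u' 0 k * a 0 k - w 0 k * a 0 k by rewrite subr_ge0.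
  have /eqP := psumr_eq0P ge0 sum0 (i := i) isT.
  by rewrite -mulrBl mulf_eq0 (negbTE ai) orbF subr_eq0 mxE iI => /eqP.
- by move=> i; apply: wt; rewrite mem_enum.
- move=> c c0 cu i; have [v vV [vi vN km]] := Hk i.
  rewrite -(ler_pM2r vi); apply: le_trans (wv _ _ vV vN).
  apply: le_trans (dm _ c0 cu).
  by rewrite mulrAC ler_wpM2r.
Qed.

(** * Functions with a locally Lipschitz gradient *)

Lemma nbhs_rVP (R : realType) M (a : 'rV[R]_M) (N : set 'rV[R]_M) :
  nbhs a N <-> exists2 d, 0 < d & forall y, `|y - a| < d -> N y.
Proof.
split=> [/nbhs_ballP[d /= d0 H]|[d d0 H]].
  by exists d => // y ya; apply: H; rewrite -ball_normE /ball_ /= distrC.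
apply/nbhs_ballP; exists d => //= y; rewrite -ball_normE /ball_ /= distrC.
exact: H.
Qed.

Lemma continuous_at_rV (R : realType) M (V : normedModType R) (phi : 'rV[R]_M -> V)
    (a : 'rV[R]_M) :
  (forall e, 0 < e -> exists2 d, 0 < d & forall y, `|y - a| < d -> `|phi y - phi a| <= e) ->
  {for a, continuous phi}.
Proof.
move=> H; have FF : Filter (nbhs a) by exact: nbhs_filter.
apply/(@cvgrPdist_le _ _ _ (nbhs a) FF) => e /H[d d0 Hd].
by apply/nbhs_rVP; exists d => // y /Hd; rewrite distrC.
Qed.

Definition loc_lipschitz (R : realType) M (phi : 'rV[R]_M -> R) (a : 'rV[R]_M) :=
  exists (N : set 'rV[R]_M) (C : R), [/\ nbhs a N, 0 <= C &
    forall x y, N x -> N y -> `|phi y - phi x| <= C * `|y - x|].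

(** Differentiability with gradient [G], with a quadratic remainder that is
    uniform near [a]; unlike differentiability at points this survives limits
    with uniform constants, and the gradients are regular enough for the
    uniqueness of trajectories. *)
Definition c11 (R : realType) M (phi : 'rV[R]_M -> R) (G : 'rV[R]_M -> 'rV[R]_M)
    (a : 'rV[R]_M) :=
  (exists (N : set 'rV[R]_M) (C : R), [/\ nbhs a N, 0 <= C &
    forall x y, N x -> N y ->
      `|phi y - phi x - dot (G x) (y - x)| <= C * `|y - x| ^+ 2]) /\
  forall i, loc_lipschitz (fun x => G x 0 i) a.

Section LocLipschitz.
Context {R : realType} {M : nat}.
Implicit Types (phi psi : 'rV[R]_M -> R) (a : 'rV[R]_M).

Lemma loc_lipschitz_cst c a : loc_lipschitz (fun=> c) a.
Proof.
exists setT, 0; split=> // [|x y _ _]; first exact: filterT.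
by rewrite subrr normr0 mul0r.
Qed.

Lemma loc_lipschitz_coord i a : loc_lipschitz (fun x => x 0 i) a.
Proof.
exists setT, 1; split=> // [|x y _ _]; first exact: filterT.
by rewrite mul1r (le_trans _ (normrv_le _ i))// !mxE.
Qed.

Lemma loc_lipschitz_bounded phi a : loc_lipschitz phi a ->
  exists (N : set 'rV[R]_M) (C : R), [/\ nbhs a N, 0 <= C &
    forall x, N x -> `|phi x| <= C].
Proof.
move=> [N [C [Na C0 H]]]; exists (N `&` ball a 1), (`|phi a| + C); split.
- by apply: filterI => //; exact: nbhsx_ballx.
- by rewrite addr_ge0.
move=> x [Nx]; rewrite -ball_normE /ball_ /= distrC => xa.
have := H _ _ (nbhs_singleton Na) Nx.
have : C * `|x - a| <= C by rewrite ler_piMr// ltW.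
have := ler_normD (phi x - phi a) (phi a); rewrite subrK; lra.
Qed.

Lemma loc_lipschitzD phi psi a : loc_lipschitz phi a -> loc_lipschitz psi a ->
  loc_lipschitz (fun x => phi x + psi x) a.
Proof.
move=> [N [C [Na C0 H]]] [N' [C' [Na' C0' H']]].
exists (N `&` N'), (C + C'); split; [exact: filterI|exact: addr_ge0|].
move=> x y [Nx Nx'] [Ny Ny']; rewrite opprD addrACA.
by rewrite (le_trans (ler_normD _ _))// mulrDl lerD// ?H ?H'.
Qed.

Lemma loc_lipschitzM phi psi a : loc_lipschitz phi a -> loc_lipschitz psi a ->
  loc_lipschitz (fun x => phi x * psi x) a.
Proof.
move=> Hp Hq; have [N1 [B [Na1 B0 HB]]] := loc_lipschitz_bounded Hp.
have [N2 [B' [Na2 B0' HB']]] := loc_lipschitz_bounded Hq.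
move: Hp Hq => [N [C [Na C0 H]]] [N' [C' [Na' C0' H']]].
exists ((N `&` N') `&` (N1 `&` N2)), (B * C' + C * B'); split.
- by apply: filterI; exact: filterI.
- by rewrite addr_ge0// mulr_ge0.
move=> x y [[Nx Nx'] [N1x N2x]] [[Ny Ny'] [N1y N2y]].
rewrite (_ : _ - _ = phi y * (psi y - psi x) + (phi y - phi x) * psi x); last ring.
rewrite (le_trans (ler_normD _ _))// !normrM mulrDl -!mulrA lerD//.
  by apply: ler_pM; rewrite ?HB ?H'.
by rewrite (mulrC B') mulrA ler_pM ?H ?HB'.
Qed.

Lemma loc_lipschitz_ext phi psi a : phi =1 psi ->
  loc_lipschitz phi a -> loc_lipschitz psi a.
Proof. by move=> /funext ->. Qed.

Lemma loc_lipschitzN phi a : loc_lipschitz phi a -> loc_lipschitz (fun x => - phi x) a.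
Proof.
move=> [N [C [Na C0 H]]]; exists N, C; split=> // x y Nx Ny.
by rewrite -opprD normrN H.
Qed.

Lemma loc_lipschitz_sum I (r : seq I) (P : pred I) (phi : I -> 'rV[R]_M -> R) a :
  (forall i, loc_lipschitz (phi i) a) ->
  loc_lipschitz (fun x => \sum_(i <- r | P i) phi i x) a.
Proof.
move=> H; elim: r => [|i r IH].
  by under [X in loc_lipschitz X]funext do rewrite big_nil; exact: loc_lipschitz_cst.
under [X in loc_lipschitz X]funext do rewrite big_cons.
by case: (P i) => //; exact: loc_lipschitzD.
Qed.

Lemma loc_lipschitz_prod I (r : seq I) (P : pred I) (phi : I -> 'rV[R]_M -> R) a :
  (forall i, loc_lipschitz (phi i) a) ->
  loc_lipschitz (fun x => \prod_(i <- r | P i) phi i x) a.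
Proof.
move=> H; elim: r => [|i r IH].
  by under [X in loc_lipschitz X]funext do rewrite big_nil; exact: loc_lipschitz_cst.
under [X in loc_lipschitz X]funext do rewrite big_cons.
by case: (P i) => //; exact: loc_lipschitzM.
Qed.

Lemma loc_lipschitz_continuous phi a : loc_lipschitz phi a -> {for a, continuous phi}.
Proof.
move=> [N [C [Na C0 H]]]; apply: continuous_at_rV => e e0.
have [d d0 Hd] := (nbhs_rVP _ _).1 Na.
have C1 : 0 < C + 1 by rewrite ltr_wpDl.
exists (Num.min d (e / (C + 1))); first by rewrite lt_min d0 divr_gt0.
move=> y; rewrite lt_min => /andP[/Hd Ny]; rewrite ltr_pdivlMr// => ye.
rewrite (le_trans (H _ _ (nbhs_singleton Na) Ny))//.
by have := normr_ge0 (y - a); nra.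
Qed.

Lemma loc_lipschitzV phi a : loc_lipschitz phi a -> phi a != 0 ->
  loc_lipschitz (fun x => (phi x)^-1) a.
Proof.
move=> Hp pa; have cp := loc_lipschitz_continuous Hp.
move: Hp => [N [C [Na C0 H]]].
pose m := `|phi a| / 2; have m0 : 0 < m by rewrite divr_gt0 ?normr_gt0.
pose N1 := [set x | m <= `|phi x|].
have N1a : nbhs a N1.
  have FF : Filter (nbhs a) by exact: nbhs_filter.
  have /(@cvgrPdist_le _ _ _ (nbhs a) FF)/(_ _ m0) := cp; apply: filterS => x.
  rewrite /N1 /m /=; have := ler_normD (phi a - phi x) (phi x); rewrite subrK.
  by lra.
exists (N `&` N1), (C / m ^+ 2); split=> //; first exact: filterI.
  by rewrite divr_ge0// exprn_ge0// ltW.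
move=> x y [Nx N1x] [Ny N1y].
have x0 : phi x != 0 by rewrite -normr_gt0 (lt_le_trans m0).
have y0 : phi y != 0 by rewrite -normr_gt0 (lt_le_trans m0).
rewrite (_ : _ - _ = - (phi y - phi x) / (phi x * phi y)); last by field; rewrite ?x0 ?y0.
rewrite normrM normrN normfV normrM mulrAC.
rewrite ler_pM ?invr_ge0 ?mulr_ge0 ?H// lef_pV2 ?posrE ?exprn_gt0 ?mulr_gt0 ?normr_gt0// expr2.
by apply: ler_pM => //; exact: ltW.
Qed.

Lemma loc_lipschitz_det k (A : 'rV[R]_M -> 'M[R]_k) a :
  (forall i j, loc_lipschitz (fun x => A x i j) a) ->
  loc_lipschitz (fun x => \det (A x)) a.
Proof.
move=> H; apply: loc_lipschitz_sum => s; apply: loc_lipschitzM.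
  exact: loc_lipschitz_cst.
by apply: loc_lipschitz_prod => i; exact: H.
Qed.

Lemma loc_lipschitz_mulmx k l m (A : 'rV[R]_M -> 'M[R]_(k, l))
    (B : 'rV[R]_M -> 'M[R]_(l, m)) a :
  (forall i j, loc_lipschitz (fun x => A x i j) a) ->
  (forall i j, loc_lipschitz (fun x => B x i j) a) ->
  forall i j, loc_lipschitz (fun x => (A x *m B x) i j) a.
Proof.
move=> HA HB i j; under [X in loc_lipschitz X]funext do rewrite mxE.
by apply: loc_lipschitz_sum => l'; exact: loc_lipschitzM.
Qed.

Lemma loc_lipschitz_adj k (A : 'rV[R]_M -> 'M[R]_k) a :
  (forall i j, loc_lipschitz (fun x => A x i j) a) ->
  forall i j, loc_lipschitz (fun x => (\adj (A x)) i j) a.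
Proof.
move=> H i j; under [X in loc_lipschitz X]funext do rewrite mxE.
apply: loc_lipschitzM; first exact: loc_lipschitz_cst.
apply: loc_lipschitz_det => i' j'.
by under [X in loc_lipschitz X]funext do rewrite !mxE; exact: H.
Qed.

End LocLipschitz.

Lemma dot_norm (R : realType) M (u v : 'rV[R]_M) : `|dot u v| <= M%:R * (`|u| * `|v|).
Proof.
rewrite (le_trans (ler_norm_sum _ _ _))//.
apply: (@le_trans _ _ (\sum_(i < M) `|u| * `|v|)).
  by apply: ler_sum => i _; rewrite normrM ler_pM ?normrv_le.
by rewrite sumr_const card_ord mulr_natl.
Qed.

Section C11.
Context {R : realType} {M : nat}.
Implicit Types (phi psi : 'rV[R]_M -> R) (G H : 'rV[R]_M -> 'rV[R]_M) (a : 'rV[R]_M).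

Lemma loc_lipschitz_norm_bounded G a : (forall i, loc_lipschitz (fun x => G x 0 i) a) ->
  exists (N : set 'rV[R]_M) (C : R), [/\ nbhs a N, 0 <= C &
    forall x, N x -> `|G x| <= C].
Proof.
move=> HG; have /choice[F HF] : forall i, exists NC : set 'rV[R]_M * R,
    [/\ nbhs a NC.1, 0 <= NC.2 & forall x, NC.1 x -> `|G x 0 i| <= NC.2].
  by move=> i; have [N [C H]] := loc_lipschitz_bounded (HG i); exists (N, C).
exists [set x | forall i, (F i).1 x], (\sum_i (F i).2); split.
- have FF : Filter (nbhs a) by exact: nbhs_filter.
  by apply: (@filter_forall _ _ (fun i => (F i).1) _ FF) => i; case: (HF i).
- by apply: sumr_ge0 => i _; case: (HF i).
move=> x Nx; apply: normrv_leP; first by apply: sumr_ge0 => i _; case: (HF i).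
move=> i; have [_ _ /(_ x (Nx i)) H] := HF i; apply: le_trans H _.
by rewrite (bigD1 i)//= lerDl sumr_ge0// => k _; case: (HF k).
Qed.

Lemma c11_loc_lipschitz phi G a : c11 phi G a -> loc_lipschitz phi a.
Proof.
move=> [[N [C [Na C0 Hp]]] /loc_lipschitz_norm_bounded[N' [C' [Na' C0' HG]]]].
exists ((N `&` N') `&` ball a 1), (M%:R * C' + C * 2); split.
- by apply: filterI; [exact: filterI | exact: nbhsx_ballx].
- by rewrite addr_ge0// mulr_ge0.
move=> x y [[Nx Nx']] + [[Ny Ny']].
rewrite -ball_normE /ball_ /= => xa ya.
have := Hp _ _ Nx Ny; have := dot_norm (G x) (y - x).
have xy : `|y - x| <= 2.
  have := ler_normB (a - x) (a - y).
  by rewrite opprB addrC addrA subrK; lra.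
have : `|y - x| ^+ 2 <= 2 * `|y - x| by rewrite expr2 ler_wpM2r.
have := ler_normD (phi y - phi x - dot (G x) (y - x)) (dot (G x) (y - x)).
rewrite subrK => h1 h2 h3 h4.
apply: (le_trans h1); rewrite mulrDl addrC lerD//.
  by apply: (le_trans h3); rewrite -mulrA ler_wpM2l// ler_wpM2r// HG.
by apply: (le_trans h4); rewrite -mulrA ler_wpM2l.
Qed.

Lemma c11_cst c a : c11 (fun=> c) (fun=> 0) a.
Proof.
split=> [|i]; last first.
  by under [X in loc_lipschitz X]funext do rewrite mxE; exact: loc_lipschitz_cst.
exists setT, 0; split=> // [|x y _ _]; first exact: filterT.
by rewrite dot0l !subr0 subrr normr0 mul0r.
Qed.

Lemma c11_dot u a : c11 (dot u) (fun=> u) a.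
Proof.
split=> [|i]; last exact: loc_lipschitz_cst.
exists setT, 0; split=> // [|x y _ _]; first exact: filterT.
by rewrite dotBr subrr normr0 mul0r.
Qed.

Lemma c11D phi psi G H a : c11 phi G a -> c11 psi H a ->
  c11 (fun x => phi x + psi x) (fun x => G x + H x) a.
Proof.
move=> [[N [C [Na C0 Hp]]] HG] [[N' [C' [Na' C0' Hp']]] HH]; split; last first.
  move=> i; under [X in loc_lipschitz X]funext do rewrite mxE.
  exact: loc_lipschitzD.
exists (N `&` N'), (C + C'); split; [exact: filterI|exact: addr_ge0|].
move=> x y [Nx Nx'] [Ny Ny']; have := Hp _ _ Nx Ny; have := Hp' _ _ Nx' Ny'.
rewrite dotDl mulrDl => h1 h2; rewrite (_ : _ - _ = (phi y - phi x - dot (G x) (y - x)) +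
  (psi y - psi x - dot (H x) (y - x))); last ring.
by rewrite (le_trans (ler_normD _ _))// lerD.
Qed.

Lemma c11M phi psi G H a : c11 phi G a -> c11 psi H a ->
  c11 (fun x => phi x * psi x) (fun x => phi x *: H x + psi x *: G x) a.
Proof.
move=> Hphi Hpsi; have Lphi := c11_loc_lipschitz Hphi.
have Lpsi := c11_loc_lipschitz Hpsi; split; last first.
  move=> i; under [X in loc_lipschitz X]funext do rewrite mxE [X in X + _]mxE [X in _ + X]mxE.
  by apply: loc_lipschitzD; apply: loc_lipschitzM => //; [case: Hpsi | case: Hphi].
have [N1 [B1 [Na1 B10 H1]]] := loc_lipschitz_bounded Lphi.
have [N2 [B2 [Na2 B20 H2]]] := loc_lipschitz_bounded Lpsi.
move: Hphi Hpsi => [[N3 [C3 [Na3 C30 H3]]] _] [[N4 [C4 [Na4 C40 H4]]] _].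
move: Lphi Lpsi => [N5 [C5 [Na5 C50 H5]]] [N6 [C6 [Na6 C60 H6]]].
exists (N1 `&` N2 `&` (N3 `&` N4) `&` (N5 `&` N6)), (C5 * C6 + B1 * C4 + B2 * C3).
split; first by do ?apply: filterI.
  by do ?apply: addr_ge0; exact: mulr_ge0.
move=> x y [[[x1 x2] [x3 x4]] [x5 x6]] [[[y1 y2] [y3 y4]] [y5 y6]].
rewrite dotDl !dotZl; set h := `|y - x|; set gx := dot _ _; set hx := dot _ _.
rewrite (_ : _ - _ = (phi y - phi x) * (psi y - psi x) +
  phi x * (psi y - psi x - gx) + psi x * (phi y - phi x - hx)); last ring.
rewrite (le_trans (ler_normD _ _))// [leRHS]mulrDl lerD//.
  rewrite (le_trans (ler_normD _ _))// [leRHS]mulrDl lerD// normrM.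
    by rewrite expr2 mulrACA ler_pM ?H5 ?H6.
  by rewrite -mulrA ler_pM ?H1 ?H4.
by rewrite normrM -mulrA ler_pM ?H2 ?H3.
Qed.

Lemma c11_sum I (r : seq I) (P : pred I) (phi : I -> 'rV[R]_M -> R)
    (G : I -> 'rV[R]_M -> 'rV[R]_M) a :
  (forall i, c11 (phi i) (G i) a) ->
  c11 (fun x => \sum_(i <- r | P i) phi i x) (fun x => \sum_(i <- r | P i) G i x) a.
Proof.
move=> H; elim: r => [|i r IH].
  under [X in c11 X]funext do rewrite big_nil.
  by under [X in c11 _ X]funext do rewrite big_nil; exact: c11_cst.
under [X in c11 X]funext do rewrite big_cons.
under [X in c11 _ X]funext do rewrite big_cons.
by case: (P i) => //; exact: c11D.
Qed.

End C11.

Lemma norm_mulmx (R : realType) M M' (B : 'M[R]_(M, M')) :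
  exists2 k, 0 < k & forall z : 'rV[R]_M, `|z *m B| <= k * `|z|.
Proof.
exists (1 + \sum_j M%:R * `|(col j B)^T|).
  by rewrite ltr_wpDr// sumr_ge0// => j _; rewrite mulr_ge0.
move=> z; apply: normrv_leP => [|j].
  by rewrite mulr_ge0// addr_ge0// sumr_ge0// => k _; rewrite mulr_ge0.
have -> : (z *m B) 0 j = dot (col j B)^T z.
  by rewrite dotC dot_mulmx trmxK !mxE; apply: eq_bigr => i _; rewrite mxE.
apply: le_trans (dot_norm _ _) _; rewrite mulrA ler_wpM2r//.
rewrite (bigD1 j)//= addrA [1 + _]addrC -addrA lerDl addr_ge0//.
by rewrite sumr_ge0// => k _; rewrite mulr_ge0.
Qed.

Lemma mulmx_continuous (R : realType) M M' (B : 'M[R]_(M, M')) :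
  continuous (fun z : 'rV[R]_M => z *m B).
Proof.
move=> a; have [k k0 H] := norm_mulmx B; apply: continuous_at_rV => e e0.
exists (e / k); first exact: divr_gt0.
move=> y; rewrite ltr_pdivlMr// -mulmxBl mulrC => /ltW.
exact: le_trans.
Qed.

Lemma loc_lipschitz_comp_lin (R : realType) M M' (B : 'M[R]_(M, M'))
    (phi : 'rV[R]_M' -> R) (a : 'rV[R]_M) :
  loc_lipschitz phi (a *m B) -> loc_lipschitz (fun z => phi (z *m B)) a.
Proof.
move=> [N [C [Na C0 H]]]; have [k k0 Hk] := norm_mulmx B.
exists [set z | N (z *m B)], (C * k); split.
- exact: (mulmx_continuous Na).
- by rewrite mulr_ge0// ltW.
move=> x y Nx Ny; rewrite -mulrA (le_trans (H _ _ Nx Ny))//.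
by rewrite ler_wpM2l// -mulmxBl.
Qed.

Lemma c11_comp_lin (R : realType) M M' (B : 'M[R]_(M, M'))
    (phi : 'rV[R]_M' -> R) G (a : 'rV[R]_M) :
  c11 phi G (a *m B) -> c11 (fun z => phi (z *m B)) (fun z => G (z *m B) *m B^T) a.
Proof.
move=> [[N [C [Na C0 H]]] HG]; split; last first.
  apply: loc_lipschitz_mulmx => i j; last exact: loc_lipschitz_cst.
  by rewrite ord1; apply: (loc_lipschitz_comp_lin (HG j)).
have [k k0 Hk] := norm_mulmx B.
exists [set z | N (z *m B)], (C * k ^+ 2); split.
- exact: (mulmx_continuous Na).
- by rewrite mulr_ge0// exprn_ge0// ltW.
move=> x y Nx Ny; have := H _ _ Nx Ny.
rewrite !dot_mulmx -mulmxA -trmx_mul mulmxBl => h; apply: (le_trans h).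
rewrite -mulrA ler_wpM2l// -exprMn lerXn2r ?nnegrE ?mulr_ge0 ?(ltW k0)//.
by rewrite -mulmxBl.
Qed.

Lemma diff_quadratic (R : realType) (V W : normedModType R) (f : V -> W)
    (df : {linear V -> W}) (a : V) C :
  continuous df -> 0 <= C ->
  (\forall h \near (0 : V), `|f (h + a) - f a - df h| <= C * `|h| ^+ 2) ->
  differentiable f a /\ 'd f a = df :> (V -> W).
Proof.
move=> dfc C0 H.
have E : f \o shift a = cst (f a) + df +o_ (0 : V) id.
  apply/eqaddoP => e e0; near=> h.
  rewrite /= !fctE /= opprD addrA.
  have : `|f (h + a) - f a - df h| <= C * `|h| ^+ 2 by near: h.
  have h0 : `|h| <= e / (C + 1).
    near: h; apply: nbhs0_le.
    by rewrite divr_gt0// ltr_wpDl.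
  move=> hC; apply: (le_trans hC).
  move: h0; rewrite ler_pdivlMr ?ltr_wpDl// => h0.
  by have := normr_ge0 h; rewrite expr2; nra.
have dE := diff_unique dfc E; split=> //.
by apply/diff_locallyP; rewrite dE.
Unshelve. all: by end_near. Qed.

Lemma c11_near (R : realType) M (phi : 'rV[R]_M -> R) G a :
  c11 phi G a -> exists2 C, 0 <= C &
  \forall h \near (0 : 'rV[R]_M), `|phi (h + a) - phi a - dot (G a) h| <= C * `|h| ^+ 2.
Proof.
move=> [[N [C [Na C0 H]]] _]; exists C => //.
have [d d0 Hd] := (nbhs_rVP _ _).1 Na.
apply/nbhs_rVP; exists d => // h; rewrite subr0 => hd.
have := H a (h + a) (nbhs_singleton Na); rewrite addrK; apply.
by apply: Hd; rewrite addrK.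
Qed.

Lemma c11_jacobian (R : realType) M P (f : 'rV[R]_M -> 'rV[R]_P)
    (G : 'I_P -> 'rV[R]_M -> 'rV[R]_M) a :
  (forall j, c11 (fun x => f x 0 j) (G j) a) ->
  jacobian f a = \matrix_(i, j) G j a 0 i.
Proof.
move=> H; pose J := \matrix_(i, j) G j a 0 i.
have /choice[C HC] := fun j => let: ex_intro2 c h1 h2 := c11_near (H j) in
  ex_intro (fun c => 0 <= c /\ _) c (conj h1 h2).
have FF : Filter (nbhs (0 : 'rV[R]_M)) by exact: nbhs_filter.
have [] := @diff_quadratic R _ _ f (mulmxr J) a (\sum_j C j).
- exact: mulmx_continuous.
- by apply: sumr_ge0 => j _; case: (HC j).
- have : \forall h \near (0 : 'rV[R]_M), forall j,
      `|f (h + a) 0 j - f a 0 j - dot (G j a) h| <= C j * `|h| ^+ 2.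
    apply: (@filter_forall _ _ (fun j h =>
      `|f (h + a) 0 j - f a 0 j - dot (G j a) h| <= C j * `|h| ^+ 2) _ FF) => j.
    by case: (HC j).
  apply: filterS => h Hh; apply: normrv_leP => [|j].
    by rewrite mulr_ge0 ?exprn_ge0// sumr_ge0// => j _; case: (HC j).
  have := Hh j; rewrite !mxE dotC.
  have -> : dot h (G j a) = \sum_k h 0 k * J k j.
    by apply: eq_bigr => k _; rewrite mxE.
  move=> h1; apply: (le_trans h1); rewrite ler_wpM2r ?exprn_ge0//.
  rewrite (bigD1 j)//= lerDl; apply: sumr_ge0 => k _; by case: (HC k).
move=> _ dE; apply/matrixP => i j; rewrite /jacobian mxE dE /=.
by rewrite -rowE [LHS]mxE.
Qed.

Lemma c11_grad_unique (R : realType) M (phi : 'rV[R]_M -> R) G H a :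
  c11 phi G a -> c11 phi H a -> G a = H a.
Proof.
move=> HG HH; pose f x : 'rV[R]_1 := (phi x)%:M.
have fE : (fun x => f x 0 0) = phi by apply/funext => x; rewrite mxE eqxx mulr1n.
have := @c11_jacobian R M 1 f (fun=> G) a; have := @c11_jacobian R M 1 f (fun=> H) a.
move=> -> => [|j]; last by rewrite ord1 fE.
move=> E; have /matrixP E' := E (fun j => ltac:(by rewrite ord1 fE)).
by apply/rowP => i; have := E' i 0; rewrite !mxE.
Qed.

Lemma is_derive_comp_c11 (R : realType) M (phi : 'rV[R]_M -> R) G
    (g : R -> 'rV[R]_M) (v : 'rV[R]_M) (t : R) :
  is_derive t 1 g v -> c11 phi G (g t) ->
  is_derive t 1 (fun s => phi (g s)) (dot (G (g t)) v).
Proof.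
move=> gv /[dup] HG /c11_near[C C0 HC].
pose d h := dot (G (g t)) h.
have dlin : linear d by move=> c u w; rewrite /d dotDr dotZr.
pose dM := GRing.isLinear.Build _ _ _ _ _ dlin.
pose dL : {linear 'rV[R]_M -> R} := HB.pack d dM.
have [|dphi dE] := @diff_quadratic R _ _ phi dL (g t) C _ C0 HC.
  exact: dot_continuous.
have dg : differentiable g t by apply/derivable1_diffP; exact: ex_derive.
have dc : differentiable (phi \o g) t by exact: differentiable_comp.
split; first exact/derivable1_diffP.
rewrite deriveE// diff_comp//= dE /= /d.
by rewrite -deriveE// (@derive_val _ _ _ _ _ _ _ gv).
Qed.

(** * Real analytic functions have a locally Lipschitz gradient *)

Lemma multinom_ind M (Q : multinom M -> Prop) :
  Q (@mnm0 M) -> (forall k i, Q k -> Q (mnm_add k (mnm1 i))) -> forall k, Q k.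
Proof.
move=> Q0 QS k; have [d] := ubnP (mdeg k); elim: d k => // d IH k kd.
have [k0|] := eqVneq (mdeg k) 0%N.
  by have /eqP := k0; rewrite mdeg_eq0 => /eqP ->.
rewrite mdegE => k0; have [i ki] : exists i, (0 < k i)%N.
  apply: contrapT => N; move/eqP: k0; apply; apply: big1 => i _.
  by apply/eqP; rewrite -leqn0 leqNgt; apply/negP => ki; apply: N; exists i.
have kE : mnm_add (mnm_sub k (mnm1 i)) (mnm1 i) = k.
  by apply/mnmP => j; rewrite mnmDE mnmBE mnm1E; case: eqVneq => [<-|_]; rewrite ?subnK// subn0 addn0.
rewrite -kE; apply/QS/IH; move: kd; rewrite -{1}kE mdegD mdeg1 addn1.
by rewrite ltnS.
Qed.

Section Monomials.
Context {R : realType} {M : nat}.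
Implicit Types (k : multinom M) (x y : 'rV[R]_M).

Definition monom k x : R := \prod_i x 0 i ^+ k i.

Lemma monom0 x : monom (@mnm0 M) x = 1.
Proof. by rewrite /monom big1// => i _; rewrite mnm0E. Qed.

Lemma monomS k i x : monom (mnm_add k (mnm1 i)) x = monom k x * x 0 i.
Proof.
rewrite /monom (bigD1 i)//= [in RHS](bigD1 i)//= mnmDE mnm1E eqxx addn1 exprSr.
rewrite mulrAC; congr (_ * _ * _); apply: eq_bigr => j ji.
by rewrite mnmDE mnm1E eq_sym (negbTE ji) addn0.
Qed.

(** The constants grow only quadratically with the degree, so that a geometric
    series will absorb them. *)
Lemma monom_c11_bounds (s : R) : 0 < s -> forall k, exists G : 'rV[R]_M -> 'rV[R]_M,
  forall x y, `|x| <= s -> `|y| <= s -> let d := (mdeg k)%:R in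
  [/\ `|monom k x| <= s ^+ mdeg k,
      `|monom k y - monom k x| <= d * s ^+ mdeg k / s * `|y - x|,
      forall i, `|G x 0 i| <= d * s ^+ mdeg k / s,
      forall i, `|G y 0 i - G x 0 i| <= d ^+ 2 * s ^+ mdeg k / s ^+ 2 * `|y - x| &
      `|monom k y - monom k x - dot (G x) (y - x)| <=
        d ^+ 2 * s ^+ mdeg k / s ^+ 2 * `|y - x| ^+ 2].
Proof.
move=> s0; elim/multinom_ind => [|k i [G H]].
  exists (fun=> 0) => x y xs ys /=; rewrite mdeg0 !monom0 dot0l subrr subr0.
  rewrite expr0n !mul0r normr0 normr1.
  by split=> // j; rewrite !mxE ?subrr normr0.
exists (fun x => monom k x *: delta_mx 0 i + x 0 i *: G x) => x y xs ys.
have [h1 h2 h3 h4 h5] := H x y xs ys.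
have [g1 _ g3 _ _] := H y x ys xs.
rewrite !monomS mdegD mdeg1 addn1 => /=.
move: (mdeg k) h1 h2 h3 h4 h5 g1 g3 => d; set A := s ^+ d.
set B := d%:R * A / s; set C := d%:R ^+ 2 * A / s ^+ 2; set h := `|y - x|.
move=> h1 h2 h3 h4 h5 g1 g3.
have A0 : 0 <= A by rewrite exprn_ge0// ltW.
have xi : `|x 0 i| <= s by apply: le_trans (normrv_le _ _) xs.
have yi : `|y 0 i| <= s by apply: le_trans (normrv_le _ _) ys.
have hi : `|y 0 i - x 0 i| <= h.
  by have := normrv_le (y - x) i; rewrite !mxE.
have h0 : 0 <= h by exact: normr_ge0.
have B0 : 0 <= B by rewrite !mulr_ge0// ?invr_ge0 ltW.
have C0 : 0 <= C by rewrite !mulr_ge0// ?invr_ge0 ?exprn_ge0// ltW.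
have -> : d.+1%:R * s ^+ d.+1 / s = A + s * B.
  by rewrite /B exprSr -natr1 -/A; field; rewrite gt_eqF.
have CB : 2 * B + s * C <= d.+1%:R ^+ 2 * s ^+ d.+1 / s ^+ 2.
  have -> : d.+1%:R ^+ 2 * s ^+ d.+1 / s ^+ 2 = 2 * B + s * C + A / s.
    by rewrite /B /C (exprSr s) -[d.+1%:R]natr1 -/A; field; rewrite gt_eqF.
  by rewrite lerDl divr_ge0// ltW.
have lipM : `|monom k y * y 0 i - monom k x * x 0 i| <= (A + s * B) * h.
  rewrite (_ : _ - _ = monom k y * (y 0 i - x 0 i) +
    (monom k y - monom k x) * x 0 i); last ring.
  rewrite (le_trans (ler_normD _ _))// [leRHS]mulrDl !normrM.
  by rewrite lerD// ?(mulrC s) ?[B * s * h]mulrAC ler_pM.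
split=> //.
- by rewrite normrM exprSr ler_pM.
- move=> j; rewrite !mxE eqxx /= (le_trans (ler_normD _ _))// !normrM lerD//.
    by rewrite -[leRHS]mulr1 ler_pM//; case: (_ == _); rewrite ?normr1 ?normr0.
  by rewrite ler_pM.
- move=> j; apply: (@le_trans _ _ ((2 * B + s * C) * h)); last exact: ler_wpM2r.
  rewrite !mxE eqxx /=; set e := _%:R.
  rewrite (_ : _ - _ = (monom k y - monom k x) * e + ((y 0 i - x 0 i) * G x 0 j
     + y 0 i * (G y 0 j - G x 0 j))); last ring.
  have e1 : `|e| <= 1 by rewrite /e; case: (_ == _); rewrite ?normr1 ?normr0.
  rewrite (le_trans (ler_normD _ _))//.
  have t1 : `|(monom k y - monom k x) * e| <= B * h.
    by rewrite normrM -[leRHS]mulr1 ler_pM.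
  have t2 := ler_normD ((y 0 i - x 0 i) * G x 0 j) (y 0 i * (G y 0 j - G x 0 j)).
  have t3 : `|(y 0 i - x 0 i) * G x 0 j| <= B * h.
    by rewrite normrM mulrC ler_pM.
  have t4 : `|y 0 i * (G y 0 j - G x 0 j)| <= s * (C * h).
    by rewrite normrM ler_pM.
  by lra.
- apply: (@le_trans _ _ ((2 * B + s * C) * h ^+ 2)); last by rewrite ler_wpM2r ?exprn_ge0.
  rewrite dotDl !dotZl (dotC (delta_mx _ _)) dot_deltar [(y - x) 0 i]mxE [(- x) 0 i]mxE.
  rewrite (_ : _ - _ = (monom k y - monom k x) * (y 0 i - x 0 i) +
     x 0 i * (monom k y - monom k x - dot (G x) (y - x))); last ring.
  rewrite (le_trans (ler_normD _ _))//.
  have t1 : `|(monom k y - monom k x) * (y 0 i - x 0 i)| <= B * h ^+ 2.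
    by rewrite normrM expr2 mulrA ler_pM.
  have t2 : `|x 0 i * (monom k y - monom k x - dot (G x) (y - x))| <= s * (C * h ^+ 2).
    by rewrite normrM ler_pM.
  have : 0 <= B * h ^+ 2 by rewrite mulr_ge0 ?exprn_ge0.
  by lra.
Qed.

End Monomials.

Section UltraLimits.
Context {R : realType} {T : Type} (W : set_system T) {WU : UltraFilter W}.

Lemma fmap_ultra T' (f : T -> T') : UltraFilter (f @ W).
Proof.
split; first exact: fmap_proper_filter.
move=> G GF sG; apply/seteqP; split=> A GA; last exact: sG.
have [//|WA] := in_ultra_setVsetC (f @^-1` A) WU.
have /filter_ex[x [] //] : G (A `&` ~` A).
by apply: filterI => //; apply: sG; rewrite /= nbhs_filterE /= preimage_setC.
Qed.

Lemma ultra_cvg_rV M (f : T -> 'rV[R]_M) B : W [set t | `|f t| <= B] ->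
  exists l : 'rV[R]_M, f @ W --> l.
Proof.
move=> H; have : compact [set v : 'rV[R]_M | `|v| <= B].
  apply: (@compact_rV _ _ _ B) => //.
  apply: (closed_comp _ (@closed_le _ B)) => x _; exact: norm_continuous.
rewrite compact_ultra => /(_ (f @ W) (fmap_ultra f) H)[l [_ fl]].
by exists l.
Qed.

Lemma ultra_cvg_real (f : T -> R) B : W [set t | `|f t| <= B] ->
  exists l : R, f @ W --> l.
Proof.
move=> H; have /ultra_cvg_rV[l fl] : W [set t | `|(f t)%:M : 'rV_1| <= B].
  apply: filterS H => t /= ft; apply: normrv_leP => [|i].
    exact: le_trans (normr_ge0 _) ft.
  by rewrite ord1 mxE eqxx mulr1n.
exists (l 0 0); rewrite (_ : f = (fun v : 'rV[R]_1 => v 0 0) \o (fun t => (f t)%:M)).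
  apply: cvg_comp fl _; exact: coord_continuous.
by apply/funext => t /=; rewrite mxE eqxx mulr1n.
Qed.

Lemma ultra_cvg_le (f : T -> R) l c : f @ W --> l -> W [set t | f t <= c] -> l <= c.
Proof. by move=> fl H; exact: (@closed_cvg _ _ W _ f (fun x => x <= c) (@closed_le R c) H l fl). Qed.

End UltraLimits.

(** The powers of 2 are absorbed by halving the radius. *)
Lemma natr_le_exp2 (R : realType) d :
  d%:R <= 6 * 2 ^+ d :> R /\ d%:R ^+ 2 <= 6 * 2 ^+ d :> R.
Proof.
have H : d%:R ^+ 2 + 4 * d%:R + 6 <= 6 * 2 ^+ d :> R.
  elim: d => [|d IH]; first by rewrite expr0n mulr0 !add0r expr0 mulr1.
  rewrite (exprS 2) -[d.+1%:R]natr1; have := ler0n R d; have := sqr_ge0 (d%:R : R).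
  by rewrite (_ : (d%:R + 1) ^+ 2 = d%:R ^+ 2 + 2 * d%:R + 1); [lra | ring].
by have := ler0n R d; have := sqr_ge0 (d%:R : R); split; lra.
Qed.

(** The partial sums of the absolute values converge at the corner of a cube
    around [a], which bounds all the weighted sums of the coefficients. *)
Lemma analytic_series (R : realType) M (U : set 'rV[R]_M) (g : 'rV[R]_M -> R) a :
  analytic_on U g -> U a -> exists (c : multinom M -> R) t B,
  [/\ 0 < t, 0 <= B,
      forall N, \sum_(k : bmultinom M N) `|c (bmnm k)| * t ^+ mdeg (bmnm k) <= B &
      forall x, `|x - a| <= t -> power_sum c (x - a) N @[N --> \oo] --> g x].
Proof.
move=> ag /ag[c [r [r0 H]]].
pose t := r / 2; have t0 : 0 < t by rewrite divr_gt0.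
have inball x : `|x - a| <= t -> ball a r x.
  rewrite -ball_normE /ball_ /= distrC => xa; rewrite (le_lt_trans xa)//.
  by rewrite /t ltr_pdivrMr// ltr_pMr// ltr1n.
(* All coordinates of this point differ from those of [a] by [t]. *)
have [|/cvg_seq_bounded[B [_ HB]] _] := H (a + const_mx t).
  apply: inball; rewrite addrC addKr; apply: normrv_leP; first exact: ltW.
  by move=> i; rewrite mxE gtr0_norm.
exists c, t, (`|B| + 1); split=> // [N|x xt].
  have BB : B < `|B| + 1 by have := ler_norm B; lra.
  apply: le_trans (HB _ BB N I); apply: le_trans (ler_norm _).
  apply: ler_sum => k _; rewrite ler_wpM2l// mdegE expr_sum.
  apply: ler_prod => i _; rewrite exprn_ge0 ?(ltW t0)//= !mxE addrC addKr.
  by rewrite gtr0_norm.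
by have [] := H x (inball _ xt).
Qed.

(** A convergent power series is the limit of polynomials whose second
    differences are bounded uniformly on a smaller ball, and this bound survives
    any limit of their gradients. *)
Lemma analytic_c11_at (R : realType) M (U : set 'rV[R]_M) (g : 'rV[R]_M -> R) a :
  analytic_on U g -> U a -> exists G, c11 g G a.
Proof.
move=> ag Ua; have [c [t [B [t0 B0 HB H]]]] := analytic_series ag Ua.
pose s := t / 2; have s0 : 0 < s by rewrite divr_gt0.
have /choice[Gk HGk] := monom_c11_bounds (M := M) s0.
pose f N x := power_sum c (x - a) N.
pose GN N x : 'rV[R]_M := \sum_(k : bmultinom M N) c (bmnm k) *: Gk (bmnm k) (x - a).
have sumB N (F : bmultinom M N -> R) q : 0 <= q ->
    (forall k, `|F k| <= 6 * 2 ^+ mdeg (bmnm k) * s ^+ mdeg (bmnm k) * q) ->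
    \sum_k `|c (bmnm k) * F k| <= B * (6 * q).
  move=> q0 HF; apply: le_trans (_ : _ <= (\sum_(k : bmultinom M N)
      `|c (bmnm k)| * t ^+ mdeg (bmnm k)) * (6 * q)) _; last first.
    by rewrite ler_wpM2r// mulr_ge0.
  rewrite mulr_suml; apply: ler_sum => k _; rewrite normrM -mulrA ler_wpM2l//.
  apply: le_trans (HF k) _; rewrite -[6 * _ * _]mulrA -exprMn.
  have -> : 2 * s = t by rewrite /s; field.
  by rewrite mulrAC mulrC.
have dle d : d%:R <= 6 * 2 ^+ d :> R by case: (natr_le_exp2 R d).
have d2le d : d%:R ^+ 2 <= 6 * 2 ^+ d :> R by case: (natr_le_exp2 R d).
have GNb N x i : `|x - a| <= s -> `|GN N x 0 i| <= B * (6 / s).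
  move=> xs; rewrite summxE; under eq_bigr do rewrite mxE.
  apply: le_trans (ler_norm_sum _ _ _) _.
  apply: sumB => [|k]; first by rewrite invr_ge0 ltW.
  have [_ _ /(_ i) h _ _] := HGk (bmnm k) _ _ xs xs; apply: le_trans h _.
  by rewrite ler_wpM2r ?invr_ge0 ?(ltW s0)// ler_wpM2r ?exprn_ge0 ?(ltW s0).
have GNlip N x y i : `|x - a| <= s -> `|y - a| <= s ->
    `|GN N y 0 i - GN N x 0 i| <= B * (6 / s ^+ 2) * `|y - x|.
  move=> xs ys; rewrite !summxE -sumrB.
  under eq_bigr do rewrite !mxE -mulrBr.
  apply: le_trans (ler_norm_sum _ _ _) _.
  rewrite -mulrA -[6 / _ * _]mulrA; apply: sumB => [|k].
    by rewrite !mulr_ge0 ?invr_ge0 ?exprn_ge0 ?(ltW s0).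
  have [_ _ _ /(_ i) + _] := HGk (bmnm k) _ _ xs ys.
  rewrite opprB addrA subrK => h; apply: le_trans h _.
  rewrite -!mulrA mulrA [leRHS]mulrA ler_wpM2r//.
    by rewrite !mulr_ge0 ?invr_ge0 ?exprn_ge0 ?(ltW s0).
  exact: d2le.
have frem N x y : `|x - a| <= s -> `|y - a| <= s ->
    `|f N y - f N x - dot (GN N x) (y - x)| <= B * (6 / s ^+ 2) * `|y - x| ^+ 2.
  move=> xs ys; rewrite /f /power_sum dotC dot_sumr -!sumrB.
  have E (k : bmultinom M N) : true ->
      c (bmnm k) * \prod_i (y - a) 0 i ^+ (bmnm k) i -
      c (bmnm k) * \prod_i (x - a) 0 i ^+ (bmnm k) i -
      dot (y - x) (c (bmnm k) *: Gk (bmnm k) (x - a)) =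
      c (bmnm k) * (monom (bmnm k) (y - a) - monom (bmnm k) (x - a) -
        dot (Gk (bmnm k) (x - a)) (y - x)).
    by move=> _; rewrite dotZr (dotC (y - x)) -!mulrBr.
  rewrite (eq_bigr _ E); apply: le_trans (ler_norm_sum _ _ _) _.
  rewrite -mulrA -[6 / _ * _]mulrA; apply: sumB => [|k].
    by rewrite !mulr_ge0 ?invr_ge0 ?exprn_ge0 ?(ltW s0).
  have [_ _ _ _] := HGk (bmnm k) _ _ xs ys.
  rewrite opprB addrA subrK => h; apply: le_trans h _.
  rewrite -!mulrA mulrA [leRHS]mulrA ler_wpM2r//.
    by rewrite !mulr_ge0 ?invr_ge0 ?exprn_ge0 ?(ltW s0).
  exact: d2le.
have [W [WU oW]] := ultraFilterLemma eventually_filter.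
have /choice[G HG] : forall x, exists l : 'rV[R]_M, `|x - a| <= s ->
    (fun N => GN N x) @ W --> l.
  move=> x; have [xs|_] := boolP (`|x - a| <= s); last by exists 0.
  have [|l Hl] := @ultra_cvg_rV R nat W WU M (fun N => GN N x) (B * (6 / s)).
    apply: filterE => N /=; apply: normrv_leP => [|i]; last exact: GNb.
    by rewrite mulr_ge0// divr_ge0// ltW.
  by exists l.
have HGi x i : `|x - a| <= s -> (fun N => GN N x 0 i) @ W --> G x 0 i.
  move=> xs; apply: (@cvg_comp _ _ _ (fun N => GN N x) (fun v => v 0 i) _ _ _ (HG _ xs)).
  exact: coord_continuous.
have Hf x : `|x - a| <= s -> (fun N => f N x) @ W --> g x.
  move=> xs N Nx; apply/oW; apply: H Nx; apply: le_trans xs _.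
  by rewrite ler_pdivrMr// ler_peMr ?(ltW t0)// ler1n.
have Ns : nbhs a [set x | `|x - a| <= s].
  by apply/nbhs_rVP; exists s => // y /ltW.
have K0 : 0 <= B * (6 / s ^+ 2) by rewrite mulr_ge0// divr_ge0// exprn_ge0// ltW.
exists G; split.
  exists [set x | `|x - a| <= s], (B * (6 / s ^+ 2)); split=> // x y xs ys.
  apply: (@ultra_cvg_le R nat W WU (fun N => `|f N y - f N x - dot (GN N x) (y - x)|)).
    apply: cvg_norm; apply: cvgB; first by apply: cvgB; exact: Hf.
    rewrite dotC; under [X in X @ _ --> _]funext do rewrite dotC.
    apply: (@cvg_comp _ _ _ (fun N => GN N x) (dot (y - x)) _ _ _ (HG _ xs)).
    exact: dot_continuous.
  by apply: filterE => N /=; exact: frem.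
move=> i; exists [set x | `|x - a| <= s], (B * (6 / s ^+ 2)); split=> // x y xs ys.
apply: (@ultra_cvg_le R nat W WU (fun N => `|GN N y 0 i - GN N x 0 i|)).
  by apply: cvg_norm; apply: cvgB; exact: HGi.
by apply: filterE => N /=; exact: GNlip.
Qed.

Lemma c11_ext (R : realType) M (phi : 'rV[R]_M -> R) G H a :
  c11 phi G a -> (\forall x \near a, G x = H x) -> c11 phi H a.
Proof.
move=> [[N [C [Na C0 Hp]]] HG] GH; split.
  exists (N `&` [set x | G x = H x]), C; split=> //; first exact: filterI.
  by move=> x y [Nx /= <-] [Ny _]; exact: Hp.
move=> i; have [N' [C' [Na' C0' H']]] := HG i.
exists (N' `&` [set x | G x = H x]), C'; split=> //; first exact: filterI.
by move=> x y [Nx /= <-] [Ny /= <-]; exact: H'.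
Qed.

Lemma c11_nbhs (R : realType) M (phi : 'rV[R]_M -> R) G a :
  c11 phi G a -> \forall x \near a, c11 phi G x.
Proof.
move=> [[N [C [Na C0 Hp]]] HG].
have /choice[F HF] : forall i, exists NC : set 'rV[R]_M * R,
    [/\ nbhs a NC.1, 0 <= NC.2 & forall x y, NC.1 x -> NC.1 y ->
      `|G y 0 i - G x 0 i| <= NC.2 * `|y - x|].
  by move=> i; have [N' [C' H']] := HG i; exists (N', C').
have FF : Filter (nbhs a) by exact: nbhs_filter.
have : nbhs a [set x | forall i, nbhs x (F i).1].
  apply: (@filter_forall _ _ (fun i x => nbhs x (F i).1) _ FF) => i.
  by case: (HF i) => /nbhs_interior.
move: Na => /[dup] Na /nbhs_interior; apply: filterS2 => x Nx Fx; split.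
  by exists N, C.
by move=> i; have [_ C0' H'] := HF i; exists (F i).1, (F i).2.
Qed.

(** The gradients found near different points agree by uniqueness. *)
Lemma analytic_c11 (R : realType) M (U : set 'rV[R]_M) (g : 'rV[R]_M -> R) :
  analytic_on U g -> open U -> exists G, forall a, U a -> c11 g G a.
Proof.
move=> ag Uo; have /choice[G HG] : forall a, exists G, U a -> c11 g G a.
  move=> a; have [Ua|nUa] := pselect (U a); last by exists (fun=> 0).
  by have [G HG] := analytic_c11_at ag Ua; exists G.
exists (fun x => G x x) => a Ua; apply: c11_ext (HG a Ua) _.
have : nbhs a U by exact: open_nbhs_nbhs.
by move: (c11_nbhs (HG _ Ua)); apply: filterS2 => x h /HG; exact: c11_grad_unique.
Qed.

(** * Zeros of real analytic functions *)

Section LineZeros.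
Context {R : realType} {M : nat} (g : 'rV[R]_M -> R) (ag : analytic_on setT g).
Context (y : 'rV[R]_M) (i : 'I_M).

Definition on_line (s : R) : 'rV[R]_M := \row_j (if j == i then s else y 0 j).

Lemma on_lineB s s0 : on_line s - on_line s0 = (s - s0) *: delta_mx 0 i.
Proof.
apply/rowP => j; rewrite !mxE /=; case: eqVneq => _; first by rewrite mulr1.
by rewrite subrr mulr0.
Qed.

(** The term of least degree dominates the power series of the restriction of
    [g] to the line, so that its zeros do not accumulate unless it vanishes. *)
Lemma zeros_isolated s0 :
  (exists2 d, 0 < d & forall s, `|s - s0| < d -> g (on_line s) = 0) \/
  (exists2 d, 0 < d & forall s, 0 < `|s - s0| < d -> g (on_line s) != 0).
Proof.
have [c [t [B [t0 B0 HB H]]]] := analytic_series ag (I : setT (on_line s0)).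
pose supp1 (k : multinom M) := [forall j, (j != i) ==> (k j == 0%N)].
have mon s (k : multinom M) : \prod_j (on_line s - on_line s0) 0 j ^+ k j =
    if supp1 k then (s - s0) ^+ mdeg k else 0.
  rewrite on_lineB; case: ifPn => [/forallP k1|k1].
    rewrite mdegE (bigD1 i)//= [in RHS](bigD1 i)//= !mxE !eqxx mulr1.
    rewrite !big1 ?addn0 ?mulr1// => j ji; have := k1 j; rewrite ji => /eqP->//.
  have [j ji kj] : exists2 j, j != i & k j != 0%N.
    apply: contrapT => N; move/negP: k1; apply; apply/forallP => j.
    by apply/implyP => ji; apply: contraT => kj; exfalso; apply: N; exists j.
  rewrite (bigD1 j)//= !mxE (negbTE ji) andbF mulr0 expr0n.
  by rewrite (negbTE kj) mul0r.
have dist s : `|s - s0| <= t -> `|on_line s - on_line s0| <= t.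
  move=> st; rewrite on_lineB; apply: normrv_leP => [|j]; first exact: ltW.
  rewrite !mxE eqxx normrM /= (le_trans _ st)// ler_piMr//.
  by case: (_ == _); rewrite ?normr1 ?normr0.
have [N0|N0] := pselect (forall k, supp1 k -> c k = 0).
  left; exists t => // s /ltW st.
  apply: (@cvg_unique _ (@norm_hausdorff _ R) _ _ _ _ (H _ (dist _ st))).
  rewrite (_ : (fun N => _) = fun=> 0); first exact: cvg_cst.
  apply/funext => N; apply: big1 => k _; rewrite mon.
  by case: ifPn => [/N0->|_]; rewrite ?mul0r ?mulr0.
right.
have [d dP dmin] : exists2 d, exists k, [/\ supp1 k, c k != 0 & mdeg k = d] &
    forall k, supp1 k -> c k != 0 -> (d <= mdeg k)%N.
  have ex : exists d, `[< exists k, [/\ supp1 k, c k != 0 & mdeg k = d] >].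
    apply: contrapT => E; apply: N0 => k k1; apply: contrapT => /eqP ck.
    by apply: E; exists (mdeg k); apply/asboolP; exists k.
  exists (ex_minn ex); case: ex_minnP => d /asboolP dP dm //.
  by move=> k k1 ck; apply: dm; apply/asboolP; exists k.
have [k0 [k01 ck0 k0d]] := dP.
have k0uniq k : supp1 k -> mdeg k = d -> k = k0.
  move=> /[dup] ks /forallP k1 kd; apply/mnmP => j.
  have P (k' : multinom M) : supp1 k' -> mdeg k' = k' i.
    move=> /forallP H'; rewrite mdegE (bigD1 i)//= big1 ?addn0// => l li.
    by apply/eqP; have := H' l; rewrite li.
  have [->|ji] := eqVneq j i; first by rewrite -(P k)// -(P k0)// kd k0d.
  by have := k1 j; have := forallP k01 j; rewrite ji => /eqP-> /eqP->.
pose K := B / t ^+ d.+1.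
have K0 : 0 <= K by rewrite divr_ge0// exprn_ge0// ltW.
have bound s : `|s - s0| <= t ->
    `|c k0 * (s - s0) ^+ d - g (on_line s)| <= K * `|s - s0| ^+ d.+1.
  move=> st; have cv := H _ (dist _ st).
  have cv' : `|c k0 * (s - s0) ^+ d - power_sum c (on_line s - on_line s0) N|
     @[N --> \oo] --> `|c k0 * (s - s0) ^+ d - g (on_line s)|.
    by apply: cvg_norm; apply: cvgB => //; exact: cvg_cst.
  apply: (@closed_cvg _ _ _ _ _ (fun x => x <= K * `|s - s0| ^+ d.+1)
    (@closed_le _ _) _ _ cv').
  exists d.+1 => // N /= dN; rewrite /power_sum.
  have k0N : (mdeg k0 < N)%N by rewrite k0d.
  rewrite (bigD1 (BMultinom k0N))//= mon k01 k0d opprD addNKr normrN.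
  apply: le_trans (ler_norm_sum _ _ _) _.
  apply: (@le_trans _ _ (\sum_(k : bmultinom M N)
     `|c (bmnm k)| * t ^+ mdeg (bmnm k) * (`|s - s0| / t) ^+ d.+1)); last first.
    rewrite -mulr_suml exprMn exprVn mulrA [K * _]mulrAC.
    by rewrite ler_wpM2r ?invr_ge0 ?exprn_ge0 ?(ltW t0)// ler_wpM2r ?exprn_ge0.
  rewrite big_mkcond /=; apply: ler_sum => k _.
  have q0 : 0 <= `|s - s0| / t by rewrite divr_ge0// ltW.
  have q1 : `|s - s0| / t <= 1 by rewrite ler_pdivrMr// mul1r.
  case: ifPn => [kk0|_]; last by rewrite !mulr_ge0 ?exprn_ge0 ?(ltW t0).
  rewrite mon; case: ifPn => [ks|_]; last first.
    by rewrite mulr0 normr0 !mulr_ge0 ?exprn_ge0 ?(ltW t0).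
  have [->|ck] := eqVneq (c (bmnm k)) 0; first by rewrite mul0r normr0 !mul0r.
  have dk : (d.+1 <= mdeg (bmnm k))%N.
    rewrite ltn_neqAle dmin// andbT; apply: contraNneq kk0 => dk.
    by apply/eqP/val_inj => /=; apply: k0uniq.
  rewrite normrM -mulrA ler_wpM2l// normrX.
  have -> : `|s - s0| ^+ mdeg (bmnm k) = t ^+ mdeg (bmnm k) * (`|s - s0| / t) ^+ mdeg (bmnm k).
    by rewrite -exprMn mulrCA divff ?mulr1// gt_eqF.
  by rewrite ler_wpM2l ?exprn_ge0 ?(ltW t0)// ler_wiXn2l.
pose e := Num.min t (`|c k0| / (K + 1)).
exists e; first by rewrite lt_min t0 divr_gt0 ?normr_gt0// ltr_wpDl.
move=> s /andP[s1]; rewrite lt_min => /andP[/ltW/bound bs].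
rewrite ltr_pdivlMr ?ltr_wpDl// => s2; apply/eqP => gs; move: bs.
rewrite gs subr0 normrM normrX exprSr mulrA mulrAC.
rewrite ler_pM2r ?exprn_gt0// => s3.
by have := normr_ge0 (s - s0); nra.
Qed.

(** The points near which [g] vanishes along the line form a closed and open
    set, which is not the whole line.  So all zeros are isolated, and each is the
    only one between two suitable rational numbers. *)
Lemma countable_line_zeros s1 : g (on_line s1) != 0 ->
  countable [set s | g (on_line s) = 0].
Proof.
move=> gs1; pose S := [set s0 | exists2 d, 0 < d &
  forall s, `|s - s0| < d -> g (on_line s) = 0].
have S0 : S = set0.
  apply: contrapT => /eqP/set0P Sn.
  have cR : connected (setT : set R) by apply/connected_intervalP.
  have ST : S = setT.
    apply: cR => //.
      exists S; last by rewrite setTI.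
      rewrite openE => s [d d0 Hd]; apply/nbhs_ballP; exists (d / 2) => /=.
        by rewrite divr_gt0.
      move=> s' /=; rewrite -ball_normE /ball_ /= => ss'.
      exists (d / 2); first by rewrite divr_gt0.
      move=> s2 ss2; apply: Hd.
      have := ler_normD (s2 - s') (s' - s); rewrite subrKA distrC (distrC s').
      by rewrite distrC; lra.
    exists S; last by rewrite setTI.
    move=> s cs; have [//|[d d0 Hd]] := zeros_isolated s.
    have [s' [[d' d'0 Hd'] ]] := cs _ (nbhsx_ballx s d d0).
    rewrite -ball_normE /ball_ /= distrC => ss'.
    exfalso; pose m := Num.min d' (d - `|s' - s|).
    have m0 : 0 < m by rewrite lt_min d'0 subr_gt0.
    have zero s2 : `|s2 - s'| < m -> g (on_line s2) = 0.
      by rewrite lt_min => /andP[/Hd'].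
    have nz s2 : `|s2 - s'| < m -> s2 = s.
      move=> /[dup] /zero z; rewrite lt_min => /andP[_ h].
      apply: contrapT => /eqP ne; have /eqP := z; apply/negP.
      apply: Hd; rewrite normr_gt0 subr_eq0 ne /=.
      by have := ler_normD (s2 - s') (s' - s); rewrite subrKA; lra.
    have e1 := nz s'; rewrite subrr normr0 in e1.
    have e2 := nz (s' + m / 2).
    rewrite addrC addKr gtr0_norm ?divr_gt0// ltr_pdivrMr// ltr_pMr// ltr1n in e2.
    by have := e1 m0; have := e2 isT; have := m0; lra.
  have [d d0 Hd] : S s1 by rewrite ST.
  by have := Hd s1; rewrite subrr normr0 d0 => /(_ isT)/eqP; rewrite (negbTE gs1).
pose T (pq : rat * rat) : set R :=
  [set s | [/\ ratr pq.1 < s, s < ratr pq.2 & g (on_line s) = 0]].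
pose psi pq := xget 0 (T pq).
apply: (@sub_countable _ _ _ (range psi)); last first.
  apply: sub_countable (card_image_le _ _) _; exact: countableP.
apply: subset_card_le => s gs.
have [Ss|[d d0 Hd]] := zeros_isolated s.
  by have : S s by []; rewrite S0.
have [p] := @rat_in_itvoo R (s - d) s ltac:(by rewrite ltrBlDr ltrDl).
have [q] := @rat_in_itvoo R s (s + d) ltac:(by rewrite ltrDl).
rewrite !in_itv /= => /andP[q1 q2] /andP[p1 p2].
exists (p, q) => //; rewrite /psi; apply: xget_unique => //.
move=> s' [/= ps' s'q gs']; apply: contrapT => /eqP ne.
have /eqP := gs'; apply/negP/Hd; rewrite normr_gt0 subr_eq0 ne /=.
by rewrite ltr_norml; apply/andP; split; lra.
Qed.

End LineZeros.

Lemma not_countable_real (R : realType) (A : set R) : countable A -> exists a, ~ A a.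
Proof.
move=> cA; apply: contrapT => N.
have AT : A = setT.
  by apply/seteqP; split=> // a _; apply: contrapT => Aa; apply: N; exists a.
have := countable_lebesgue_measure0 cA; rewrite AT.
have := @lebesgue_measure_itv R `]-oo, +oo[%R.
rewrite set_itvNyy /=.
by move=> ->.
Qed.

(** Along a line in general position none of the functions vanishes
    identically, and each then has countably many zeros only; the coordinates of
    a common nonzero point are found one after the other. *)
Lemma common_nonzero (R : realType) M (g : nat -> 'rV[R]_M -> R) :
  (forall k, analytic_on setT (g k)) -> (forall k, exists y, g k y != 0) ->
  exists x, forall k, g k x != 0.
Proof.
move=> ga gn0.
(* The first [i] coordinates of [x] extend, separately for each [k], to a point
   where [g k] does not vanish. *)
suff /(_ M (leqnn _))[x Hx] : forall i, (i <= M)%N -> exists x : 'rV[R]_M, forall k,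
    exists y : 'rV[R]_M, g k y != 0 /\ forall j : 'I_M, (j < i)%N -> y 0 j = x 0 j.
  exists x => k; have [y [gy yx]] := Hx k; rewrite (_ : x = y)//.
  by apply/rowP => j; rewrite yx.
elim=> [_|i IH iM].
  by exists 0 => k; have [y gy] := gn0 k; exists y.
have [x /choice[y Hy]] := IH (ltnW iM); pose i0 := Ordinal iM.
have [|s Hs] := @not_countable_real R
    (\bigcup_(k in setT) [set s | g k (on_line (y k) i0 s) = 0]).
  apply: bigcup_countable => [|k _]; first exact: countableP.
  apply: (@countable_line_zeros _ _ _ (ga k) _ _ (y k 0 i0)).
  rewrite (_ : on_line _ _ _ = y k); first by case: (Hy k).
  by apply/rowP => j; rewrite mxE; case: eqVneq => [->|].
exists (on_line x i0 s) => k; exists (on_line (y k) i0 s); split.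
  by apply/eqP => gs; apply: Hs; exists k.
move=> j; rewrite ltnS leq_eqVlt !mxE => /orP[/eqP ji|ji].
  by rewrite (_ : j == i0)//; apply/eqP/val_inj.
by case: eqVneq => // _; case: (Hy k) => _; apply.
Qed.

(** * Real coordinates of polynomial maps *)

Section RealCoordinates.
Local Open Scope complex_scope.

(** A real coordinate of K^n is the component [kcomp] of one of the coordinates
    in K, whose index is [kidx]. *)
Definition kidx (K : ground) (n : nat) : 'I_(kdim K n) -> 'I_n :=
  match K return 'I_(kdim K n) -> 'I_n with
  | RealGround => id
  | ComplexGround => fun i : 'I_(n + n) =>
      match fintype.split i with inl j => j | inr j => j end
  end.

Definition kcomp (R : realType) (K : ground) (n : nat) :
    'I_(kdim K n) -> gfield R K -> R :=
  match K return 'I_(kdim K n) -> gfield R K -> R with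
  | RealGround => fun _ z => z
  | ComplexGround => fun (i : 'I_(n + n)) z =>
      match fintype.split i with inl _ => complex.Re (z : R[i]) | inr _ => complex.Im (z : R[i]) end
  end.

Definition kunit (R : realType) (K : ground) : 'I_(kdim K 1) -> gfield R K :=
  match K return 'I_(kdim K 1) -> gfield R K with
  | RealGround => fun _ => 1
  | ComplexGround => fun q : 'I_(1 + 1) =>
      match fintype.split q with inl _ => 1 | inr _ => 'i%C end
  end.

Lemma realifyE (R : realType) K n (z : 'I_n -> gfield R K) i :
  realify z 0 i = kcomp i (z (kidx i)).
Proof.
case: K z i => [z i|z i]; first by rewrite mxE.
rewrite /realify /kcomp /kidx mxE.
by case: (fintype.split _) => j; rewrite mxE.
Qed.

Lemma kcompD (R : realType) K n (i : 'I_(kdim K n)) (z w : gfield R K) :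
  kcomp i (z + w) = kcomp i z + kcomp i w.
Proof. by case: K i z w => // i [a b] [c d] /=; case: (fintype.split _). Qed.

Lemma kcomp0 (R : realType) K n (i : 'I_(kdim K n)) : kcomp i (0 : gfield R K) = 0.
Proof. by case: K i => // i /=; case: (fintype.split _). Qed.

Lemma kcomp_sum (R : realType) K n (i : 'I_(kdim K n)) I (r : seq I) (Q : pred I)
    (F : I -> gfield R K) :
  kcomp i (\sum_(k <- r | Q k) F k) = \sum_(k <- r | Q k) kcomp i (F k).
Proof. by elim/big_rec2: _ => [|k y z _ <-]; rewrite ?kcomp0 ?kcompD. Qed.

Lemma kcompM (R : realType) K n (i : 'I_(kdim K n)) (z w : gfield R K) :
  kcomp i (z * w) = \sum_q kcomp q z * kcomp i (kunit R q * w).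
Proof.
case: K i z w => [i z w|i [a b] [c d]]; first by rewrite big_ord1 /= mul1r.
rewrite /= (@big_ord_recl _ _ _ 1) big_ord1.
have -> : fintype.split (ord0 : 'I_(1 + 1)) = inl ord0.
  by rewrite -(unsplitK (inl ord0)); congr fintype.split; exact: val_inj.
have -> : fintype.split (lift ord0 ord0 : 'I_(1 + 1)) = inr ord0.
  by rewrite -(unsplitK (inr ord0)); congr fintype.split; exact: val_inj.
by case: (fintype.split i) => _ /=; ring.
Qed.

Lemma kcomp_eq0 (R : realType) K (z : gfield R K) :
  (forall q : 'I_(kdim K 1), kcomp q z = 0) -> z = 0.
Proof.
case: K z => [z /(_ ord0)//|[a b] /= H].
have := H (lshift 1 ord0); have := H (rshift 1 ord0).
by rewrite (unsplitK (inl _)) (unsplitK (inr _)) /= => -> ->.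
Qed.

Definition kscale (R : realType) (K : ground) (s : R) : gfield R K :=
  match K return gfield R K with
  | RealGround => s
  | ComplexGround => s%:C
  end.

Lemma kcompZ (R : realType) K n (i : 'I_(kdim K n)) (s : R) (z : gfield R K) :
  kcomp i (kscale K s * z) = s * kcomp i z.
Proof.
case: K i z => // i [a b] /=; case: (fintype.split _) => _ /=; ring.
Qed.

Lemma kscaleM (R : realType) K (s t : R) : kscale K (s * t) = kscale K s * kscale K t.
Proof. by case: K => //=; rewrite rmorphM. Qed.

Lemma kscale1 (R : realType) K : kscale K (1 : R) = 1.
Proof. by case: K. Qed.

Definition kmonom (R : realType) K n (m : multinom (kdim K n)) (x : kspace R K n) :
    gfield R K :=
  \prod_i var_values x i ^+ m i.

(** The real functions of which polynomial maps are linear combinations over R,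
    the coefficients being the real components of the coefficients in K; see
    [eval_mapE].  For K = C each monomial gives two such functions, one for each
    real unit [kunit]. *)
Definition mu (R : realType) K n p (i : 'I_(kdim K p)) (m : multinom (kdim K n))
    (q : 'I_(kdim K 1)) (x : kspace R K n) : R :=
  kcomp i (kunit R q * kmonom m x).

Lemma peval_bound (R : realType) K n (g : kpoly R K n) N (x : kspace R K n) :
  (forall m, mcoeff m g != 0 -> (mdeg m < N)%N) ->
  peval g x = \sum_(m : bmultinom (kdim K n) N) mcoeff (bmnm m) g * kmonom (bmnm m) x.
Proof.
move=> gN; have gs : (msize g <= N)%N.
  by rewrite msizeE; apply/bigmax_leqP_seq => m; rewrite mcoeff_msupp => /gN.
rewrite /peval {1}(mpolywE gs) rmorph_sum /=; apply: eq_bigr => m _.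
by rewrite mevalZ mevalX.
Qed.

Lemma eval_mapE (R : realType) K n p (g : kmap R K n p) N (x : kspace R K n) i :
  (forall j m, mcoeff m (g j) != 0 -> (mdeg m < N)%N) ->
  eval_map g x 0 i = \sum_(m : bmultinom (kdim K n) N) \sum_q
    kcomp q (mcoeff (bmnm m) (g (kidx i))) * mu i (bmnm m) q x.
Proof.
move=> gN; rewrite /eval_map realifyE (peval_bound _ (gN _)) kcomp_sum.
by apply: eq_bigr => m _; rewrite kcompM.
Qed.

(** Real and imaginary parts of monomials are sums of products of coordinates. *)
Lemma mu_c11 (R : realType) K n p (i : 'I_(kdim K p)) m q :
  exists G, forall x : kspace R K n, c11 (mu i m q) G x.
Proof.
have lin (a b : R) (l1 l2 : 'I_(kdim K n)) : exists G, forall x : kspace R K n,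
    c11 (fun x => a * x 0 l1 + b * x 0 l2) G x.
  have cc (l' : 'I_(kdim K n)) (x : kspace R K n) :
      c11 (fun x => x 0 l') (fun=> delta_mx 0 l') x.
    have := c11_dot (delta_mx 0 l') x; congr (c11 _ _ _).
    by apply/funext => y; rewrite dotC dot_deltar.
  by eexists => x; apply: c11D; (apply: c11M; [exact: c11_cst | exact: cc]).
have var p' (k : 'I_(kdim K p')) (l : 'I_(kdim K n)) (c : gfield R K) : exists G,
    forall x : kspace R K n, c11 (fun x => kcomp k (c * var_values x l)) G x.
  case: K k l c {m q i} lin => [k l c lin|k l [a b] lin].
    have [G HG] := lin c 0 l l; exists G => x; have := HG x.
    by congr (c11 _ _ _); apply/funext => y /=; rewrite mul0r addr0.
  have [j jl] : exists j : 'I_n, l = lshift n j \/ l = rshift n j.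
    have := splitK l; case: (fintype.split l) => j <-; exists j; by [left|right].
  have [e He] : exists e : R, forall x : kspace R ComplexGround n,
      var_values x l = (x 0 (lshift n j)) +i* (e * x 0 (rshift n j)).
    rewrite /var_values /coordinate; case: jl => ->.
      by exists 1 => x; rewrite (unsplitK (inl _)) mul1r !mxE.
    by exists (-1) => x; rewrite (unsplitK (inr _)) mulN1r !mxE.
  rewrite /kcomp; case: (fintype.split k) => _.
    have [G HG] := lin a (- (b * e)) (lshift n j) (rshift n j).
    exists G => x; have := HG x; congr (c11 _ _ _); apply/funext => y.
    by rewrite He /=; ring.
  have [G HG] := lin b (a * e) (lshift n j) (rshift n j).
  exists G => x; have := HG x; congr (c11 _ _ _); apply/funext => y.
  by rewrite He /=; ring.
suff H p' (z : gfield R K) (k : 'I_(kdim K p')) :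
    exists G, forall x : kspace R K n, c11 (fun x => kcomp k (z * kmonom m x)) G x.
  exact: H.
elim/multinom_ind: m p' k => [|m l IH] p' k.
  exists (fun=> 0) => x; have := c11_cst (kcomp k z) x; congr (c11 _ _ _).
  apply/funext => y; rewrite /kmonom big1 ?mulr1// => j _.
  by rewrite mnm0E.
have kmonomS (x : kspace R K n) :
    kmonom (mnm_add m (mnm1 l)) x = kmonom m x * var_values x l.
  rewrite /kmonom (bigD1 l)//= [in RHS](bigD1 l)//= mnmDE mnm1E eqxx addn1 exprSr.
  rewrite mulrAC; congr (_ * _ * _); apply: eq_bigr => j ji.
  by rewrite mnmDE mnm1E eq_sym (negbTE ji) addn0.
have /choice[G1 HG1] := IH 1%N.
have /choice[G2 HG2] : forall q' : 'I_(kdim K 1), exists G, forall x : kspace R K n,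
    c11 (fun x => kcomp k (kunit R q' * var_values x l)) G x.
  by move=> q'; exact: var.
eexists => x; have := c11_sum (index_enum _) xpredT (fun q' => c11M (HG1 q' x) (HG2 q' x)).
rewrite (_ : (fun x => _) = (fun x => kcomp k (z * kmonom (mnm_add m (mnm1 l)) x))).
  exact.
by apply/funext => y; rewrite kmonomS mulrA kcompM.
Qed.

(** Scaling the coordinates in K^n by positive factors multiplies a monomial by
    the corresponding power. *)
Definition kdilate (R : realType) K n (s : 'rV[R]_n) : 'M[R]_(kdim K n) :=
  diag_mx (\row_i s 0 (kidx i)).

Lemma kdilateE (R : realType) K n (s : 'rV[R]_n) (x : kspace R K n) i :
  (x *m kdilate K s) 0 i = s 0 (kidx i) * x 0 i.
Proof. by rewrite /kdilate mul_mx_diag !mxE mulrC. Qed.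

Lemma var_values_dilate (R : realType) K n (s : 'rV[R]_n) (x : kspace R K n) i :
  var_values (x *m kdilate K s) i = kscale K (s 0 (kidx i)) * var_values x i.
Proof.
case: K x i => [x i|x i]; first exact: (kdilateE (K := RealGround)).
rewrite /var_values /=.
have idxl j : kidx (K := ComplexGround) (n := n) (lshift n j) = j.
  by rewrite /kidx (unsplitK (inl _)).
have idxr j : kidx (K := ComplexGround) (n := n) (rshift n j) = j.
  by rewrite /kidx (unsplitK (inr _)).
have D l : (x *m kdilate ComplexGround s) 0 l = s 0 (kidx l) * x 0 l := kdilateE s x l.
have Dl j : (x *m kdilate ComplexGround s) 0 (lshift n j) = s 0 j * x 0 (lshift n j).
  by rewrite -{2}(idxl j); exact: D.
have Dr j : (x *m kdilate ComplexGround s) 0 (rshift n j) = s 0 j * x 0 (rshift n j).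
  by rewrite -{2}(idxr j); exact: D.
have El j (y : 'rV[R]_(n + n)) : lsubmx y 0 j = y 0 (lshift n j) by rewrite mxE.
have Er j (y : 'rV[R]_(n + n)) : rsubmx y 0 j = y 0 (rshift n j) by rewrite mxE.
case: (fintype.split i) => j; rewrite !El !Er Dl Dr.
  by apply/eqP; rewrite eq_complex /=; apply/andP; split; apply/eqP; ring.
by apply/eqP; rewrite eq_complex /=; apply/andP; split; apply/eqP; ring.
Qed.

Lemma kmonom_dilate (R : realType) K n (w : 'rV[R]_n) (m : multinom (kdim K n))
    (x : kspace R K n) :
  kmonom m (x *m kdilate K (\row_l expR (w 0 l))) =
  kscale K (expR (dot w (exponent R m))) * kmonom m x.
Proof.
have -> : dot w (exponent R m) = \sum_i w 0 (kidx i) * (m i)%:R.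
  case: K m x => [m x|m x]; rewrite /dot.
    by apply: eq_bigr => i _; rewrite mxE.
  rewrite big_split_ord /= -big_split /=; apply: eq_bigr => i _.
  by rewrite (unsplitK (inl _)) (unsplitK (inr _)) mxE natrD mulrDr.
rewrite expR_sum /kmonom.
rewrite (big_morph (kscale K) (@kscaleM R K) (kscale1 R K)).
rewrite -big_split /=; apply: eq_bigr => i _.
rewrite var_values_dilate mxE exprMn expRM_natr; congr (_ * _).
elim: (m i) => [|d IH]; first by rewrite !expr0 kscale1.
by rewrite !exprS IH kscaleM.
Qed.

End RealCoordinates.

Lemma kcompCA (R : realType) K n (i : 'I_(kdim K n)) (s : R) (u z : gfield R K) :
  kcomp i (u * (kscale K s * z)) = s * kcomp i (u * z).
Proof. by rewrite mulrCA kcompZ. Qed.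

Lemma mu_dilate (R : realType) K n p (i : 'I_(kdim K p)) m q (w : 'rV[R]_n)
    (x : kspace R K n) :
  mu i m q (x *m kdilate K (\row_l expR (w 0 l))) =
  expR (dot w (exponent R m)) * mu i m q x.
Proof. by rewrite /mu kmonom_dilate kcompCA. Qed.

Definition grad_mu (R : realType) K n p (i : 'I_(kdim K p)) (m : multinom (kdim K n)) q :
    kspace R K n -> kspace R K n :=
  sval (cid (@mu_c11 R K n p i m q)).

Lemma grad_muP (R : realType) K n p (i : 'I_(kdim K p)) m q (x : kspace R K n) :
  c11 (mu i m q) (grad_mu i m q) x.
Proof. exact: svalP (cid (@mu_c11 R K n p i m q)) x. Qed.

(** Gradients are unique, so that the scaling law of [mu] can be differentiated. *)
Lemma grad_mu_dilate (R : realType) K n p (i : 'I_(kdim K p)) m q (w : 'rV[R]_n)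
    (x : kspace R K n) :
  grad_mu i m q (x *m kdilate K (\row_l expR (w 0 l))) *m kdilate K (\row_l expR (w 0 l)) =
  expR (dot w (exponent R m)) *: grad_mu i m q x.
Proof.
set S := kdilate K _; set s := expR _.
have H1 : c11 (fun x => mu i m q (x *m S)) (fun x => grad_mu i m q (x *m S) *m S^T) x.
  by apply: c11_comp_lin; exact: grad_muP.
have H2 := c11M (c11_cst s x) (grad_muP i m q x).
rewrite (_ : (fun x => s * mu i m q x) = fun x => mu i m q (x *m S)) in H2; last first.
  by apply/funext => y; rewrite mu_dilate.
have := c11_grad_unique H1 H2; rewrite /S tr_diag_mx => ->.
by rewrite scaler0 addr0.
Qed.

Lemma mcoeff_restrict (R : realType) K n (A : set 'rV[R]_n) (g : kpoly R K n) m :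
  mcoeff m (restrict_poly A g) = if `[< A (exponent R m) >] then mcoeff m g else 0.
Proof.
rewrite /restrict_poly raddf_sum /=.
under eq_bigr do rewrite mcoeffZ mcoeffX.
have [mg|mg] := boolP (m \in msupp g); last first.
  rewrite big1_seq => [|m' /andP[_ m'g]].
    by move: mg; rewrite -mcoeff_eq0 => /eqP ->; rewrite if_same.
  case: eqVneq => [mm|_]; last by rewrite mulr0.
  by rewrite mm (negbTE mg) in m'g.
case: asboolP => Am.
  rewrite (big_rem m)//= asboolT// eqxx mulr1 big1_seq ?addr0// => m' /andP[_].
  rewrite mem_rem_uniq ?msupp_uniq// inE => /andP[m'm _].
  by rewrite (negbTE m'm) mulr0.
rewrite big1// => m' /asboolP Am'; case: eqVneq => [mm|_]; last by rewrite mulr0.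
by exfalso; apply: Am; rewrite -mm.
Qed.

(** The real Jacobian in the space variables is linear in the real coefficients
    [c] of the components. *)
Definition grad_map (R : realType) K n p N
    (c : 'I_p -> bmultinom (kdim K n) N -> 'I_(kdim K 1) -> R)
    (i : 'I_(kdim K p)) (x : kspace R K n) : kspace R K n :=
  \sum_m \sum_q c (kidx i) m q *: grad_mu i (bmnm m) q x.

Definition jac_map (R : realType) K n p N
    (c : 'I_p -> bmultinom (kdim K n) N -> 'I_(kdim K 1) -> R)
    (x : kspace R K n) : 'M[R]_(kdim K n, kdim K p) :=
  \matrix_(l, i) grad_map c i x 0 l.

Definition coeffs (R : realType) K n p N (g : kmap R K n p) (j : 'I_p)
    (m : bmultinom (kdim K n) N) (q : 'I_(kdim K 1)) : R :=
  kcomp q (mcoeff (bmnm m) (g j)).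
Arguments coeffs {R K n p} N g j m q.

Definition degree_lt (R : realType) K n p N (g : kmap R K n p) :=
  forall j m, mcoeff m (g j) != 0 -> (mdeg m < N)%N.

Lemma eval_map_c11 (R : realType) K n p N (g : kmap R K n p) i (x : kspace R K n) :
  degree_lt N g ->
  c11 (fun x => eval_map g x 0 i) (grad_map (coeffs N g) i) x.
Proof.
move=> gN; rewrite (_ : (fun x => _) = fun x => \sum_(m : bmultinom (kdim K n) N) \sum_q
    coeffs N g (kidx i) m q * mu i (bmnm m) q x); last first.
  by apply/funext => y; rewrite (eval_mapE _ _ gN).
apply: c11_sum => m; apply: c11_sum => q.
have := c11M (c11_cst (coeffs N g (kidx i) m q) x) (grad_muP i (bmnm m) q x).
by congr (c11 _ _ _); apply/funext => y; rewrite scaler0 addr0.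
Qed.

Lemma jacobian_eval_map (R : realType) K n p N (g : kmap R K n p) (x : kspace R K n) :
  degree_lt N g -> jacobian (eval_map g) x = jac_map (coeffs N g) x.
Proof.
by move=> gN; apply: c11_jacobian => i; exact: eval_map_c11.
Qed.

Lemma coordinate_neq0 (R : realType) K n (x : kspace R K n) l :
  (coordinate x l != 0) <-> exists2 i, kidx i = l & x 0 i != 0.
Proof.
case: K x => x /=; first by split=> [xl|[i <-//]]; exists l.
rewrite eq_complex /= negb_and !mxE; split.
  move=> /orP[xl|xl]; [exists (lshift n l)|exists (rshift n l)] => //.
    by rewrite /kidx (unsplitK (inl _)).
  by rewrite /kidx (unsplitK (inr _)).
move=> [i <-]; have := splitK i; rewrite /kidx.
by case: (fintype.split i) => j /= <- ->; rewrite ?orbT.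
Qed.

(** Infinitely many nonzero analytic coefficients would all be nonzero at some
    parameter value, where the map would not be polynomial. *)
Lemma deformation_degree (R : realType) K n p (f : kmap R K n p) (F : kfamily R K n p) :
  is_deformation f F -> exists N, forall e, degree_lt N (F e).
Proof.
move=> [_ _ Fan].
pose cf (j : 'I_p) m (q : 'I_(kdim K 1)) (e : kspace R K 1) := kcomp q (mcoeff m (F e j)).
have cfan j m q : analytic_on setT (cf j m q).
  have := Fan j m q; congr (analytic_on _ _); apply/funext => e.
  by rewrite realifyE.
have bd j (q : 'I_(kdim K 1)) : exists N, forall m e, cf j m q e != 0 -> (mdeg m < N)%N.
  apply: contrapT => H.
  have /choice[ms Hms] : forall N, exists m, (N <= mdeg m)%N /\ exists e, cf j m q e != 0.
    move=> N; apply: contrapT => H'; apply: H; exists N => m e ce.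
    by rewrite ltnNge; apply/negP => Nm; apply: H'; exists m; split=> //; exists e.
  have [||e He] := @common_nonzero R _ (fun N => cf j (ms N) q).
  - by move=> k; exact: cfan.
  - by move=> k; case: (Hms k).
  have := He (msize (F e j)); apply/negP; rewrite negbK /cf.
  have := msize_mdeg_ge (proj1 (Hms (msize (F e j)))).
  by rewrite -mcoeff_eq0 => /eqP ->; rewrite kcomp0.
have /choice[Nf HNf] : forall jq : 'I_p * 'I_(kdim K 1),
    exists N, forall m e, cf jq.1 m jq.2 e != 0 -> (mdeg m < N)%N.
  by move=> [j q]; exact: bd.
exists (\max_jq Nf jq)%N => e j m mF.
have [q cq] : exists q, cf j m q e != 0.
  apply: contrapT => H; move/eqP: mF; apply; apply: kcomp_eq0 => q.
  by apply: contrapT => /eqP cq; apply: H; exists q.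
by apply: leq_trans (HNf (j, q) _ _ cq) _; exact: leq_bigmax.
Qed.

(** * Critical points near the origin *)

(** The weight that vanishes on one axis only has minimum 0 on the region, and it
    is attained at a point of that axis. *)
Lemma vertex_on_axis (R : realType) n (J : seq 'rV[rat]_n) (V : seq 'rV[R]_n) i :
  J <> [::] -> positive_forms J -> V <> [::] ->
  (forall v, v \in V -> upper R n J v) ->
  (forall w c, orthant w -> (forall v, v \in V -> c <= dot w v) ->
     forall nu, upper R n J nu -> c <= dot w nu) ->
  exists2 v, v \in V & 0 < v 0 i /\ forall k, k != i -> v 0 k = 0.
Proof.
move=> J0 Jp V0 VJ Vmin.
pose w : 'rV[R]_n := \row_k (k != i)%:R.
have w0 : orthant w by move=> k; rewrite mxE ler0n.
have [v vV vm] := exists_argmin (dot w) V0.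
have [c c0 cJ] := @upper_axis R n J i Jp.
have := Vmin w (dot w v) w0 vm _ cJ.
rewrite dotZr dot_deltar mxE eqxx mulr0 => wv0.
have [vo _] := VJ _ vV.
have wv : dot w v = 0 by apply/eqP; rewrite eq_le wv0 dot_ge0.
have vk k : k != i -> v 0 k = 0.
  move=> ki; have ge0 l : true -> 0 <= w 0 l * v 0 l by rewrite mulr_ge0.
  have := psumr_eq0P ge0 wv (i := k) isT.
  by rewrite mxE ki mul1r.
exists v => //; split=> //; rewrite lt_neqAle vo andbT eq_sym.
have := upper_neq0 J0 (VJ _ vV); apply: contraNneq => vi.
apply/eqP/rowP => k; rewrite mxE; have [->//|ki] := eqVneq k i; exact: vk.
Qed.

(** An adapted weight for the vertices of the sum of the polyhedra: a sum of
    vertices is minimal exactly when all its summands are. *)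
Lemma newton_weights (R : realType) n p (Js : 'I_p -> seq 'rV[rat]_n) :
  (0 < n)%N -> (0 < p)%N -> (forall j, Js j <> [::]) ->
  (forall j, positive_forms (Js j)) ->
  exists (V : 'I_p -> seq 'rV[R]_n) (S : finType) (sel : S -> 'I_p -> 'rV[R]_n),
  [/\ forall j, V j <> [::] /\ forall v, v \in V j -> upper R n (Js j) v,
      forall j w c, orthant w -> (forall v, v \in V j -> c <= dot w v) ->
        forall nu, upper R n (Js j) nu -> c <= dot w nu,
      (forall s j, sel s j \in V j) /\ (forall j v, v \in V j -> exists s, sel s j = v) &
      exists2 kap : R, 0 < kap & forall (I : {set 'I_n}) (u : 'rV[R]_n),
        I != finset.set0 -> (forall i, i \in I -> 0 < u 0 i) ->
        exists w : 'rV[R]_n,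
        [/\ (forall i, 0 < w 0 i) /\ (forall i, i \in I -> w 0 i <= u 0 i),
            exists s, (forall j v, v \in V j -> dot w (sel s j) <= dot w v) /\
              forall i, (\sum_j sel s j) 0 i != 0 -> i \in I /\ w 0 i = u 0 i,
            forall i, exists s, (forall j v, v \in V j -> dot w (sel s j) <= dot w v) /\
              0 < (\sum_j sel s j) 0 i &
            forall c, 0 <= c -> (forall i, i \in I -> c <= u 0 i) ->
              forall i, kap * c <= w 0 i]].
Proof.
move=> n0 p0 J0 Jp.
have /choice[V HV] : forall j, exists V : seq 'rV[R]_n,
    [/\ V <> [::], forall v, v \in V -> upper R n (Js j) v &
        forall w c, orthant w -> (forall v, v \in V -> c <= dot w v) ->
          forall nu, upper R n (Js j) nu -> c <= dot w nu].
  by move=> j; exact: upper_vertices.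
have V0 j : V j <> [::] by case: (HV j).
have VJ j v : v \in V j -> upper R n (Js j) v by case: (HV j) => _ + _; apply.
have [S [sel [selV selE]]] := selections V0.
exists V, S, sel; split=> //; first by move=> j; case: (HV j).
  by move=> j; case: (HV j).
  split=> // j v vV; have /choice[v0 v0V] : forall j, exists x, x \in V j.
    by move=> k; case: (V k) (V0 k) => // x s _; exists x; rewrite inE eqxx.
  have [k|s Hs] := selE (fun k => if k == j then v else v0 k).
    by case: eqVneq => [->|].
  by exists s; rewrite Hs eqxx.
pose VQ := [seq \sum_j sel s j | s <- enum S].
have VQP s : \sum_j sel s j \in VQ by rewrite map_f ?mem_enum.
have selo s j : orthant (sel s j) by case: (VJ _ _ (selV s j)).
have VQo v : v \in VQ -> orthant v.
  by move=> /mapP[s _ ->] i; rewrite summxE sumr_ge0// => j _; exact: selo.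
have j0 := Ordinal p0.
have VQn v : v \in VQ -> v != 0.
  move=> /mapP[s _ ->]; have := upper_neq0 (J0 j0) (VJ _ _ (selV s j0)).
  apply: contraNneq => /rowP E; apply/eqP/rowP => i; have := E i.
  rewrite summxE !mxE => /psumr_eq0P -> // j _; exact: selo.
have VQax i : exists2 v, v \in VQ & 0 < v 0 i /\ forall k, k != i -> v 0 k = 0.
  have /choice[a Ha] : forall j, exists v : 'rV[R]_n,
      [/\ v \in V j, 0 < v 0 i & forall k, k != i -> v 0 k = 0].
    move=> j; have [_ VJj Vm] := HV j.
    by have [v ? [? ?]] := vertex_on_axis i (J0 j) (Jp j) (V0 j) VJj Vm; exists v.
  have [s sa] : exists s, sel s =1 a by apply: selE => j; case: (Ha j).
  exists (\sum_j sel s j) => //; split=> [|k ki]; rewrite summxE.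
    rewrite (bigD1 j0)//= sa ltr_pwDl//; first by case: (Ha j0).
    by apply: sumr_ge0 => j _; exact: selo.
  by apply: big1 => j _; rewrite sa; case: (Ha j) => _ _; apply.
have [kap kap0 H] := adapted_weight VQo VQn VQax.
exists kap => // I u I0 uI; have [w [d [wu wd [v vVQ [vd vI]] wt wc]]] := H I u I0 uI.
have tight s : dot w (\sum_j sel s j) = d ->
    forall j v, v \in V j -> dot w (sel s j) <= dot w v.
  move=> sd j v' v'V.
  have [s' Hs'] : exists s', sel s' =1 (fun k => if k == j then v' else sel s k).
    by apply: selE => k; case: eqVneq => [->|_].
  have := wd _ (VQP s'); rewrite -sd !dot_sumr (bigD1 j)//= [leRHS](bigD1 j)//=.
  rewrite Hs' eqxx [X in _ <= _ + X](eq_bigr (fun k => dot w (sel s k))).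
    by rewrite lerD2r.
  by move=> k kj; rewrite Hs' (negbTE kj).
exists w; split=> //.
  by move: vVQ vd vI => /mapP[s _ ->] sd sI; exists s; split=> //; exact: tight.
move=> i; have [v' /mapP[s _ ->] [sd si]] := wt i.
by exists s; split=> //; exact: tight.
Qed.

(** The minimizers of the sum form a face of the sum diagram, which decomposes
    into the minimizers of the summands; the last two conditions on the
    minimizers say that it is inner and that it meets the coordinate subspace. *)
Lemma SIKND_regular (R : realType) K n p (D : 'I_p -> set 'rV[R]_n) P
    (f : kmap R K n p) (Js : 'I_p -> seq 'rV[rat]_n) (w : 'rV[R]_n)
    (a : 'I_p -> 'rV[R]_n) (I : {set 'I_n}) :
  (0 < n)%N -> (0 < p)%N -> SIKND D P f -> (forall j, presents (Js j) (D j)) ->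
  (forall i, 0 < w 0 i) ->
  (forall j, minimizers (Js j) w (a j)) ->
  I != finset.set0 ->
  (forall i, exists b, (forall j, minimizers (Js j) w (b j)) /\
     0 < (\sum_j b j) 0 i) ->
  (exists b, (forall j, minimizers (Js j) w (b j)) /\
     forall i, (\sum_j b j) 0 i != 0 -> i \in I) ->
  forall x, torus I x ->
    ~ singular_locus (restrict_map (fun j => minimizers (Js j) w) f) x.
Proof.
move=> n0 p0 [_ Hf] JsD w0 ma I0 Hinner [b [mb bI]] x xI sx.
have Js0 j : Js j <> [::] by case: (JsD j).
have Jsp j : positive_forms (Js j) by case: (JsD j).
have [J [[J0 Jp JD] JE]] := diagram_sum_presents n0 p0 JsD.
have PhiE : minimizers J w = minkowski_sum (fun j => minimizers (Js j) w).
  apply/seteqP; split=> nu.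
    move=> [/JE[nus [Hnus nuE]] numin]; exists nus => //= j; split=> // mu muJ.
    have : upper R n J (\sum_k (if k == j then mu else nus k)).
      apply/JE; eexists; split; last by [].
      by move=> k /=; case: eqVneq => [->|_].
    move=> /numin; rewrite nuE !dot_sumr (bigD1 j)//= [leRHS](bigD1 j)//= eqxx.
    rewrite [X in _ <= _ + X](eq_bigr (fun k => dot w (nus k))).
      by rewrite lerD2r.
    by move=> k /negbTE ->.
  move=> [nus Hnus <-]; split.
    by apply/JE; exists nus; split=> // j; case: (Hnus j).
  move=> mu /JE[mus [Hmus ->]]; rewrite !dot_sumr; apply: ler_sum => j _.
  by have [_] := Hnus j; apply.
have Phisum c : (forall j, minimizers (Js j) w (c j)) -> minimizers J w (\sum_j c j).
  by move=> Hc; rewrite PhiE; exists c.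
have := Hf (minimizers J w) (fun j => minimizers (Js j) w).
case/(_ _ _ _ PhiE I I0 _)/seteqP => [|I' I'T H|j||+ _].
- by rewrite JD; exact: minimizers_face.
- have [i iI'] : exists i, i \notin I'.
    apply: contrapT => N; move/eqP: I'T; apply; apply/setP => i; rewrite inE.
    by apply: contraT => iI; exfalso; apply: N; exists i.
  have [c [mc ci]] := Hinner i.
  by have := H _ (Phisum _ mc) i iI' => ci0; rewrite ci0 ltxx in ci.
- by case: (JsD j) => ? ? ->; exact: minimizers_face.
- exists (\sum_j b j); split; first exact: Phisum.
  by move=> i iI; apply: contraNeq iI => /bI.
by move=> /(_ x); apply; split.
Qed.

(** Over the reals [A^T *m A] annihilates only the vectors annihilated by [A].
    This turns the rank condition into one that passes to limits. *)
Lemma gram_det (R : realType) M P (A : 'M[R]_(M, P)) :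
  (\det (A^T *m A) == 0) = (\rank A < P)%N.
Proof.
have fr : (\rank A < P)%N = ~~ row_free A^T.
  by rewrite /row_free mxrank_tr ltn_neqAle rank_leq_col andbT.
rewrite fr; apply/idP/idP => [/det0P[v v0 vA]|].
  have vA0 : v *m A^T = 0.
    have : dot (v *m A^T) (v *m A^T) = 0.
      by rewrite dot_mulmx trmx_mul trmxK mulmxA -(mulmxA v) vA mul0mx mxE.
    move=> d0; apply/rowP => i; rewrite [RHS]mxE.
    have ge0 k : true -> 0 <= (v *m A^T) 0 k * (v *m A^T) 0 k by rewrite -expr2 sqr_ge0.
    by have /eqP := psumr_eq0P ge0 d0 (i := i) isT; rewrite mulf_eq0 orbb => /eqP.
  apply/negP => /row_freeP[B AB]; move/eqP: v0; apply.
  by rewrite -(mulmx1 v) -AB mulmxA vA0 mul0mx.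
rewrite -kermx_eq0 => /rowV0Pn[v /sub_kermxP vA v0].
by apply/det0P; exists v => //; rewrite mulmxA vA mul0mx.
Qed.

Lemma cvg_det (R : realType) (T : Type) (W : set_system T) {WF : Filter W} k
    (A : T -> 'M[R]_k) (L : 'M[R]_k) :
  (forall i j, (fun t => A t i j) @ W --> L i j) -> (fun t => \det (A t)) @ W --> \det L.
Proof.
move=> H; rewrite /determinant.
apply: (@cvg_big R _ +%R 0 xpredT) => [|s _]; first exact: add_continuous.
apply: cvgM; first exact: cvg_cst.
apply: (@cvg_big R _ *%R 1 xpredT) => [|i _]; last exact: H.
exact: mul_continuous.
Qed.

Lemma cvg_mulmx (R : realType) (T : Type) (W : set_system T) {WF : Filter W} k l m
    (A : T -> 'M[R]_(k, l)) (B : T -> 'M[R]_(l, m)) (A' : 'M[R]_(k, l)) (B' : 'M[R]_(l, m)) :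
  (forall i j, (fun t => A t i j) @ W --> A' i j) ->
  (forall i j, (fun t => B t i j) @ W --> B' i j) ->
  forall i j, (fun t => (A t *m B t) i j) @ W --> (A' *m B') i j.
Proof.
move=> HA HB i j; rewrite mxE; under [X in X @ _ --> _]funext do rewrite mxE.
apply: (@cvg_big R _ +%R 0 xpredT) => [|s _]; first exact: add_continuous.
by apply: cvgM; [exact: HA | exact: HB].
Qed.

Lemma ultra_finite (T : Type) (W : set_system T) {WU : UltraFilter W} (S : finType)
    (Q : S -> set T) :
  W [set t | exists s, Q s t] -> exists s, W (Q s).
Proof.
move=> H; apply: contrapT => N.
have : W [set t | forall s, ~ Q s t].
  apply: (@filter_forall _ _ (fun s t => ~ Q s t)) => s.
  by have [QW|//] := in_ultra_setVsetC (Q s) WU; exfalso; apply: N; exists s.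
by move=> /(filterI H)/filter_ex[t [[s Qs] /(_ s)]].
Qed.

Lemma cvg_expN_infty (R : realType) (T : Type) (W : set_system T) {WF : Filter W}
    (f : T -> R) :
  (forall B, W [set t | B < f t]) -> (fun t => expR (- f t)) @ W --> 0.
Proof.
move=> H; apply/cvgrPdist_le => e e0.
apply: filterS (H (- ln e)) => t /= ft.
rewrite sub0r normrN ger0_norm ?expR_ge0// -ler_ln ?posrE ?expR_gt0// expRK.
by rewrite lerNl ltW.
Qed.

Section Dilation.
Context {R : realType} (K : ground) (n p N : nat).

(** For K = C equivalent to the absolute value of the coordinate, and compatible
    with positive scaling. *)
Definition modulus (x : kspace R K n) (l : 'I_n) : R := \sum_(i | kidx i == l) `|x 0 i|.

Lemma modulus_ge0 x l : 0 <= modulus x l.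
Proof. exact: sumr_ge0. Qed.

Lemma modulus_gt0 x l : (0 < modulus x l) = (coordinate x l != 0).
Proof.
apply/idP/idP => [|/coordinate_neq0[i <- xi]].
  apply: contraLR; rewrite negbK => /eqP c0; rewrite lt0r modulus_ge0 andbT negbK.
  apply/eqP; apply: big1 => i /eqP il; apply/eqP; rewrite normr_eq0.
  apply: contraT => xi; have := (coordinate_neq0 x l).2 (ex_intro2 _ _ i il xi).
  by rewrite c0 eqxx.
by rewrite /modulus (bigD1 i)//= ltr_pwDl ?normr_gt0// sumr_ge0.
Qed.

Lemma modulus_le x l : modulus x l <= (kdim K n)%:R * `|x|.
Proof.
apply: (@le_trans _ _ (\sum_(i < kdim K n) `|x|)).
  by rewrite /modulus big_mkcond /=; apply: ler_sum => i _; case: ifP => // _; exact: normrv_le.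
by rewrite sumr_const card_ord mulr_natl.
Qed.

(** Scaling makes the Jacobian at a point near the origin into the Jacobian at a
    point of bounded size of a map with nearly the coefficients of a face. *)
Lemma jac_map_dilate (c c' : 'I_p -> bmultinom (kdim K n) N -> 'I_(kdim K 1) -> R)
    (w : 'rV[R]_n) (v : 'I_p -> 'rV[R]_n) (x : kspace R K n) :
  (forall j m q, c' j m q = c j m q * expR (- dot w (exponent R (bmnm m) - v j))) ->
  (\rank (jac_map c' (x *m kdilate K (\row_l expR (w 0 l)))%R) <=
   \rank (jac_map c x))%N.
Proof.
move=> c'E; set y := x *m _.
pose S := kdilate K (\row_l expR ((- w) 0 l)) : 'M[R]_(kdim K n).
have yS : y *m S = x.
  apply/rowP => i; rewrite /S /y !kdilateE !mxE mulrA -expRD.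
  by rewrite addNr expR0 mul1r.
have gE i : grad_map c' i y = expR (dot w (v (kidx i))) *: (grad_map c i x *m S).
  rewrite /grad_map mulmx_suml scaler_sumr; apply: eq_bigr => m _.
  rewrite mulmx_suml scaler_sumr; apply: eq_bigr => q _.
  rewrite -scalemxAl -[in RHS]yS /S grad_mu_dilate !scalerA c'E.
  congr (_ *: _); rewrite [expR (dot w _) * _]mulrC -mulrA -expRD.
  by congr (_ * expR _); rewrite dotBr (dotC (- w)) dotNr (dotC _ w); ring.
rewrite (_ : jac_map c' y = (S^T *m jac_map c x) *m
    diag_mx (\row_i expR (dot w (v (kidx i))))); last first.
  apply/matrixP => l i; rewrite mul_mx_diag !mxE gE !mxE mulrC; congr (_ * _).
  by apply: eq_bigr => k _; rewrite !mxE mulrC.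
apply: leq_trans (mxrankM_maxl _ _) _; exact: mxrankM_maxr.
Qed.

End Dilation.

Lemma coeffs_continuous (R : realType) K n p N (f : kmap R K n p) (F : kfamily R K n p)
    (es : kspace R K 1) j m q :
  is_deformation f F -> {for es, continuous (fun e => coeffs N (F e) j m q)}.
Proof.
move=> [_ _ Fan]; have := Fan j (bmnm m) q.
move=> /(@analytic_c11_at _ _ _ _ es)/(_ I)[G /c11_loc_lipschitz/loc_lipschitz_continuous].
rewrite (_ : (fun e => _) = (fun e => coeffs N (F e) j m q))//.
by apply/funext => e; rewrite realifyE.
Qed.

(** Along an ultrafilter on a hypothetical family of critical points tending to
    the origin, the adapted weights decide which exponents stay within a bounded
    distance of the minimum.  After a bounded correction of the weights these
    exponents lie on the face of one fixed weight; rescaled by the corrected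
    weights, the points and the maps converge to a singular point of that face
    part. *)
Lemma no_critical (R : realType) K n p N (f : kmap R K n p) (F : kfamily R K n p)
    (D : 'I_p -> set 'rV[R]_n) (P : 'I_p -> seq 'rV[rat]_n) (es : kspace R K 1) :
  (0 < n)%N -> (0 < p)%N -> is_deformation f F ->
  (forall j, is_Cface_diagram (D j)) -> (forall j, facet_weights (D j) (P j)) ->
  SIKND D P f ->
  (forall j e w, w \in P j ->
     ((weight_diagram w (D j))%:E <= weight_poly w (F e j - f j)%R)%E) ->
  (forall e, degree_lt N (F e)) ->
  (forall j m, D j (exponent R m) -> mcoeff m (F es j) = mcoeff m (f j)) ->
  exists2 d, 0 < d & forall (x : kspace R K n) e,
    x != 0 -> `|x| < d -> `|e - es| < d ->
    (\rank (jac_map (coeffs N (F e)) x) = kdim K p)%N.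
Proof.
move=> n0 p0 Fdef DC DP Sf Fw FN FD; apply: contrapT => Hbad.
pose bad (d : R) : set (kspace R K n * kspace R K 1) :=
  [set z | [/\ z.1 != 0, `|z.1| < d, `|z.2 - es| < d &
     (\rank (jac_map (coeffs N (F z.2)) z.1) < kdim K p)%N]].
have bad0 d : 0 < d -> bad d !=set0.
  move=> d0; apply: contrapT => H; apply: Hbad; exists d => // x e x0 xd ed.
  apply/eqP; rewrite eqn_leq rank_leq_col leqNgt; apply/negP => rk.
  by apply: H; exists (x, e).
have badF : ProperFilter (filter_from [set d : R | 0 < d] bad).
  apply: filter_from_proper; last exact: bad0.
  apply: filter_from_filter; first by exists 1; rewrite /= ltr01.
  move=> d1 d2 /= d10 d20; exists (Num.min d1 d2); first by rewrite /= lt_min d10.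
  by move=> z [z0]; rewrite !lt_min => /andP[? ?] /andP[? ?] ?; split; split.
have [W [WU badW]] := ultraFilterLemma badF.
have Wbad d : 0 < d -> W (bad d) by move=> d0; apply: badW; exists d.
have /choice[Js HJs] : forall j, exists J, presents J (D j) /\ forall g : kpoly R K n,
    ((forall w, w \in P j -> ((weight_diagram w (D j))%:E <= weight_poly w g)%E) ->
      forall m, mcoeff m g != 0 -> upper R n J (exponent R m)) /\
    ((forall w, w \in P j -> ((weight_diagram w (D j))%:E < weight_poly w g)%E) ->
      forall m, mcoeff m g != 0 -> ~ D j (exponent R m)).
  by move=> j; have [J PJ H] := supp_upper K n0 (DC j) (DP j); exists J.
have JsD j : presents (Js j) (D j) by case: (HJs j).
have Js0 j : Js j <> [::] by case: (JsD j).
have Jsp j : positive_forms (Js j) by case: (JsD j).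
have Fsupp e j m : mcoeff m (F e j) != 0 -> upper R n (Js j) (exponent R m).
  have [fm Fm|fm _] := eqVneq (mcoeff m (f j)) 0; last first.
    by have [_ /(_ (f j))[H _]] := HJs j; apply: H => //; case: Sf => /(_ j).
  have [_ /(_ (F e j - f j))[H _]] := HJs j; apply: H; first exact: Fw.
  by rewrite mcoeffB fm subr0.
have [V [S [sel [HV Vmin [selV selsurj] [kap kap0 Hkap]]]]] := @newton_weights R n p Js n0 p0 Js0 Jsp.
(* [ux x] records the orders of decay of the nonzero coordinates of [x], and [w x]
   is the weight vector adapted to them. *)
pose ux (x : kspace R K n) : 'rV[R]_n := \row_l - ln (modulus x l).
pose Ix (x : kspace R K n) := [set l | coordinate x l != 0]%SET.
pose small (x : kspace R K n) := x != 0 /\ forall l, modulus x l < 1.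
have /choice[w Hw] : forall x : kspace R K n, exists w : 'rV[R]_n, small x ->
    [/\ (forall i, 0 < w 0 i) /\ (forall i, i \in Ix x -> w 0 i <= ux x 0 i),
        exists s, (forall j v, v \in V j -> dot w (sel s j) <= dot w v) /\
          forall i, (\sum_j sel s j) 0 i != 0 -> i \in Ix x /\ w 0 i = ux x 0 i,
        forall i, exists s, (forall j v, v \in V j -> dot w (sel s j) <= dot w v) /\
          0 < (\sum_j sel s j) 0 i &
        forall c, 0 <= c -> (forall i, i \in Ix x -> c <= ux x 0 i) ->
          forall i, kap * c <= w 0 i].
  move=> x; have [[x0 xs]|nx] := pselect (small x); last by exists 0.
  have [||w Hw] := Hkap (Ix x) (ux x); last by exists w.
  - have [i xi] : exists i, x 0 i != 0.
      apply: contrapT => H; move/eqP: x0; apply; apply/rowP => i; rewrite mxE.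
      by apply: contrapT => /eqP xi; apply: H; exists i.
    apply/set0Pn; exists (kidx i); rewrite inE; apply/coordinate_neq0.
    by exists i.
  - by move=> l; rewrite inE mxE -modulus_gt0 => xl; rewrite oppr_gt0 ln_lt0// xl xs.
have C1 : 0 < (kdim K n)%:R + 1 :> R by rewrite ltr_wpDl.
have modW (c : R) : 0 < c -> W [set z | z.1 != 0 /\ forall l, modulus z.1 l < c].
  move=> c0; apply: filterS (Wbad (c / ((kdim K n)%:R + 1)) (divr_gt0 c0 C1)) => z.
  move=> [z0 + _ _]; rewrite ltr_pdivlMr// => zc; split=> // l.
  apply: le_lt_trans (modulus_le z.1 l) _; apply: le_lt_trans zc.
  by rewrite mulrC ler_wpM2l// lerDl.
have Wsmall : W [set z | small z.1] by exact: modW.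
have wlarge (B : R) : W [set z | forall i, B < w z.1 0 i].
  pose c := (`|B| + 1) / kap.
  have c0 : 0 <= c by rewrite divr_ge0 ?addr_ge0// ltW.
  apply: filterS2 Wsmall (modW (expR (- c)) (expR_gt0 _)) => z zs [_ zm] i.
  have [_ _ _ H] := Hw _ zs.
  apply: (@lt_le_trans _ _ (kap * c)).
    rewrite /c mulrC divfK ?gt_eqF//; have := ler_norm B; lra.
  apply: H => // l; rewrite inE -modulus_gt0 => zl; rewrite mxE lerNr.
  by rewrite -(expRK (- c)) ler_ln ?posrE ?expR_gt0// ltW.
have [s0 Hs0] : exists s0 : S, W [set z |
    (forall j v, v \in V j -> dot (w z.1) (sel s0 j) <= dot (w z.1) v) /\
    forall i, (\sum_j sel s0 j) 0 i != 0 -> i \in Ix z.1 /\ w z.1 0 i = ux z.1 0 i].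
  apply: (@ultra_finite _ W WU S (fun s z => (forall j v, v \in V j ->
     dot (w z.1) (sel s j) <= dot (w z.1) v) /\ forall i, (\sum_j sel s j) 0 i != 0 ->
     i \in Ix z.1 /\ w z.1 0 i = ux z.1 0 i)).
  by apply: filterS Wsmall => z /Hw[].
have /choice[si Hsi] : forall i, exists s : S, W [set z |
    (forall j v, v \in V j -> dot (w z.1) (sel s j) <= dot (w z.1) v) /\
    0 < (\sum_j sel s j) 0 i].
  move=> i; apply: (@ultra_finite _ W WU S (fun s z => (forall j v, v \in V j ->
     dot (w z.1) (sel s j) <= dot (w z.1) v) /\ 0 < (\sum_j sel s j) 0 i)).
  by apply: filterS Wsmall => z /Hw[_ _ /(_ i)].
pose v := sel s0.
(* The slack of an exponent or of a vertex is the amount by which the weight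
   [w x] exceeds its minimum there.  Along the ultrafilter it stays bounded or
   tends to infinity.  The part [wb] of the weight is a linear function of the
   bounded slacks, hence bounded, and without it these slacks vanish. *)
pose X : finType := (('I_p * bmultinom (kdim K n) N) + ('I_p * S))%type.
pose dv (a : X) : 'rV[R]_n := match a with
  | inl jm => exponent R (bmnm jm.2) - v jm.1
  | inr js => sel js.2 js.1 - v js.1 end.
pose rel (a : X) : Prop := match a with
  | inl jm => upper R n (Js jm.1) (exponent R (bmnm jm.2)) | inr _ => True end.
have slack_ge0 a : rel a -> W [set z | 0 <= dot (w z.1) (dv a)].
  move=> ra; apply: filterS2 Hs0 Wsmall => z [zv _] /Hw[[w0 _] _ _ _].
  case: a ra => [[j m]|[j s]] /= ra; rewrite dotBr subr_ge0; last exact: zv.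
  apply: (Vmin j) => // [i|]; first exact: ltW.
  exact: zv.
pose bnd a := rel a /\ exists B, W [set z | dot (w z.1) (dv a) <= B].
pose Dt : 'M[R]_(n, #|X|) :=
  \matrix_(i, k) if `[< bnd (enum_val k) >] then dv (enum_val k) 0 i else 0.
have DtE (u : 'rV[R]_n) k : (u *m Dt) 0 k = if `[< bnd (enum_val k) >] then
    dot u (dv (enum_val k)) else 0.
  rewrite mxE; case: asboolP => b.
    by apply: eq_bigr => i _; rewrite mxE asboolT.
  by apply: big1 => i _; rewrite mxE asboolF// mulr0.
pose wb z := w z *m Dt *m pinvmx Dt.
pose w' z := w z - wb z.
have w'0 z a : bnd a -> dot (w' z) (dv a) = 0.
  move=> ba; have : w' z *m Dt = 0.
    by rewrite mulmxBl mulmxKpV ?subrr// submxMl.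
  move=> /rowP/(_ (enum_rank a)); rewrite DtE enum_rankK asboolT//.
  by rewrite mxE.
have [K0 K00 HK0] : exists2 K0, 0 <= K0 & W [set z | `|wb z.1| <= K0].
  have [k k0 Hk] := norm_mulmx (pinvmx Dt).
  have /choice[B HB] : forall a : X, exists B, 0 <= B /\ W [set z | bnd a ->
      `|dot (w z.1) (dv a)| <= B].
    move=> a; have [[ra [B HB]]|nb] := pselect (bnd a); last first.
      by exists 0; split=> //; apply: filterE => z /nb.
    exists `|B|; split=> //; apply: filterS2 HB (slack_ge0 _ ra) => z /= zB z0 _.
    by rewrite ger0_norm// (le_trans zB)// ler_norm.
  exists (k * \sum_a B a).
    by rewrite mulr_ge0 ?(ltW k0)// sumr_ge0// => a _; case: (HB a).
  have : W [set z | forall a, bnd a -> `|dot (w z.1) (dv a)| <= B a].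
    apply: (@filter_forall _ _ (fun a z => bnd a -> `|dot (w z.1) (dv a)| <= B a)) => a.
    by case: (HB a).
  apply: filterS => z Hz; apply: le_trans (Hk _) _; rewrite ler_wpM2l ?(ltW k0)//.
  apply: normrv_leP => [|l]; first by rewrite sumr_ge0// => a _; case: (HB a).
  rewrite DtE; case: asboolP => b; last first.
    by rewrite normr0 sumr_ge0// => a _; case: (HB a).
  apply: le_trans (Hz _ b) _; rewrite (bigD1 (enum_val l))//= lerDl.
  by rewrite sumr_ge0// => a _; case: (HB a).
have w'large (B : R) : W [set z | forall i, B < w' z.1 0 i].
  apply: filterS2 (wlarge (B + K0)) HK0 => z zw zb i; rewrite [w' _ _ _]mxE [(- wb _) _ _]mxE.
  have := zw i; have := le_trans (normrv_le (wb z.1) i) zb; rewrite ler_norml.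
  by move=> /andP[_]; lra.
have w'inf a : rel a -> ~ bnd a -> forall B, W [set z | B < dot (w' z.1) (dv a)].
  move=> ra nb B; pose c := n%:R * (K0 * `|dv a|).
  have : W [set z | B + c < dot (w z.1) (dv a)].
    have [H|H] := in_ultra_setVsetC [set z | dot (w z.1) (dv a) <= B + c] WU.
      by exfalso; apply: nb; split=> //; exists (B + c).
    by apply: filterS H => z /=; rewrite ltNge => H; apply/negP.
  move=> H; apply: filterS2 H HK0 => z /= zw zb; rewrite dotBl.
  have := dot_norm (wb z.1) (dv a); rewrite ler_norml => /andP[_].
  have : n%:R * (`|wb z.1| * `|dv a|) <= c by rewrite ler_wpM2l// ler_wpM2r.
  lra.
(* The rescaled points are bounded because [w x] is at most [ux x]; where both
   agree, the coordinates are also bounded away from 0. *)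
pose y (z : kspace R K n * kspace R K 1) : kspace R K n :=
  z.1 *m kdilate K (\row_l expR (w' z.1 0 l)).
have modyE z l : modulus (y z) l = expR (w' z.1 0 l) * modulus z.1 l.
  rewrite /modulus mulr_sumr; apply: eq_bigr => i /eqP il.
  by rewrite /y kdilateE mxE il normrM gtr0_norm// expR_gt0.
have mody z l : l \in Ix z.1 -> modulus (y z) l = expR (w' z.1 0 l - ux z.1 0 l).
  rewrite inE -modulus_gt0 => zl; rewrite modyE expRD [ux _ _ _]mxE opprK lnK//.
have ybnd : W [set z | `|y z| <= expR K0].
  apply: filterS2 Wsmall HK0 => z /Hw[[_ wu] _ _ _] zb.
  apply: normrv_leP => [|i]; first exact: expR_ge0.
  apply: (@le_trans _ _ (modulus (y z) (kidx i))).
    by rewrite /modulus (bigD1 i)//= lerDl sumr_ge0.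
  have [iI|iI] := boolP (kidx i \in Ix z.1); last first.
    move: iI; rewrite inE -modulus_gt0 -leNgt => m0.
    by rewrite modyE (le_trans _ (expR_ge0 _))// mulr_ge0_le0 ?expR_ge0.
  rewrite mody// ler_expR; have := wu _ iI.
  have := le_trans (normrv_le (wb z.1) (kidx i)) zb; rewrite ler_norml.
  by rewrite [w' _ _ _]mxE [(- wb _) _ _]mxE => /andP[]; lra.
have [a ya] := @ultra_cvg_rV R _ W WU _ y _ ybnd.
have ecvg : (fun z => z.2) @ W --> es.
  apply/cvgrPdist_le => e e0; apply: filterS (Wbad _ e0) => z [_ _ + _].
  by rewrite distrC => /ltW.
(* Rescaling divides a coefficient by the exponential of its slack, so that only
   the coefficients with bounded slack survive in the limit. *)
pose c z j (m : bmultinom (kdim K n) N) q := coeffs N (F z.2) j m q *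
  expR (- dot (w' z.1) (exponent R (bmnm m) - v j)).
pose cinf j (m : bmultinom (kdim K n) N) q :=
  if `[< bnd (inl (j, m)) >] then coeffs N (F es) j m q else 0.
have ccvg j m q : (fun z => c z j m q) @ W --> cinf j m q.
  have Fc : (fun z => coeffs N (F z.2) j m q) @ W --> coeffs N (F es) j m q.
    apply: (@cvg_comp _ _ _ (fun z => z.2) (fun e => coeffs N (F e) j m q) _ _ _ ecvg).
    exact: coeffs_continuous Fdef.
  rewrite /cinf /c; case: asboolP => b.
    rewrite (_ : (fun z => _) = fun z => coeffs N (F z.2) j m q)//.
    by apply/funext => z; rewrite (w'0 _ _ b) oppr0 expR0 mulr1.
  have [ra|nr] := pselect (rel (inl (j, m))).
    rewrite -(mulr0 (coeffs N (F es) j m q)); apply: cvgM => //.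
    by apply: cvg_expN_infty; exact: (w'inf (inl (j, m))).
  rewrite (_ : (fun z => _) = fun=> 0); first exact: cvg_cst.
  apply/funext => z; rewrite /coeffs.
  suff -> : mcoeff (bmnm m) (F z.2 j) = 0 by rewrite kcomp0 mul0r.
  by apply: contrapT => /eqP /Fsupp.
have rkinf : (\rank (jac_map cinf a) < kdim K p)%N.
  have Jcvg l i : (fun z => jac_map (c z) (y z) l i) @ W --> jac_map cinf a l i.
    have jE c' x : jac_map c' x l i = \sum_m \sum_q c' (kidx i) m q *
        grad_mu i (bmnm m) q x 0 l.
      rewrite mxE /grad_map summxE; apply: eq_bigr => m _.
      by rewrite summxE; apply: eq_bigr => q _; rewrite mxE.
    rewrite jE (_ : (fun z => _) = fun z => \sum_m \sum_q c z (kidx i) m q *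
        grad_mu i (bmnm m) q (y z) 0 l); last by apply/funext => z; rewrite jE.
    apply: (@cvg_big R _ +%R 0 xpredT) => [|m _]; first exact: add_continuous.
    apply: (@cvg_big R _ +%R 0 xpredT) => [|q _]; first exact: add_continuous.
    apply: cvgM; first exact: ccvg.
    apply: (@cvg_comp _ _ _ y (fun x => grad_mu i (bmnm m) q x 0 l) _ _ _ ya).
    by apply: loc_lipschitz_continuous; case: (grad_muP i (bmnm m) q a).
  rewrite -gram_det; apply/eqP.
  have dcvg : (fun z => \det ((jac_map (c z) (y z))^T *m jac_map (c z) (y z))) @ W -->
      \det ((jac_map cinf a)^T *m jac_map cinf a).
    apply: cvg_det => i j; apply: cvg_mulmx => // k l.
    rewrite mxE (_ : (fun z => _) = fun z => jac_map (c z) (y z) l k); first exact: Jcvg.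
    by apply/funext => z; rewrite mxE.
  apply: (@closed_cvg _ _ W _ _ (fun x => x = 0) (@closed_eq R 0) _ _ dcvg).
  apply: filterS (Wbad 1 ltr01) => z [_ _ _ rk]; apply/eqP; rewrite gram_det.
  by apply: leq_ltn_trans rk; apply: jac_map_dilate.
(* A single corrected weight [w1] from the family vanishes on the bounded slacks
   and is positive on the other ones, so that its face carries exactly the terms
   of the limit map. *)
have : W [set z | [/\ forall i, 0 < w' z.1 0 i & forall b, rel b -> ~ bnd b ->
    0 < dot (w' z.1) (dv b)]].
  apply: filterS2 (w'large 0) (_ : W [set z | forall b, rel b -> ~ bnd b ->
    0 < dot (w' z.1) (dv b)]) => [z ? ?|]; first by split.
  apply: (@filter_forall _ _ (fun b z => rel b -> ~ bnd b -> 0 < dot (w' z.1) (dv b))) => b.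
  have [rb|nr] := pselect (rel b); last by apply: filterE => z /nr.
  have [bb|nb] := pselect (bnd b); first by apply: filterE => z _ /(_ bb).
  by apply: filterS (w'inf b rb nb 0).
move=> /filter_ex[z1 [w1pos w1inf]]; set w1 := w' z1.1 in w1pos w1inf.
have w1ge b : rel b -> 0 <= dot w1 (dv b).
  move=> rb; have [/w'0->//|nb] := pselect (bnd b).
  exact: ltW (w1inf _ rb nb).
have vmin j nu : upper R n (Js j) nu -> dot w1 (v j) <= dot w1 nu.
  apply: Vmin => [i|b bV]; first exact: ltW.
  have [s <-] := selsurj j b bV.
  by have := w1ge (inr (j, s)) I; rewrite /= dotBr subr_ge0.
have vJ j : upper R n (Js j) (v j) by case: (HV j) => _; apply; exact: selV.
have minv j : minimizers (Js j) w1 (v j) by split=> // nu; exact: vmin.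
have minP j nu : minimizers (Js j) w1 nu <-> upper R n (Js j) nu /\ dot w1 (nu - v j) = 0.
  rewrite dotBr; split=> [[nuJ numin]|[nuJ /eqP]].
    by split=> //; apply/eqP; rewrite subr_eq0 eq_le numin//= vmin.
  by rewrite subr_eq0 => /eqP nuv; split=> // mu' mu'J; rewrite nuv vmin.
have minsel s : W [set z | forall j b, b \in V j -> dot (w z.1) (sel s j) <= dot (w z.1) b] ->
    forall j, minimizers (Js j) w1 (sel s j).
  move=> Hs j; apply/minP; split; first by case: (HV j) => _; apply; exact: selV.
  have : bnd (inr (j, s)).
    split=> //; exists 0; apply: filterS Hs => z /(_ j (v j) (selV _ _)).
    by rewrite /= dotBr subr_le0.
  by move=> /(w'0 z1.1).
have fE : f = F 0 by apply/funext => j; case: Fdef => ->.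
pose g := restrict_map (fun j => minimizers (Js j) w1) f.
have gN : degree_lt N g.
  move=> j m; rewrite mcoeff_restrict; case: asboolP => _; last by rewrite eqxx.
  by rewrite fE; exact: FN.
have cg : coeffs N g = cinf.
  apply/funext => j; apply/funext => m; apply/funext => q.
  rewrite /coeffs /g /restrict_map mcoeff_restrict /cinf /coeffs.
  case: asboolP => [/minP[mJ m0]|nm].
    rewrite asboolT; last first.
      apply: contrapT => nb; have := w1inf (inl (j, m)) mJ nb.
      by rewrite /= m0 ltxx.
    rewrite FD//; case: (JsD j) => _ _ ->.
    by apply: (@minimizers_diagram _ _ _ w1) => //; apply/minP.
  rewrite asboolF ?kcomp0// => b; apply: nm; apply/minP; split; first by case: b.
  exact: (w'0 z1.1 _ b).
have sing : singular_locus g a.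
  by rewrite /singular_locus /= (jacobian_eval_map _ gN) cg.
pose Ia := [set l | coordinate a l != 0]%SET.
have vIa i : (\sum_j v j) 0 i != 0 -> i \in Ia.
  move=> vi; rewrite inE -modulus_gt0.
  apply: (@lt_le_trans _ _ (expR (- K0))); first exact: expR_gt0.
  have mcvg : (fun z => modulus (y z) i) @ W --> modulus a i.
    apply: (@cvg_big R _ +%R 0 (fun k => kidx k == i)) => [|k _]; first exact: add_continuous.
    apply: cvg_norm; apply: (@cvg_comp _ _ _ y (fun x => x 0 k) _ _ _ ya).
    exact: coord_continuous.
  apply: (@closed_cvg _ _ W _ _ (fun x => expR (- K0) <= x) (@closed_ge R _) _ _ mcvg).
  apply: filterS2 Hs0 HK0 => z [_ /(_ i vi)[iI wi]] zb; rewrite mody// ler_expR.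
  have := le_trans (normrv_le (wb z.1) i) zb; rewrite ler_norml.
  by rewrite [w' _ _ _]mxE [(- wb _) _ _]mxE wi => /andP[]; lra.
have Ia0 : Ia != finset.set0.
  have j0 := Ordinal p0; have vo j i : 0 <= v j 0 i by case: (vJ j) => + _; apply.
  have [i vi] : exists i, v j0 0 i != 0.
    apply: contrapT => H; move/eqP: (upper_neq0 (Js0 j0) (vJ j0)); apply.
    by apply/rowP => i; rewrite mxE; apply: contrapT => /eqP vi; apply: H; exists i.
  apply/set0Pn; exists i; apply: vIa; rewrite summxE (bigD1 j0)//= gt_eqF//.
  by rewrite ltr_pwDl ?sumr_ge0// lt_neqAle eq_sym vi vo.
apply: (SIKND_regular n0 p0 Sf JsD w1pos minv Ia0 _ _ _ sing).
- move=> i; exists (sel (si i)); split.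
    by apply: minsel; apply: filterS (Hsi i) => z [].
  by have /filter_ex[z []] := Hsi i.
- exists v; split=> //; exact: vIa.
- by move=> l; rewrite inE.
Qed.

(** * Ordinary differential equations *)

(** The interval extends beyond [0, 1], so that the derivative is two-sided at
    the end points as well. *)
Lemma antiderivative (R : realType) (g : R -> R) : continuous g ->
  exists G : R -> R, G 0 = 0 /\ forall t : R, -1 < t < 2 -> is_derive t 1 G (g t).
Proof.
move=> gc; pose F x := (\int[@lebesgue_measure R]_(t in [set` `[(-1 : R), x]]) (g t))%R.
exists (fun x => F x - F 0); split; first by rewrite subrr.
move=> t /andP[t1 t2].
have ig : (@lebesgue_measure R).-integrable `[(-1 : R), 3] (EFin \o g).
  apply: continuous_compact_integrable; first exact: segment_compact.
  by apply: continuous_subspaceT => x; exact: gc.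
have t3 : t < 3 by apply: lt_trans t2 _; rewrite ltr_nat.
have [Fd FE] := continuous_FTC1_closed t3 ig t1 (gc t).
have dF : is_derive t 1 F (g t) by split=> //; rewrite -derive1E.
by apply: is_derive_eq; rewrite subr0.
Qed.

Lemma deriv_le0 (R : realType) (phi dphi : R -> R) (T : R) :
  (forall t : R, 0 <= t <= T -> is_derive t 1 phi (dphi t)) ->
  (forall t, 0 <= t <= T -> dphi t <= 0) ->
  forall s t, 0 <= s -> s <= t -> t <= T -> phi t <= phi s.
Proof.
move=> dp dp0 s t s0 st tT.
have io x : x \in `]0, T[%R -> 0 <= x <= T.
  by rewrite in_itv /= => /andP[/ltW -> /ltW ->].
apply: (@ler0_derive1_nincr _ phi 0 T) => //.
- by move=> x /io/dp[].
- by move=> x /io xT; rewrite derive1E; have [_ ->] := dp _ xT; exact: dp0.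
- apply: derivable_within_continuous => x; rewrite in_itv /= => /dp[].
  by [].
Qed.

Lemma deriv_compare (R : realType) (phi dphi psi dpsi : R -> R) (T : R) :
  (forall t : R, 0 <= t <= T -> is_derive t 1 phi (dphi t)) ->
  (forall t : R, 0 <= t <= T -> is_derive t 1 psi (dpsi t)) ->
  (forall t, 0 <= t <= T -> `|dphi t| <= dpsi t) ->
  forall t, 0 <= t <= T -> `|phi t - phi 0| <= psi t - psi 0.
Proof.
move=> dp dq H t /andP[t0 tT].
rewrite ler_norml; apply/andP; split.
  have := @deriv_le0 R (- (psi + phi)) (fun t => - (dpsi t + dphi t)) T _ _ 0 t.
  rewrite !fctE /= => h; have {}h : - (psi t + phi t) <= - (psi 0 + phi 0).
    apply: h => // s sT; last by rewrite oppr_le0; have := H s sT; rewrite ler_norml; lra.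
    by have ? := dp s sT; have ? := dq s sT; apply: is_deriveN.
  by lra.
have := @deriv_le0 R (phi - psi) (fun t => dphi t - dpsi t) T _ _ 0 t.
rewrite !fctE /= => h; have {}h : phi t - psi t <= phi 0 - psi 0.
  apply: h => // s sT; last by have := H s sT; rewrite ler_norml; lra.
  by have ? := dp s sT; have ? := dq s sT; apply: is_deriveB.
by lra.
Qed.

Lemma is_derive_expM (R : realType) (a t : R) :
  is_derive t 1 (fun s => expR (a * s)) (a * expR (a * t)).
Proof.
have H : is_derive t 1 (fun s : R => a * s) a.
  have := @is_deriveZ R _ _ id a t 1 1 _; rewrite /GRing.scale /= mulr1.
  exact.
rewrite mulrC.
exact: (@is_derive1_comp R expR (fun s => a * s) t (expR (a * t)) a (is_derive_expR _) H).
Qed.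

(** Two solutions of an equation with Lipschitz right hand side drift apart at
    most exponentially. *)
Lemma gronwall (R : realType) M (w : 'rV[R]_M -> 'rV[R]_M) (C : set 'rV[R]_M) L T
    (g1 g2 : R -> 'rV[R]_M) :
  0 <= L -> (forall x y, C x -> C y -> `|w y - w x| <= L * `|y - x|) ->
  (forall t : R, 0 <= t <= T -> C (g1 t) /\ is_derive t 1 g1 (w (g1 t))) ->
  (forall t : R, 0 <= t <= T -> C (g2 t) /\ is_derive t 1 g2 (w (g2 t))) ->
  forall t : R, 0 <= t <= T ->
    `|g2 t - g1 t| ^+ 2 <= M%:R * expR (2 * M%:R * L * t) * `|g2 0 - g1 0| ^+ 2.
Proof.
move=> L0 wL H1 H2 t tT.
pose d s := g2 s - g1 s.
pose E s := dot (d s) (d s).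
have Enorm (u : 'rV[R]_M) : `|u| ^+ 2 <= dot u u.
  have du : 0 <= dot u u by apply: sumr_ge0 => i _; rewrite -expr2 sqr_ge0.
  have : `|u| <= Num.sqrt (dot u u).
    apply: normrv_leP => [|i]; first exact: sqrtr_ge0.
    rewrite -sqrtr_sqr ler_wsqrtr// /dot (bigD1 i)//= -expr2 lerDl.
    by apply: sumr_ge0 => k _; rewrite -expr2 sqr_ge0.
  by move=> h; rewrite -(sqr_sqrtr du) lerXn2r ?nnegrE ?sqrtr_ge0.
have E0 s : 0 <= E s by apply: le_trans (Enorm (d s)); rewrite exprn_ge0.
pose k := 2 * M%:R * L.
have dE s : 0 <= s <= T -> is_derive s 1 E (2 * dot (d s) (w (g2 s) - w (g1 s))).
  move=> sT; have [_ d1] := H1 s sT; have [_ d2] := H2 s sT.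
  have dd : is_derive s 1 d (w (g2 s) - w (g1 s)) by exact: is_deriveB.
  have cE (x : 'rV[R]_M) : c11 (fun x => dot x x) (fun x => x + x) x.
    have cc i (y : 'rV[R]_M) : c11 (fun x => x 0 i) (fun=> delta_mx 0 i) y.
      have := c11_dot (delta_mx 0 i) y; congr (c11 _ _ _).
      by apply/funext => z; rewrite dotC dot_deltar.
    have := c11_sum (index_enum _) xpredT (fun i => c11M (cc i x) (cc i x)).
    congr (c11 _ _ _); apply/funext => y; apply/rowP => i; rewrite summxE mxE.
    rewrite (bigD1 i)//= big1 ?addr0; first by rewrite !mxE !eqxx /= !mulr1.
    by move=> j ji; rewrite !mxE eq_sym (negbTE ji) /= !mulr0 addr0.
  have := is_derive_comp_c11 dd (cE (d s)); congr (is_derive _ _ _ _).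
  by rewrite dotDl; ring.
have dF s : 0 <= s <= T -> is_derive s 1 (fun s => E s * expR (- k * s))
    ((2 * dot (d s) (w (g2 s) - w (g1 s)) - k * E s) * expR (- k * s)).
  move=> sT; have ? := dE s sT; have ? := is_derive_expM (- k) s.
  by apply: is_derive_eq; rewrite /GRing.scale /=; ring.
have := deriv_le0 dF _ (lexx 0); move=> /(_ _ t).
have [t0 t1] := andP tT; rewrite t0 t1 mulr0 expR0 mulr1.
move=> /(_ _ isT isT) h; have {}h : E t * expR (- k * t) <= E 0.
  apply: h => s sT; apply: mulr_le0_ge0; last exact: expR_ge0.
  rewrite subr_le0; have [C1 _] := H1 s sT; have [C2 _] := H2 s sT.
  apply: le_trans (_ : _ <= 2 * `|dot (d s) (w (g2 s) - w (g1 s))|) _.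
    by rewrite ler_wpM2l// ler_norm.
  rewrite /k -!mulrA ler_wpM2l//; apply: le_trans (dot_norm _ _) _.
  rewrite ler_wpM2l//; apply: (@le_trans _ _ (L * `|d s| ^+ 2)); last first.
    by rewrite ler_wpM2l.
  by rewrite expr2 mulrCA ler_wpM2l//; exact: wL.
apply: (le_trans (Enorm _)); rewrite -/(d t) -/(E t).
have -> : E t = E t * expR (- k * t) * expR (k * t).
  by rewrite -mulrA -expRD mulNr addNr expR0 mulr1.
rewrite -/k [leRHS]mulrAC ler_wpM2r ?expR_ge0//; apply: le_trans h _.
apply: le_trans (ler_norm _) _; apply: le_trans (dot_norm _ _) _.
by rewrite -expr2.
Qed.

(** McShane's formula: the infimum of the cones of slope [L] over the graph. *)
Lemma lipschitz_extension (R : realType) M (f : 'rV[R]_M -> R) (C : set 'rV[R]_M) L :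
  0 <= L -> (forall x y, C x -> C y -> `|f y - f x| <= L * `|y - x|) ->
  exists f', (forall x y, `|f' y - f' x| <= L * `|y - x|) /\ forall x, C x -> f' x = f x.
Proof.
move=> L0 fL; have [->|/set0P[c0 Cc0]] := eqVneq C set0.
  by exists (fun=> 0); split=> // x y; rewrite subrr normr0 mulr_ge0.
pose S x := [set f c + L * `|x - c| | c in C].
have Slb x : lbound (S x) (f c0 - L * `|x - c0|).
  move=> _ [c Cc <-]; have := fL _ _ Cc Cc0; rewrite ler_norml => /andP[_ h].
  have : L * `|c0 - c| <= L * `|x - c0| + L * `|x - c|.
    rewrite -mulrDr ler_wpM2l//.
    by have := ler_normD (c0 - x) (x - c); rewrite subrKA (distrC c0 x).
  lra.
have Sinf x : has_inf (S x).
  by split; [exists (f c0 + L * `|x - c0|), c0 | exists (f c0 - L * `|x - c0|); exact: Slb].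
have Sle x c : C c -> inf (S x) <= f c + L * `|x - c|.
  by move=> Cc; apply: ge_inf; [case: (Sinf x) | exists c].
exists (fun x => inf (S x)); split=> [x y|x Cx].
  have H u v : inf (S u) - inf (S v) <= L * `|u - v|.
    rewrite lerBlDr addrC -lerBlDr; apply: lb_le_inf; first by case: (Sinf v).
    move=> _ [c Cc <-]; rewrite lerBlDr; apply: le_trans (Sle u c Cc) _.
    rewrite -addrA lerD2l -mulrDr ler_wpM2l//.
    by rewrite [leRHS]addrC; have := ler_normD (u - v) (v - c); rewrite subrKA.
  rewrite ler_norml; apply/andP; split; last exact: H.
  by rewrite lerNl opprB distrC; exact: H.
apply/eqP; rewrite eq_le; apply/andP; split.
  by apply: le_trans (Sle x x Cx) _; rewrite subrr normr0 mulr0 addr0.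
apply: lb_le_inf; first by case: (Sinf x).
move=> _ [c Cc <-]; have := fL _ _ Cc Cx; rewrite ler_norml => /andP[_].
by rewrite lerBlDr addrC.
Qed.

Lemma lipschitz_extension_rV (R : realType) M M' (f : 'rV[R]_M -> 'rV[R]_M')
    (C : set 'rV[R]_M) L :
  0 <= L -> (forall x y, C x -> C y -> `|f y - f x| <= L * `|y - x|) ->
  exists f', (forall x y, `|f' y - f' x| <= L * `|y - x|) /\ forall x, C x -> f' x = f x.
Proof.
move=> L0 fL.
have /choice[g Hg] : forall i, exists g : 'rV[R]_M -> R,
    (forall x y, `|g y - g x| <= L * `|y - x|) /\ forall x, C x -> g x = f x 0 i.
  move=> i; apply: lipschitz_extension => // x y Cx Cy.
  by apply: le_trans (fL _ _ Cx Cy); have := normrv_le (f y - f x) i; rewrite !mxE.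
exists (fun x => \row_i g i x); split=> [x y|x Cx].
  apply: normrv_leP => [|i]; first by rewrite mulr_ge0.
  by rewrite !mxE; case: (Hg i).
by apply/rowP => i; rewrite mxE; case: (Hg i) => _ ->.
Qed.

Lemma is_derive_rV (R : realType) M (g : R -> 'rV[R]_M) (v : 'rV[R]_M) (t : R) :
  (forall i, is_derive t 1 (fun s => g s 0 i) (v 0 i)) -> is_derive t 1 g v.
Proof.
move=> H; have dg : derivable g t 1.
  by apply/derivable_mxP => i j; rewrite ord1; case: (H j).
split=> //; rewrite derive_mx//; apply/rowP => j; rewrite mxE.
by case: (H j).
Qed.

Lemma is_derive_coord (R : realType) M (g : R -> 'rV[R]_M) (v : 'rV[R]_M) (t : R) i :
  is_derive t 1 g v -> is_derive t 1 (fun s => g s 0 i) (v 0 i).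
Proof.
move=> dg; have := is_derive_comp_c11 dg (c11_dot (delta_mx 0 i) (g t)).
rewrite dotC dot_deltar (_ : (fun s => _) = fun s => g s 0 i)//.
by apply/funext => s; rewrite dotC dot_deltar.
Qed.

Lemma is_derive_continuous (R : realType) (V : normedModType R) (g : R -> V) v (t : R) :
  is_derive t 1 g v -> {for t, continuous g}.
Proof. by move=> [dg _]; apply: differentiable_continuous; apply/derivable1_diffP. Qed.

Lemma exp2_small (R : realType) (c e : R) : 0 < e -> exists k, c * 2^-1 ^+ k <= e.
Proof.
move=> e0; exists (Num.bound (`|c| / e)); set k := Num.bound _.
have kc : `|c| / e < k%:R by rewrite archi_boundP// divr_ge0// ltW.
have k2 : k%:R <= 2 ^+ k :> R by rewrite -natrX ler_nat ltnW// ltn_expl.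
rewrite exprVn ler_pdivrMr ?exprn_gt0//; apply: le_trans (ler_norm _) _.
by move: kc; rewrite ltr_pdivrMr// => kc; nra.
Qed.

Section Picard.
Context {R : realType} {M : nat} (w : 'rV[R]_M -> 'rV[R]_M) (L : R) (z : 'rV[R]_M).
Context (L0 : 0 < L) (wL : forall x y, `|w y - w x| <= L * `|y - x|).

Let clamp (s : R) : R := Num.min `|s| 1.

Let clamp01 s : 0 <= clamp s <= 1.
Proof. by rewrite /clamp le_min normr_ge0 ler01 ge_min lexx orbT. Qed.

Let clampE t : 0 <= t <= 1 -> clamp t = t.
Proof. by move=> /andP[t0 t1]; rewrite /clamp ger0_norm// min_l. Qed.

Let clamp_continuous : continuous clamp.
Proof.
move=> s; apply/cvgrPdist_le => e e0; near=> t.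
have : `|s - t| <= e.
  by near: t; apply/nbhs_ballP; exists e => //= t /ltW.
apply: le_trans; have := ler_dist_dist s t; rewrite /clamp.
case: (leP `|s| 1) => s1; case: (leP `|t| 1) => t1 // h; move: h.
- by rewrite !ler_norml; lra.
- by rewrite !ler_norml; lra.
- by rewrite subrr normr0; exact: le_trans.
Unshelve. all: by end_near. Qed.

Let w_coord_continuous h i : continuous h -> continuous (fun s : R => w (h s) 0 i).
Proof.
move=> hc s; apply: (@continuous_comp _ _ _ h (fun x => w x 0 i)); first exact: hc.
apply: continuous_at_rV => e e0; exists (e / L); first exact: divr_gt0.
move=> y; rewrite ltr_pdivlMr// mulrC => ye.
apply: le_trans (le_trans _ (wL _ _)) (ltW ye).
by have := normrv_le (w y - w (h s)) i; rewrite !mxE.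
Qed.

(** Picard iteration, in the norm weighted by exp (- 2 L t), where one step
    halves the distance. *)
Lemma picard : exists g : R -> 'rV[R]_M, g 0 = z /\
  forall t : R, 0 <= t <= 1 -> is_derive t 1 g (w (g t)).
Proof.
have /choice[A HA] : forall g : R -> R, exists G : R -> R, continuous g ->
    G 0 = 0 /\ forall t : R, -1 < t < 2 -> is_derive t 1 G (g t).
  move=> g; have [gc|gN] := pselect (continuous g); last by exists (fun=> 0).
  by have [G HG] := antiderivative gc; exists G.
pose wh h i := fun s : R => w (h s) 0 i.
pose step h (t : R) : 'rV[R]_M := z + \row_i A (wh h i) t.
(* Freezing time outside [0, 1] makes the iterates continuous on the whole line. *)
pose chain h := fun s : R => step h (clamp s).
have step_derive h (t : R) : continuous h -> 0 <= t <= 1 -> is_derive t 1 (step h) (w (h t)).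
  move=> hc /andP[t0 t1]; apply: is_derive_rV => i.
  have dA : is_derive t 1 (A (wh h i)) (wh h i t).
    by apply: (HA _ (@w_coord_continuous _ _ hc)).2; apply/andP; split; lra.
  have : is_derive t 1 (fun s => z 0 i + A (wh h i) s) (0 + wh h i t).
    by apply: (@is_deriveD _ _ _ (fun=> z 0 i)).
  rewrite add0r (_ : (fun s => _) = fun s => step h s 0 i)//.
  by apply/funext => s; rewrite !mxE.
have step0 h : continuous h -> step h 0 = z.
  move=> hc; apply/rowP => i; rewrite !mxE (HA _ (@w_coord_continuous _ _ hc)).1.
  by rewrite addr0.
have chain_continuous h : continuous h -> continuous (chain h).
  move=> hc s; apply: (@continuous_comp _ _ _ clamp (step h)).
    exact: clamp_continuous.
  exact: is_derive_continuous (step_derive _ _ hc (clamp01 s)).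
pose ex (t : R) := expR (2 * L * t).
have dex c (t : R) : is_derive t 1 (fun s => c * ex s) (c * (2 * L * ex t)).
  by have := @is_deriveZ R _ _ ex c t 1 _ (is_derive_expM (2 * L) t).
have ex0 t : 0 <= ex t by exact: expR_ge0.
have halve h h' c : continuous h -> continuous h' -> 0 <= c ->
    (forall s, `|h s - h' s| <= c * ex (clamp s)) ->
    forall t, 0 <= t <= 1 -> `|step h t - step h' t| <= c / 2 * ex t.
  move=> hc hc' c0 hh t t01; apply: normrv_leP => [|i].
    by rewrite mulr_ge0// divr_ge0.
  have := @deriv_compare R (fun s => step h s 0 i - step h' s 0 i)
    (fun s => w (h s) 0 i - w (h' s) 0 i) (fun s => c / 2 * ex s)
    (fun s => c / 2 * (2 * L * ex s)) 1 _ _ _ t t01.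
  rewrite !step0// subrr subr0 !mxE => H; apply: le_trans (H _ _ _) _.
  - move=> s s01; apply: is_deriveB; apply: is_derive_coord; exact: step_derive.
  - move=> s s01; apply: (@le_trans _ _ (L * `|h s - h' s|)).
      have := normrv_le (w (h s) - w (h' s)) i; rewrite !mxE => h1.
      exact: le_trans h1 (wL _ _).
    have := hh s; rewrite clampE// => h1.
    rewrite (_ : c / 2 * _ = L * (c * ex s)); last by field.
    by rewrite ler_wpM2l// ltW.
  by rewrite gerBl mulr_ge0// divr_ge0.
pose hk k := iter k chain (fun=> z).
have hkc k : continuous (hk k).
  elim: k => [|k IH]; [by move=> s; exact: cst_continuous | exact: chain_continuous].
pose a := `|w z| / (2 * L).
have a0 : 0 <= a by rewrite divr_ge0// mulr_ge0// ltW.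
have hk1 k s : `|hk k.+1 s - hk k s| <= a * 2^-1 ^+ k * ex (clamp s).
  elim: k s => [|k IH] s; last first.
    have := halve _ _ _ (hkc k.+1) (hkc k) _ IH _ (clamp01 s).
    rewrite mulr_ge0 ?exprn_ge0 ?invr_ge0// => /(_ isT).
    by rewrite exprSr mulrA.
  rewrite expr0 mulr1; set t := clamp s.
  have t01 : 0 <= t <= 1 by exact: clamp01.
  apply: normrv_leP => [|i]; first by rewrite mulr_ge0.
  have := @deriv_compare R (fun s => step (fun=> z) s 0 i)
    (fun s => w z 0 i) (fun s => a * ex s)
    (fun s => a * (2 * L * ex s)) 1 _ _ _ t t01.
  rewrite (step0 _ (hkc 0%N)) => H.
  rewrite (_ : (hk 1%N s - hk 0%N s) 0 i = step (fun=> z) t 0 i - z 0 i); last by rewrite !mxE.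
  apply: le_trans (H _ _ _) _.
  - by move=> s' s01; apply: is_derive_coord; exact: (step_derive _ _ (hkc 0%N)).
  - move=> s' /andP[s'0 _]; apply: le_trans (normrv_le _ _) _.
    rewrite /a mulrA divfK ?mulf_neq0 ?gt_eqF// ler_peMr//.
    by rewrite /ex -expR0 ler_expR !mulr_ge0// ltW.
  by rewrite gerBl mulr_ge0.
clearbody a; have a20 : 0 <= 2 * a by rewrite mulr_ge0.
have hkm k m s : `|hk (k + m)%N s - hk k s| <=
    2 * a * (2^-1 ^+ k - 2^-1 ^+ (k + m)) * ex (clamp s).
  elim: m => [|m IH]; first by rewrite addn0 !subrr normr0 mulr0 mul0r.
  rewrite addnS; have := hk1 (k + m)%N s.
  have := ler_normD (hk (k + m).+1 s - hk (k + m)%N s) (hk (k + m)%N s - hk k s).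
  rewrite subrKA exprSr => h1 h2; apply: (le_trans h1).
  apply: le_trans (lerD h2 IH) _; rewrite le_eqVlt; apply/orP; left; apply/eqP.
  by field.
have hkm' k m s : (k <= m)%N -> `|hk m s - hk k s| <= 2 * a * 2^-1 ^+ k * ex (clamp s).
  move=> km; have := hkm k (m - k)%N s; rewrite subnKC// => h; apply: le_trans h _.
  rewrite ler_wpM2r// ler_wpM2l ?mulr_ge0// gerBl exprn_ge0// invr_ge0.
have [W [WU oW]] := ultraFilterLemma eventually_filter.
have Wk k : W [set m | (k <= m)%N] by apply: oW; exists k.
have /choice[h Hh] : forall s, exists l : 'rV[R]_M, (fun m => hk m s) @ W --> l.
  move=> s; apply: (@ultra_cvg_rV R nat W WU M _ (`|z| + 2 * a * ex (clamp s))).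
  apply: filterE => m /=; have := hkm' 0%N m s (leq0n _); rewrite expr0 mulr1.
  have := ler_normD (hk m s - hk 0%N s) (hk 0%N s); rewrite subrK /hk /=.
  by lra.
have hhk k s : `|h s - hk k s| <= 2 * a * 2^-1 ^+ k * ex (clamp s).
  apply: (@ultra_cvg_le R nat W WU (fun m => `|hk m s - hk k s|)).
    by apply: cvg_norm; apply: cvgB; [exact: Hh | exact: cvg_cst].
  by apply: filterS (Wk k) => m; exact: hkm'.
have exB s : ex (clamp s) <= ex 1.
  by rewrite ler_expR ler_wpM2l ?mulr_ge0 ?(ltW L0)//; case/andP: (clamp01 s).
have hc : continuous h.
  move=> s; apply/cvgrPdist_le => e e0.
  have [k Hk] := @exp2_small R (2 * a * ex 1) (e / 3) (divr_gt0 e0 (ltr0Sn _ 2)).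
  have hk3 t : `|h t - hk k t| <= e / 3.
    apply: le_trans (hhk k t) _; apply: le_trans Hk.
    by rewrite mulrAC ler_wpM2r ?exprn_ge0 ?invr_ge0// ler_wpM2l.
  have e3 : 0 < e / 3 by rewrite divr_gt0.
  have Hs : \forall t \near s, `|hk k s - hk k t| <= e / 3.
    by have /cvgrPdist_le/(_ _ e3) := hkc k s.
  apply: (@filterS _ _ _ _ _ _ Hs) => t ht.
  have := ler_normD (h s - hk k s) (hk k s - h t); rewrite subrKA.
  have := ler_normD (hk k s - hk k t) (hk k t - h t); rewrite subrKA (distrC (hk k t)).
  have := hk3 s; have := hk3 t; lra.
have sh t : 0 <= t <= 1 -> step h t = h t.
  move=> t01; apply/eqP; rewrite -subr_eq0 -normr_le0; apply/ler_addgt0Pr => e e0.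
  rewrite add0r; have [k Hk] := @exp2_small R (2 * a * ex t) e e0.
  have h1 : `|step h t - step (hk k) t| <= 2 * a * 2^-1 ^+ k / 2 * ex t.
    apply: (halve _ _ _ hc (hkc k) _ (hhk k) _ t01).
    by rewrite mulr_ge0// exprn_ge0// invr_ge0.
  have h2 := hhk k.+1 t; rewrite clampE// exprSr in h2.
  have E : hk k.+1 t = step (hk k) t by rewrite /hk /= /chain clampE.
  rewrite E in h2.
  have := ler_normD (step h t - step (hk k) t) (step (hk k) t - h t).
  rewrite subrKA (distrC (step (hk k) t)) => h3; apply: (le_trans h3).
  apply: le_trans (lerD h1 h2) _; apply: le_trans Hk.
  rewrite le_eqVlt; apply/orP; left; apply/eqP; by field.
exists (step h); split; first exact: step0.
by move=> t t01; rewrite [in X in is_derive _ _ _ X]sh//; exact: step_derive.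
Qed.

End Picard.

Lemma loc_lipschitz_rV (R : realType) M M' (w : 'rV[R]_M -> 'rV[R]_M') (a : 'rV[R]_M) :
  (forall i, loc_lipschitz (fun z => w z 0 i) a) ->
  exists (N : set 'rV[R]_M) (C : R), [/\ nbhs a N, 0 <= C &
    forall x y, N x -> N y -> `|w y - w x| <= C * `|y - x|].
Proof.
move=> H; have /choice[F HF] : forall i, exists NC : set 'rV[R]_M * R,
    [/\ nbhs a NC.1, 0 <= NC.2 & forall x y, NC.1 x -> NC.1 y ->
      `|w y 0 i - w x 0 i| <= NC.2 * `|y - x|].
  by move=> i; have [N [C HC]] := H i; exists (N, C).
have FF : Filter (nbhs a) by exact: nbhs_filter.
have S0 : 0 <= \sum_i (F i).2 by apply: sumr_ge0 => i _; case: (HF i).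
exists [set x | forall i, (F i).1 x], (\sum_i (F i).2); split=> //.
  by apply: (@filter_forall _ _ (fun i => (F i).1) _ FF) => i; case: (HF i).
move=> x y Nx Ny; apply: normrv_leP => [|i]; first by rewrite mulr_ge0.
rewrite !mxE; have [_ _ h] := HF i; apply: le_trans (h _ _ (Nx i) (Ny i)) _.
rewrite ler_wpM2r// (bigD1 i)//= lerDl sumr_ge0// => k _.
by case: (HF k).
Qed.

Lemma rV_continuous (R : realType) M M' (w : 'rV[R]_M -> 'rV[R]_M') (a : 'rV[R]_M) :
  (forall i, loc_lipschitz (fun z => w z 0 i) a) -> {for a, continuous w}.
Proof.
move=> /loc_lipschitz_rV[N [C [Na C0 H]]]; apply: continuous_at_rV => e e0.
have [d d0 Hd] := (nbhs_rVP _ _).1 Na.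
have C1 : 0 < C + 1 by rewrite ltr_wpDl.
exists (Num.min d (e / (C + 1))); first by rewrite lt_min d0 divr_gt0.
move=> y; rewrite lt_min => /andP[/Hd Ny]; rewrite ltr_pdivlMr// => ye.
rewrite (le_trans (H _ _ (nbhs_singleton Na) Ny))//.
by have := normr_ge0 (y - a); nra.
Qed.

(** Pairs violating the inequality with larger and larger constants accumulate
    at a pair of equal points, where the function is Lipschitz nearby. *)
Lemma compact_lipschitz (R : realType) M M' (w : 'rV[R]_M -> 'rV[R]_M')
    (C : set 'rV[R]_M) :
  compact C -> (forall a, C a -> forall i, loc_lipschitz (fun z => w z 0 i) a) ->
  exists2 L, 0 < L & forall x y, C x -> C y -> `|w y - w x| <= L * `|y - x|.
Proof.
move=> Cc wC; apply: contrapT => H.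
pose B (k : R) : set ('rV[R]_M * 'rV[R]_M) :=
  [set z | [/\ C z.1, C z.2 & k * `|z.2 - z.1| < `|w z.2 - w z.1|]].
have B0 k : 0 < k -> B k !=set0.
  move=> k0; apply: contrapT => N; apply: H; exists k => // x y Cx Cy.
  by rewrite leNgt; apply/negP => h; apply: N; exists (x, y).
have BF : ProperFilter (filter_from [set k : R | 0 < k] B).
  apply: filter_from_proper; last exact: B0.
  apply: filter_from_filter; first by exists 1; rewrite /= ltr01.
  move=> k1 k2 /= k10 k20; exists (Num.max k1 k2); first by rewrite /= lt_max k10.
  move=> z [C1 C2 h]; split; split=> //; apply: le_lt_trans h;
    by rewrite ler_wpM2r// le_max lexx ?orbT.
have [W [WU BW]] := ultraFilterLemma BF.
have WB k : 0 < k -> W (B k) by move=> k0; apply: BW; exists k.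
have WC1 : W [set z | C z.1] by apply: filterS (WB 1 ltr01) => z [].
have WC2 : W [set z | C z.2] by apply: filterS (WB 1 ltr01) => z [].
have Cu (F : set_system 'rV[R]_M) : UltraFilter F -> F C -> exists a, C a /\ F --> a.
  by move: Cc; rewrite compact_ultra => h FU FC; have [a []] := h F FU FC; exists a.
have [a [Ca ca]] := Cu _ (fmap_ultra fst) WC1.
have [b [Cb cb]] := Cu _ (fmap_ultra snd) WC2.
have wa := rV_continuous (wC _ Ca); have wb := rV_continuous (wC _ Cb).
have cwa : (fun z => w z.1) @ W --> w a by exact: (@cvg_comp _ _ _ fst w _ _ _ ca).
have cwb : (fun z => w z.2) @ W --> w b by exact: (@cvg_comp _ _ _ snd w _ _ _ cb).
have cn : (fun z => `|w z.2 - w z.1|) @ W --> `|w b - w a|.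
  by apply: cvg_norm; exact: cvgB.
have cd : (fun z => `|z.2 - z.1|) @ W --> `|b - a| by apply: cvg_norm; exact: cvgB.
have ab : b = a.
  apply/eqP; rewrite -subr_eq0 -normr_le0; apply/ler_addgt0Pr => e e0; rewrite add0r.
  pose k := (`|w b - w a| + 1) / e.
  have k0 : 0 < k by rewrite divr_gt0// ltr_wpDl.
  apply: (ultra_cvg_le cd).
  have /cvgrPdist_le/(_ _ ltr01) := cn.
  apply: filterS2 (WB _ k0) => z [_ _ h1] h2 /=.
  rewrite -(ler_pM2l k0) {2}/k divfK ?gt_eqF//.
  apply: le_trans (ltW h1) _; move: h2; rewrite ler_norml; lra.
have [N [L [Na L0 HL]]] := loc_lipschitz_rV (wC _ Ca).
rewrite ab in cb; have L1 : 0 < L + 1 by rewrite ltr_wpDl.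
have /filter_ex[z [[[_ _ h] Nz1] Nz2]] : W ((B (L + 1) `&` (fst @^-1` N)) `&` (snd @^-1` N)).
  by apply: filterI; [apply: filterI; [exact: WB | exact: ca] | exact: cb].
have := HL _ _ Nz1 Nz2; have := normr_ge0 (z.2 - z.1); nra.
Qed.

Section Flow.
Context {R : realType} {M : nat} (w : 'rV[R]_M -> 'rV[R]_M) (O : set 'rV[R]_M).
Context (Oo : open O)
  (wO : forall a, O a -> forall i, loc_lipschitz (fun z => w z 0 i) a).

Definition solves (C : set 'rV[R]_M) (T : R) (g : R -> 'rV[R]_M) :=
  forall t : R, 0 <= t <= T -> C (g t) /\ is_derive t 1 g (w (g t)).

Lemma solves_tube C (e : R) g : 0 <= e -> solves C 1 g ->
  compact [set z | exists2 t, 0 <= t <= 1 & `|z - g t| <= e].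
Proof.
move=> e0 Hg; rewrite compact_ultra => W WU WC.
have /choice[tau Htau] : forall z : 'rV[R]_M, exists t : R,
    (exists2 t, 0 <= t <= 1 & `|z - g t| <= e) -> 0 <= t <= 1 /\ `|z - g t| <= e.
  move=> z; have [[t t01 zt]|N] := pselect (exists2 t, 0 <= t <= 1 & `|z - g t| <= e).
    by exists t.
  by exists 0.
have WT : W [set z | 0 <= tau z <= 1 /\ `|z - g (tau z)| <= e].
  by apply: filterS WC => z /Htau.
have [t ct] : exists t : R, tau @ W --> t.
  apply: (@ultra_cvg_real R _ W WU tau 1); apply: filterS WT => z [/andP[t0 t1] _] /=.
  by rewrite ger0_norm.
have t01 : 0 <= t <= 1.
  apply/andP; split; last by apply: (ultra_cvg_le ct); apply: filterS WT => z [/andP[]].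
  rewrite -oppr_le0; apply: (@ultra_cvg_le R _ W WU (fun z => - tau z)).
    exact: cvgN.
  by apply: filterS WT => z [/andP[t0 _] _] /=; rewrite oppr_le0.
have [_ /is_derive_continuous gc] := Hg _ t01.
have cg : (fun z => g (tau z)) @ W --> g t by exact: (@cvg_comp _ _ _ tau g _ _ _ ct).
have [z cz] : exists z : 'rV[R]_M, (fun z => z) @ W --> z.
  apply: (@ultra_cvg_rV R _ W WU M _ (e + (`|g t| + 1))).
  have /cvgrPdist_le/(_ _ ltr01) := cg.
  apply: filterS2 WT => z [_ h1] h2 /=.
  have := ler_normD (z - g (tau z)) (g (tau z)); rewrite subrK.
  have := ler_normB (g t) (g t - g (tau z)); rewrite subKr; lra.
exists z; split=> //; exists t => //.
apply: (@ultra_cvg_le R _ W WU (fun z => `|z - g (tau z)|)).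
  by apply: cvg_norm; exact: cvgB.
by apply: filterS WT => z' [].
Qed.

Lemma tube_in_open g : solves O 1 g -> exists2 e : R, 0 < e &
  [set z | exists2 t, 0 <= t <= 1 & `|z - g t| <= e] `<=` O.
Proof.
move=> Hg; apply: contrapT => H.
pose B (e : R) : set ('rV[R]_M * R) :=
  [set z | [/\ 0 <= z.2 <= 1, `|z.1 - g z.2| <= e & ~ O z.1]].
have B0 e : 0 < e -> B e !=set0.
  move=> e0; apply: contrapT => N; apply: H; exists e => // z [t t01 zt].
  by apply: contrapT => Oz; apply: N; exists (z, t).
have BF : ProperFilter (filter_from [set e : R | 0 < e] B).
  apply: filter_from_proper; last exact: B0.
  apply: filter_from_filter; first by exists 1; rewrite /= ltr01.
  move=> k1 k2 /= k10 k20; exists (Num.min k1 k2); first by rewrite /= lt_min k10.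
  by move=> z [C1]; rewrite le_min => /andP[h1 h2] Oz; split; split.
have [W [WU BW]] := ultraFilterLemma BF.
have WB e : 0 < e -> W (B e) by move=> e0; apply: BW; exists e.
have [t ct] : exists t : R, snd @ W --> t.
  apply: (@ultra_cvg_real R _ W WU snd 1).
  apply: filterS (WB 1 ltr01) => z [/andP[t0 t1] _ _] /=.
  by rewrite ger0_norm.
have t01 : 0 <= t <= 1.
  apply/andP; split; last first.
    by apply: (ultra_cvg_le ct); apply: filterS (WB 1 ltr01) => z [/andP[]].
  rewrite -oppr_le0; apply: (@ultra_cvg_le R _ W WU (fun z => - z.2)).
    exact: cvgN.
  by apply: filterS (WB 1 ltr01) => z [/andP[t0 _] _ _] /=; rewrite oppr_le0.
have [Ogt /is_derive_continuous gc] := Hg _ t01.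
have cg : (fun z => g z.2) @ W --> g t by exact: (@cvg_comp _ _ _ snd g _ _ _ ct).
have cz : fst @ W --> g t.
  apply/cvgrPdist_le => e e0; have e2 : 0 < e / 2 by rewrite divr_gt0.
  have /cvgrPdist_le/(_ _ e2) := cg.
  apply: filterS2 (WB _ e2) => z [_ h1 _] h2.
  have := ler_normD (g t - g z.2) (g z.2 - z.1); rewrite subrKA (distrC (g z.2)).
  lra.
have /filter_ex[z [[_ _ Nz]]] : W (B 1 `&` (fst @^-1` O)).
  by apply: filterI; [exact: WB | apply: cz; exact: open_nbhs_nbhs].
by apply: Nz.
Qed.

(** In a compact tube around the trajectory the field can be replaced by a
    Lipschitz field on the whole space, whose solutions exist and, by Gronwall's
    inequality, stay in the tube if they start close enough. *)
Lemma flow_stable g e : solves O 1 g -> 0 < e ->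
  exists2 d, 0 < d & forall z, `|z - g 0| < d ->
    exists g', [/\ g' 0 = z, solves O 1 g' & `|g' 1 - g 1| < e].
Proof.
move=> Hg e0; have [e1 e10 CO] := tube_in_open Hg.
pose C := [set z | exists2 t, 0 <= t <= 1 & `|z - g t| <= e1].
have Cc : compact C := solves_tube (ltW e10) Hg.
have [L L0 HL] := compact_lipschitz Cc (fun a Ca => wO (CO _ Ca)).
have [w' [w'L w'E]] := lipschitz_extension_rV (ltW L0) HL.
have gC (t : R) : 0 <= t <= 1 -> C (g t).
  by move=> t01; exists t => //; rewrite subrr normr0 ltW.
pose K := M%:R * expR (2 * M%:R * L * 1) + 1.
have K0 : 0 < K by rewrite ltr_wpDl// mulr_ge0// expR_ge0.
pose m := Num.min e1 (e / 2).
have m0 : 0 < m by rewrite lt_min e10 divr_gt0.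
exists (Num.min 1 (m ^+ 2 / K)); first by rewrite lt_min ltr01 divr_gt0// exprn_gt0.
move=> z; rewrite lt_min => /andP[z1]; rewrite ltr_pdivlMr// => zm.
have [g' [g'0 Hg']] := @picard R M w' L z L0 w'L.
have close (t : R) : 0 <= t <= 1 -> `|g' t - g t| <= m.
  move=> /[dup] t01 /andP[t0 t1].
  have := @gronwall R M w' setT L 1 g g' (ltW L0) (fun x y _ _ => w'L x y) _ _ t t01.
  move=> h; have {}h : `|g' t - g t| ^+ 2 <=
      M%:R * expR (2 * M%:R * L * t) * `|g' 0 - g 0| ^+ 2.
    apply: h => s s01; split=> //; last exact: Hg'.
    by rewrite w'E; [case: (Hg s s01) | exact: gC].
  rewrite -(@ler_pXn2r _ 2) ?nnegrE ?(ltW m0)//; apply: le_trans h _.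
  apply: le_trans (ltW zm); rewrite g'0 expr2 mulrC.
  apply: ler_pM; rewrite ?mulr_ge0 ?expR_ge0//; first by rewrite ler_piMl// ltW.
  rewrite /K ler_wpDr// ler_wpM2l// ler_expR ler_wpM2l ?mulr_ge0//.
  exact: ltW.
have g'C (t : R) : 0 <= t <= 1 -> C (g' t).
  move=> t01; exists t => //; apply: le_trans (close _ t01) _.
  by rewrite ge_min lexx.
exists g'; split=> // [t t01|].
  by rewrite -w'E; [split; [exact/CO/g'C | exact: Hg'] | exact: g'C].
have : `|g' 1 - g 1| <= m by apply: close; rewrite ler01 lexx.
move=> h; apply: le_lt_trans h _; rewrite gt_min; apply/orP; right.
by rewrite ltr_pdivrMr// ltr_pMr// ltr1n.
Qed.

Lemma flow_unique g1 g2 : solves O 1 g1 -> solves O 1 g2 -> g1 0 = g2 0 -> g1 1 = g2 1.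
Proof.
move=> H1 H2 g12.
pose C (g : R -> 'rV[R]_M) := [set z | exists2 t, 0 <= t <= 1 & `|z - g t| <= 0].
have Cc : compact (C g1 `|` C g2) by apply: compactU; apply: (@solves_tube O).
have CO a : (C g1 `|` C g2) a -> O a.
  by move=> [] [t t01]; rewrite normr_le0 subr_eq0 => /eqP->;
    [case: (H1 _ t01) | case: (H2 _ t01)].
have [L L0 HL] := compact_lipschitz Cc (fun a Ca => wO (CO _ Ca)).
have i1 : 0 <= (1 : R) <= 1 by rewrite ler01 lexx.
have := @gronwall R M w (C g1 `|` C g2) L 1 g1 g2 (ltW L0) HL _ _ 1 i1.
rewrite g12 subrr normr0 expr0n mulr0 => h.
apply/esym/eqP; rewrite -subr_eq0 -normr_le0.
rewrite -(@ler_pXn2r _ 2) ?nnegrE// expr0n /=; apply: h => t t01.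
  split; last by case: (H1 _ t01).
  by left; exists t => //; rewrite subrr normr0.
split; last by case: (H2 _ t01).
by right; exists t => //; rewrite subrr normr0.
Qed.

(** A solution that stays inside a compact set as long as it has not left it
    exists for all times. *)
Lemma flow_exists C z : compact C -> C `<=` O -> C z ->
  (forall T g, 0 <= T <= 1 -> g 0 = z -> solves C T g -> nbhs (g T) C) ->
  exists2 g, g 0 = z & solves C 1 g.
Proof.
move=> Cc CO Cz H.
have [L L0 HL] := compact_lipschitz Cc (fun a Ca => wO (CO _ Ca)).
have [w' [w'L w'E]] := lipschitz_extension_rV (ltW L0) HL.
have [g [g0 Hg]] := @picard R M w' L z L0 w'L.
have Ccl : closed C by apply: compact_closed => //; exact: norm_hausdorff.
pose S := [set T : R | 0 <= T <= 1 /\ forall t : R, 0 <= t <= T -> C (g t)].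
have S0 : S 0.
  split; first by rewrite lexx ler01.
  by move=> t /andP[t0 t1]; rewrite (_ : t = 0) ?g0//; apply/eqP; rewrite eq_le t0 t1.
have Ssup : has_sup S by split; [exists 0 | exists 1 => T [/andP[]]].
pose T := sup S.
have T0 : 0 <= T by apply: ub_le_sup => //; case: Ssup.
have T1 : T <= 1 by apply: ge_sup; [exists 0 | move=> t [/andP[]]].
have below (t : R) : 0 <= t -> t < T -> C (g t).
  move=> t0 tT; have [s [_ sS] ts] := sup_adherent (etrans (subr_gt0 _ _) tT) Ssup.
  by apply: sS; rewrite t0 /= ltW//; move: ts; rewrite subKr.
have gcont (t : R) : 0 <= t <= 1 -> {for t, continuous g}.
  by move=> t01; exact: is_derive_continuous (Hg _ t01).
have CT : C (g T).
  have [T00|T00] := eqVneq T 0; first by rewrite T00 g0.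
  have Tgt : 0 < T by rewrite lt_neqAle eq_sym T00.
  apply: Ccl => N /(gcont T (introT andP (conj T0 T1))) NT.
  have [d /= d0 Hd] := (nbhs_ballP _ _).1 NT.
  pose t := T - Num.min (d / 2) (T / 2).
  have m0 : 0 < Num.min (d / 2) (T / 2) by rewrite lt_min !divr_gt0.
  have m1 : Num.min (d / 2) (T / 2) <= d / 2 by rewrite ge_min lexx.
  have m2 : Num.min (d / 2) (T / 2) <= T / 2 by rewrite ge_min lexx orbT.
  exists (g t); split; first by apply: below; rewrite /t; lra.
  by apply: Hd; rewrite -ball_normE /ball_ /= /t subKr gtr0_norm//; lra.
have solT : solves C T g.
  move=> t /andP[t0 tT]; have [tT'|tT'] := eqVneq t T; last first.
    have Ct : C (g t) by apply: below => //; rewrite lt_neqAle tT'.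
    by rewrite -w'E//; split=> //; apply: Hg; rewrite t0 (le_trans tT).
  by rewrite tT' -w'E//; split=> //; apply: Hg; rewrite T0.
have intT := H T g (introT andP (conj T0 T1)) g0 solT.
have TE : T = 1.
  apply/eqP; rewrite eq_le T1 leNgt; apply/negP => Tlt.
  have [d /= d0 Hd] := (nbhs_ballP _ _).1 (gcont T (introT andP (conj T0 T1)) _ intT).
  pose m := Num.min (d / 2) (1 - T).
  have m0 : 0 < m by rewrite lt_min divr_gt0// subr_gt0.
  have m1 : m <= d / 2 by rewrite ge_min lexx.
  have m2 : m <= 1 - T by rewrite ge_min lexx orbT.
  suff : S (T + m).
    by move=> /(ub_le_sup (proj2 Ssup)); rewrite -/T; lra.
  split; first by apply/andP; split; lra.
  move=> t /andP[t0 tm]; have [tT|tT] := ltP t T; first exact: below.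
  apply: Hd; rewrite -ball_normE /ball_ /= distrC ger0_norm ?subr_ge0//.
  lra.
by exists g => //; rewrite -TE.
Qed.

End Flow.

(** * The transporting vector field *)

Section Triples.
Context {R : realType} {A B : nat}.
Implicit Types (x : 'rV[R]_A) (e u : 'rV[R]_B) (z : 'rV[R]_(A + (B + B))).

(** A point, a parameter and the velocity of the parameter; the latter is
    constant along the flow, and carrying it along makes the equation autonomous. *)
Definition triple x e u : 'rV[R]_(A + (B + B)) := row_mx x (row_mx e u).
Definition px : 'M[R]_(A + (B + B), A) := col_mx 1%:M 0.
Definition pe : 'M[R]_(A + (B + B), B) := col_mx 0 (col_mx 1%:M 0).
Definition pu : 'M[R]_(A + (B + B), B) := col_mx 0 (col_mx 0 1%:M).

Lemma triple_px x e u : triple x e u *m px = x.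
Proof. by rewrite mul_row_col mulmx1 mulmx0 addr0. Qed.

Lemma triple_pe x e u : triple x e u *m pe = e.
Proof. by rewrite !mul_row_col mulmx1 !mulmx0 add0r addr0. Qed.

Lemma triple_pu x e u : triple x e u *m pu = u.
Proof. by rewrite !mul_row_col mulmx1 !mulmx0 !add0r. Qed.

Lemma triple_eta z : triple (z *m px) (z *m pe) (z *m pu) = z.
Proof.
by rewrite -[z]hsubmxK -[rsubmx z]hsubmxK triple_px triple_pe triple_pu.
Qed.

Lemma dot_trmul m (a : 'rV[R]_m) (P : 'M[R]_(A + (B + B), m)) z :
  dot (a *m P^T) z = dot a (z *m P).
Proof. by rewrite !dot_mulmx trmx_mul mulmxA. Qed.

Lemma norm_triple x e u c : `|x| <= c -> `|e| <= c -> `|u| <= c -> `|triple x e u| <= c.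
Proof.
move=> xc ec uc; apply: normrv_leP => [|i]; first exact: le_trans (normr_ge0 _) xc.
rewrite /triple -(splitK i); case: (fintype.split i) => j /=.
  by rewrite row_mxEl (le_trans (normrv_le _ _)).
rewrite row_mxEr -(splitK j); case: (fintype.split j) => k /=.
  by rewrite row_mxEl (le_trans (normrv_le _ _)).
by rewrite row_mxEr (le_trans (normrv_le _ _)).
Qed.

Lemma norm_px z : `|z *m px| <= `|z|.
Proof.
rewrite -[z]triple_eta triple_px; apply: normrv_leP => // i.
apply: le_trans (normrv_le _ (lshift _ i)).
by rewrite /triple row_mxEl.
Qed.

Lemma tripleB x e u x' e' u' :
  triple x e u - triple x' e' u' = triple (x - x') (e - e') (u - u').
Proof. by rewrite /triple opp_row_mx add_row_mx opp_row_mx add_row_mx. Qed.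

End Triples.

Section Field.
Context {R : realType} {K : ground} {n p N : nat} (F : kfamily R K n p).
Context (GC : 'I_p -> bmultinom (kdim K n) N -> 'I_(kdim K 1) ->
  kspace R K 1 -> kspace R K 1).
Context (U : set (kspace R K n)) (rho : kspace R K n -> R)
  (Grho : kspace R K n -> kspace R K n).
Context (FN : forall e, degree_lt N (F e))
  (GCP : forall j m q e, c11 (fun e => coeffs N (F e) j m q) (GC j m q) e)
  (rhoP : forall a, U a -> c11 rho Grho a) (Uo : open U).

Local Notation Z := 'rV[R]_(kdim K n + (kdim K 1 + kdim K 1)).
Implicit Types (x : kspace R K n) (e u : kspace R K 1) (z : Z).

Definition phi (i : 'I_(kdim K p)) x e : R := eval_map (F e) x 0 i.

Definition Jx x e : 'M[R]_(kdim K n, kdim K p) := jac_map (coeffs N (F e)) x.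

Definition Je x e : 'M[R]_(kdim K 1, kdim K p) :=
  \matrix_(l, i) \sum_(m : bmultinom (kdim K n) N) \sum_q
    mu i (bmnm m) q x * GC (kidx i) m q e 0 l.

Definition grad_phi i z : Z := \sum_(m : bmultinom (kdim K n) N) \sum_q
  (coeffs N (F (z *m pe)) (kidx i) m q *: (grad_mu i (bmnm m) q (z *m px) *m px^T) +
   mu i (bmnm m) q (z *m px) *: (GC (kidx i) m q (z *m pe) *m pe^T)).

Lemma phi_c11 i z : c11 (fun z => phi i (z *m px) (z *m pe)) (grad_phi i) z.
Proof.
rewrite (_ : (fun z => _) = fun z : Z => \sum_(m : bmultinom (kdim K n) N) \sum_q
    coeffs N (F (z *m pe)) (kidx i) m q * mu i (bmnm m) q (z *m px)); last first.
  by apply/funext => y; rewrite /phi (eval_mapE _ _ (@FN _)).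
apply: c11_sum => m; apply: c11_sum => q; apply: c11M.
  apply: (@c11_comp_lin _ _ _ pe (fun e => coeffs N (F e) (kidx i) m q)); exact: GCP.
by apply: c11_comp_lin; exact: grad_muP.
Qed.

Lemma dot_grad_phi i z y : dot (grad_phi i z) y =
  (y *m px *m Jx (z *m px) (z *m pe)) 0 i + (y *m pe *m Je (z *m px) (z *m pe)) 0 i.
Proof.
have HJ m1 (a : 'rV[R]_m1) (C : 'M[R]_(m1, kdim K p)) :
    (a *m C) 0 i = dot (\row_l C l i) a.
  by rewrite mxE; apply: eq_bigr => l _; rewrite mxE mulrC.
rewrite !HJ.
have -> : \row_l Jx (z *m px) (z *m pe) l i =
    \sum_(m : bmultinom (kdim K n) N) \sum_q coeffs N (F (z *m pe)) (kidx i) m q *: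
      grad_mu i (bmnm m) q (z *m px).
  by apply/rowP => l; rewrite !mxE.
have -> : \row_l Je (z *m px) (z *m pe) l i =
    \sum_(m : bmultinom (kdim K n) N) \sum_q mu i (bmnm m) q (z *m px) *:
      GC (kidx i) m q (z *m pe).
  apply/rowP => l; rewrite !mxE summxE; apply: eq_bigr => m _.
  by rewrite summxE; apply: eq_bigr => q _; rewrite mxE.
rewrite (dotC (grad_phi i z)) (dotC _ (y *m px)) (dotC _ (y *m pe)).
rewrite /grad_phi !dot_sumr -big_split /=; apply: eq_bigr => m _.
rewrite !dot_sumr -big_split /=.
apply: eq_bigr => q _; rewrite dotDr !dotZr !(dotC y) !dot_trmul.
by rewrite !(dotC (y *m _)).
Qed.

Definition Amat x e : 'M[R]_(kdim K n, kdim K p + 1) := row_mx (Jx x e) (Grho x)^T.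

Definition sq x e : R := \sum_i phi i x e ^+ 2.

Definition Emat : 'M[R]_(kdim K p + 1) :=
  delta_mx (rshift (kdim K p) ord0) (rshift (kdim K p) ord0).

(** The Gram matrix of the differentials of the components and of [rho]; where
    the value is not zero, the added term keeps it definite even if the
    differential of [rho] depends on the other ones. *)
Definition Mmat x e : 'M[R]_(kdim K p + 1) :=
  (Amat x e)^T *m Amat x e + sq x e *: Emat.

(** The solution of the system with matrix [Mmat], by Cramer's rule. *)
Definition multiplier x e u : 'rV[R]_(kdim K p + 1) :=
  (\det (Mmat x e))^-1 *: (row_mx (u *m Je x e) 0 *m \adj (Mmat x e)).

Definition vfield x e u : kspace R K n := - (multiplier x e u *m (Amat x e)^T).

Definition last_multiplier x e u : R := multiplier x e u 0 (rshift (kdim K p) ord0).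

Definition wfield z : Z :=
  triple (vfield (z *m px) (z *m pe) (z *m pu)) (z *m pu) 0.

Definition regular : set Z :=
  [set z | [/\ U (z *m px), z *m px != 0 & \det (Mmat (z *m px) (z *m pe)) != 0]].

Lemma EmatE k l :
  Emat k l = ((k == rshift (kdim K p) ord0) && (l == rshift (kdim K p) ord0))%:R.
Proof. exact: mxE. Qed.

(** The field cancels the effect of the moving parameter on the components, and
    it changes [rho] only where the value of the map is not zero. *)
Lemma vfield_Amat x e u : \det (Mmat x e) != 0 ->
  vfield x e u *m Amat x e =
  row_mx (- (u *m Je x e)) (sq x e * last_multiplier x e u)%:M.
Proof.
move=> dM; set b := row_mx (u *m Je x e) (0 : 'rV[R]_1).
have mM : multiplier x e u *m Mmat x e = b.
  rewrite /multiplier -scalemxAl -mulmxA mul_adj_mx mul_mx_scalar.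
  by rewrite scalerA mulVf// scale1r.
have AA : (Amat x e)^T *m Amat x e = Mmat x e - sq x e *: Emat by rewrite addrK.
rewrite mulNmx -mulmxA AA mulmxBr mM opprB addrC.
rewrite -scalemxAr /b opp_row_mx oppr0.
have -> : multiplier x e u *m Emat = row_mx 0 (last_multiplier x e u)%:M.
  apply/rowP => k; rewrite mxE -(splitK k); case: (fintype.split k) => j /=.
    rewrite row_mxEl [RHS]mxE big1// => l _; rewrite EmatE andbC.
    by rewrite eq_lrshift mulr0.
  rewrite row_mxEr ord1 [RHS]mxE eqxx mulr1n (bigD1 (rshift _ ord0))//= EmatE !eqxx mulr1.
  by rewrite big1 ?addr0// => l ll; rewrite EmatE (negbTE ll) mulr0.
by rewrite scale_row_mx scaler0 add_row_mx addr0 add0r scale_scalar_mx.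
Qed.

Lemma vfield_Jx x e u : \det (Mmat x e) != 0 ->
  vfield x e u *m Jx x e = - (u *m Je x e).
Proof. by move=> /(vfield_Amat u); rewrite mul_mx_row => /eq_row_mx[]. Qed.

Lemma vfield_rho x e u : \det (Mmat x e) != 0 ->
  dot (Grho x) (vfield x e u) = sq x e * last_multiplier x e u.
Proof.
move=> /(vfield_Amat u); rewrite mul_mx_row => /eq_row_mx[_ /matrixP/(_ 0 0)].
by rewrite [RHS]mxE eqxx mulr1n dotC dot_mulmx.
Qed.

(** On a vector [xi] the quadratic form of the matrix is the sum of the squared
    norm of [xi *m A^T], where [A] is [Amat], and of [sq] times the square of the
    last entry.  If [sq] is not zero, the last entry of a null vector vanishes,
    and the independence of the components suffices. *)
Lemma Mmat_det x e :
  (\rank (Jx x e) = kdim K p)%N ->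
  (eval_map (F e) x = 0 -> \rank (Amat x e) = (kdim K p).+1) ->
  \det (Mmat x e) != 0.
Proof.
move=> rJ rA; apply/negP => /det0P[xi xi0 xiM].
have sq0 : 0 <= sq x e by apply: sumr_ge0 => i _; exact: sqr_ge0.
pose y := xi *m (Amat x e)^T.
have E : dot y y + sq x e * xi 0 (rshift _ ord0) ^+ 2 = 0.
  have E1 : dot y y = dot (xi *m ((Amat x e)^T *m Amat x e)) xi.
    by rewrite !dot_mulmx /y trmx_mul trmxK !mulmxA.
  have E2 : xi *m Emat = xi 0 (rshift _ ord0) *: delta_mx 0 (rshift _ ord0).
    apply/rowP => k; rewrite !mxE (bigD1 (rshift _ ord0))//= big1 ?addr0.
      by rewrite EmatE eqxx.
    by move=> l ll; rewrite EmatE (negbTE ll) mulr0.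
  have E3 : xi 0 (rshift _ ord0) ^+ 2 = dot (xi *m Emat) xi.
    by rewrite E2 dotZl dotC dot_deltar expr2.
  by rewrite E1 E3 -dotZl scalemxAr -dotDl -mulmxDr xiM dot0l.
have yy : 0 <= dot y y by apply: sumr_ge0 => i _; rewrite -expr2 sqr_ge0.
have y0 : y = 0.
  have d0 : dot y y = 0 by have := mulr_ge0 sq0 (sqr_ge0 (xi 0 (rshift _ ord0))); lra.
  apply/rowP => i; rewrite [RHS]mxE.
  have ge0 k : true -> 0 <= y 0 k * y 0 k by rewrite -expr2 sqr_ge0.
  by have /eqP := psumr_eq0P ge0 d0 (i := i) isT; rewrite mulf_eq0 orbb => /eqP.
have inj a b (B : 'M[R]_(a, b)) (c : 'rV[R]_b) : (\rank B = b)%N -> c *m B^T = 0 -> c = 0.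
  move=> rB cB; have /row_freeP[B' BB'] : row_free B^T by rewrite /row_free mxrank_tr rB.
  by rewrite -(mulmx1 c) -BB' mulmxA cB mul0mx.
have [s0|s0] := eqVneq (sq x e) 0.
  have phi0 i : phi i x e = 0.
    have ge0 k : true -> 0 <= phi k x e ^+ 2 by rewrite sqr_ge0.
    by have /eqP := psumr_eq0P ge0 s0 (i := i) isT; rewrite sqrf_eq0 => /eqP.
  have F0 : eval_map (F e) x = 0 by apply/rowP => i; rewrite mxE; exact: phi0.
  by move/eqP: xi0; apply; apply: (inj _ _ (Amat x e)); rewrite ?rA ?addn1.
have xl : xi 0 (rshift _ ord0) = 0.
  apply/eqP; rewrite -sqrf_eq0; have := mulr_ge0 sq0 (sqr_ge0 (xi 0 (rshift _ ord0))).
  move=> h; have /eqP : sq x e * xi 0 (rshift _ ord0) ^+ 2 = 0 by lra.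
  by rewrite mulf_eq0 (negbTE s0).
have xr : rsubmx xi = 0 by apply/rowP => i; rewrite ord1 !mxE.
have xl0 : lsubmx xi = 0.
  apply: (inj _ _ (Jx x e)) => //; move: y0; rewrite /y -[xi in xi *m _]hsubmxK xr.
  by rewrite /Amat tr_row_mx mul_row_col mul0mx addr0.
by move/eqP: xi0; apply; rewrite -[xi]hsubmxK xr xl0 row_mx0.
Qed.

Lemma phi_lip i z : loc_lipschitz (fun z : Z => phi i (z *m px) (z *m pe)) z.
Proof. exact: c11_loc_lipschitz (phi_c11 i z). Qed.

Lemma sq_lip z : loc_lipschitz (fun z : Z => sq (z *m px) (z *m pe)) z.
Proof.
rewrite (_ : (fun z => _) = fun z : Z => \sum_i
    phi i (z *m px) (z *m pe) * phi i (z *m px) (z *m pe)).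
  by apply: loc_lipschitz_sum => i; apply: loc_lipschitzM; exact: phi_lip.
by apply/funext => y; apply: eq_bigr => i _; rewrite expr2.
Qed.

Lemma Jx_lip z l i : loc_lipschitz (fun z : Z => Jx (z *m px) (z *m pe) l i) z.
Proof.
rewrite (_ : (fun z => _) = fun z : Z => \sum_(m : bmultinom (kdim K n) N) \sum_q
    coeffs N (F (z *m pe)) (kidx i) m q * grad_mu i (bmnm m) q (z *m px) 0 l).
  apply: loc_lipschitz_sum => m; apply: loc_lipschitz_sum => q; apply: loc_lipschitzM.
    apply: (@loc_lipschitz_comp_lin _ _ _ pe (fun e => coeffs N (F e) (kidx i) m q)).
    exact: c11_loc_lipschitz (GCP _ _ _ _).
  apply: (@loc_lipschitz_comp_lin _ _ _ px (fun x => grad_mu i (bmnm m) q x 0 l)).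
  by case: (grad_muP i (bmnm m) q (z *m px)).
apply/funext => y; rewrite mxE summxE; apply: eq_bigr => m _.
by rewrite summxE; apply: eq_bigr => q _; rewrite mxE.
Qed.

Lemma Je_lip z l i : loc_lipschitz (fun z : Z => Je (z *m px) (z *m pe) l i) z.
Proof.
rewrite (_ : (fun z => _) = fun z : Z => \sum_(m : bmultinom (kdim K n) N) \sum_q
    mu i (bmnm m) q (z *m px) * GC (kidx i) m q (z *m pe) 0 l); last first.
  by apply/funext => y; rewrite mxE.
apply: loc_lipschitz_sum => m; apply: loc_lipschitz_sum => q; apply: loc_lipschitzM.
  apply: (@loc_lipschitz_comp_lin _ _ _ px (mu i (bmnm m) q)).
  exact: c11_loc_lipschitz (grad_muP _ _ _ _).
apply: (@loc_lipschitz_comp_lin _ _ _ pe (fun e => GC (kidx i) m q e 0 l)).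
by case: (GCP (kidx i) m q (z *m pe)).
Qed.

Lemma Amat_lip z l i : U (z *m px) ->
  loc_lipschitz (fun z : Z => Amat (z *m px) (z *m pe) l i) z.
Proof.
move=> Uz; rewrite /Amat -(splitK i); case: (fintype.split i) => j /=.
  apply: (loc_lipschitz_ext _ (Jx_lip z l j)) => y.
  by rewrite row_mxEl.
apply: (@loc_lipschitz_ext _ _ (fun z : Z => Grho (z *m px) 0 l)) => [y|].
  by rewrite row_mxEr mxE ord1.
apply: (@loc_lipschitz_comp_lin _ _ _ px (fun x => Grho x 0 l)).
by case: (rhoP Uz).
Qed.

Lemma Mmat_lip z k l : U (z *m px) ->
  loc_lipschitz (fun z : Z => Mmat (z *m px) (z *m pe) k l) z.
Proof.
move=> Uz; rewrite (_ : (fun z => _) = fun z : Z =>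
    ((Amat (z *m px) (z *m pe))^T *m Amat (z *m px) (z *m pe)) k l +
    sq (z *m px) (z *m pe) * Emat k l); last first.
  by apply/funext => y; rewrite mxE; congr (_ + _); rewrite mxE.
apply: loc_lipschitzD.
  apply: (@loc_lipschitz_mulmx _ _ _ _ _ (fun z : Z => (Amat (z *m px) (z *m pe))^T)
    (fun z : Z => Amat (z *m px) (z *m pe))) => i j; last exact: Amat_lip.
  by apply: (loc_lipschitz_ext _ (Amat_lip j i Uz)) => y; rewrite [RHS]mxE.
by apply: loc_lipschitzM; [exact: sq_lip | exact: loc_lipschitz_cst].
Qed.

Lemma multiplier_lip z k : regular z ->
  loc_lipschitz (fun z : Z => multiplier (z *m px) (z *m pe) (z *m pu) 0 k) z.
Proof.
move=> [Uz _ dz]; apply: (@loc_lipschitz_ext _ _ (fun z : Z =>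
    (\det (Mmat (z *m px) (z *m pe)))^-1 *
    (row_mx (z *m pu *m Je (z *m px) (z *m pe)) (0 : 'rV[R]_1) *m
     \adj (Mmat (z *m px) (z *m pe))) 0 k)) => [y|]; first by rewrite [RHS]mxE.
apply: loc_lipschitzM.
  by apply: loc_lipschitzV => //; apply: loc_lipschitz_det => i j; exact: Mmat_lip.
apply: (@loc_lipschitz_mulmx _ _ _ _ _ (fun z : Z =>
    row_mx (z *m pu *m Je (z *m px) (z *m pe)) (0 : 'rV[R]_1))
    (fun z : Z => \adj (Mmat (z *m px) (z *m pe)))) => i j; last first.
  by apply: loc_lipschitz_adj => i' j'; exact: Mmat_lip.
rewrite ord1 -(splitK j); case: (fintype.split j) => l /=.
  apply: (@loc_lipschitz_ext _ _ (fun z : Z =>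
    (z *m pu *m Je (z *m px) (z *m pe)) 0 l)) => [y|]; first by rewrite row_mxEl.
  apply: (@loc_lipschitz_mulmx _ _ _ _ _ (fun z : Z => z *m pu)
    (fun z : Z => Je (z *m px) (z *m pe))) => i' j'; last exact: Je_lip.
  rewrite ord1.
  apply: (@loc_lipschitz_comp_lin _ _ _ pu (fun u => u 0 j')).
  exact: loc_lipschitz_coord.
apply: (loc_lipschitz_ext _ (loc_lipschitz_cst 0 z)) => y.
by rewrite row_mxEr mxE.
Qed.

Lemma wfield_lip z i : regular z -> loc_lipschitz (fun z => wfield z 0 i) z.
Proof.
move=> Oz; rewrite /wfield /triple -(splitK i); case: (fintype.split i) => j /=.
  apply: (@loc_lipschitz_ext _ _ (fun z : Z => - (multiplier (z *m px) (z *m pe)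
    (z *m pu) *m (Amat (z *m px) (z *m pe))^T) 0 j)) => [y|].
    by rewrite row_mxEl [RHS]mxE.
  apply: loc_lipschitzN; apply: (@loc_lipschitz_mulmx _ _ _ _ _ (fun z : Z =>
    multiplier (z *m px) (z *m pe) (z *m pu))
    (fun z : Z => (Amat (z *m px) (z *m pe))^T)) => k l.
    by rewrite ord1; exact: multiplier_lip.
  apply: (loc_lipschitz_ext _ (Amat_lip l k (let: And3 Uz _ _ := Oz in Uz))) => y.
  by rewrite [RHS]mxE.
rewrite -(splitK j); case: (fintype.split j) => k /=.
  apply: (@loc_lipschitz_ext _ _ (fun z : Z => (z *m pu) 0 k)) => [y|].
    by rewrite row_mxEr row_mxEl.
  apply: (@loc_lipschitz_comp_lin _ _ _ pu (fun u => u 0 k)).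
  exact: loc_lipschitz_coord.
apply: (loc_lipschitz_ext _ (loc_lipschitz_cst 0 z)) => y.
by rewrite row_mxEr row_mxEr mxE.
Qed.

Lemma regular_open : open regular.
Proof.
rewrite openE => z [Uz z0 dz].
have FF : Filter (nbhs z) by exact: nbhs_filter.
have pc : {for z, continuous (fun z : Z => z *m px)} by exact: mulmx_continuous.
have n1 : nbhs z [set z | U (z *m px)] by apply: pc; exact: open_nbhs_nbhs.
have n2 : nbhs z [set z | z *m px != 0].
  have : nbhs (z *m px) [set x | x != 0].
    apply/nbhs_rVP; exists `|z *m px|; first by rewrite normr_gt0.
    by move=> y yd; apply/eqP => y0; move: yd; rewrite y0 sub0r normrN ltxx.
  exact: pc.
have n3 : nbhs z [set z | \det (Mmat (z *m px) (z *m pe)) != 0].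
  have dc : {for z, continuous (fun z : Z => \det (Mmat (z *m px) (z *m pe)))}.
    apply: loc_lipschitz_continuous; apply: loc_lipschitz_det => i j.
    exact: Mmat_lip.
  have : nbhs (\det (Mmat (z *m px) (z *m pe))) [set t : R | t != 0].
    by apply: open_nbhs_nbhs; split=> //; exact: open_neq.
  exact: dc.
move: (@filterI _ _ FF _ _ n1 (@filterI _ _ FF _ _ n2 n3)).
by apply: (@filterS _ _ FF) => y [h1 [h2 h3]].
Qed.

End Field.

(** * Points joined by a trajectory *)

Lemma is_derive_mulmx (R : realType) M M' (B : 'M[R]_(M, M')) (g : R -> 'rV[R]_M) v (t : R) :
  is_derive t 1 g v -> is_derive t 1 (fun s => g s *m B) (v *m B).
Proof.
move=> dg; apply: is_derive_rV => i.
have E (a : 'rV[R]_M) : (a *m B) 0 i = dot (\row_l B l i) a.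
  by rewrite mxE; apply: eq_bigr => l _; rewrite mxE mulrC.
rewrite E (_ : (fun s => _) = fun s => dot (\row_l B l i) (g s)).
  exact: is_derive_comp_c11 dg (c11_dot _ _).
by apply/funext => s; rewrite E.
Qed.

Lemma is_derive_reverse (R : realType) M (g : R -> 'rV[R]_M) v (t : R) :
  is_derive (1 - t) 1 g v -> is_derive t 1 (fun s => g (1 - s)) (- v).
Proof.
move=> dg; apply: is_derive_rV => i; rewrite mxE -mulN1r mulrC.
have d1 : is_derive t 1 (fun s : R => 1 - s) (- 1).
  have := is_deriveB (is_derive_cst (1 : R) t 1) (is_derive_id t 1).
  by rewrite sub0r.
exact: (@is_derive1_comp R (fun s => g s 0 i) (fun s => 1 - s) t _ _
  (is_derive_coord i dg) d1).
Qed.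

Lemma is_derive_triple (R : realType) A B (x : R -> 'rV[R]_A) (e u : R -> 'rV[R]_B)
    x' e' u' (t : R) :
  is_derive t 1 x x' -> is_derive t 1 e e' -> is_derive t 1 u u' ->
  is_derive t 1 (fun s => triple (x s) (e s) (u s)) (triple x' e' u').
Proof.
move=> dx de du; apply: is_derive_rV => i; rewrite /triple -(splitK i).
case: (fintype.split i) => j /=.
  rewrite row_mxEl (_ : (fun s => _) = fun s => x s 0 j); first exact: is_derive_coord.
  by apply/funext => s; rewrite row_mxEl.
rewrite row_mxEr -(splitK j); case: (fintype.split j) => k /=.
  rewrite row_mxEl (_ : (fun s => _) = fun s => e s 0 k); first exact: is_derive_coord.
  by apply/funext => s; rewrite row_mxEr row_mxEl.
rewrite row_mxEr (_ : (fun s => _) = fun s => u s 0 k); first exact: is_derive_coord.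
by apply/funext => s; rewrite row_mxEr row_mxEr.
Qed.

Lemma deriv0_constant (R : realType) (phi : R -> R) (T : R) :
  (forall t : R, 0 <= t <= T -> is_derive t 1 phi 0) ->
  forall t : R, 0 <= t <= T -> phi t = phi 0.
Proof.
move=> dp t tT.
have h : `|phi t - phi 0| <= 0.
  rewrite -[leRHS](subrr 0); apply: (@deriv_compare R phi (fun=> 0) (fun=> 0) (fun=> 0) T) => // s _.
  by rewrite normr0.
by apply/eqP; rewrite -subr_eq0 -normr_le0.
Qed.

Lemma deriv0_constant_rV (R : realType) M (g : R -> 'rV[R]_M) (T : R) :
  (forall t : R, 0 <= t <= T -> is_derive t 1 g 0) ->
  forall t : R, 0 <= t <= T -> g t = g 0.
Proof.
move=> dg t tT; apply/rowP => i; apply: (@deriv0_constant R (fun s => g s 0 i) T) => // s sT.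
by have := is_derive_coord i (dg s sT); rewrite mxE.
Qed.

Section Connection.
Context {R : realType} {K : ground} {n p N : nat} (F : kfamily R K n p).
Context (GC : 'I_p -> bmultinom (kdim K n) N -> 'I_(kdim K 1) ->
  kspace R K 1 -> kspace R K 1).
Context (U : set (kspace R K n)) (rho : kspace R K n -> R)
  (Grho : kspace R K n -> kspace R K n).
Context (FN : forall e, degree_lt N (F e))
  (GCP : forall j m q e, c11 (fun e => coeffs N (F e) j m q) (GC j m q) e)
  (rhoP : forall a, U a -> c11 rho Grho a) (Uo : open U).

Local Notation Z := 'rV[R]_(kdim K n + (kdim K 1 + kdim K 1)).
Implicit Types (x y : kspace R K n) (a b e u : kspace R K 1) (z : Z).

Local Notation w := (wfield F GC Grho).
Local Notation O := (@regular _ _ _ _ N F U Grho).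

Lemma solves_pu T g : solves w O T g ->
  forall t : R, 0 <= t <= T -> g t *m pu = g 0 *m pu.
Proof.
move=> Hg; apply: (@deriv0_constant_rV R _ (fun t => g t *m pu)) => t tT.
by have [_ /(is_derive_mulmx pu)] := Hg t tT; rewrite triple_pu.
Qed.

Lemma solves_pe T g : solves w O T g ->
  forall t : R, 0 <= t <= T -> g t *m pe = g 0 *m pe + t *: (g 0 *m pu).
Proof.
move=> Hg t tT; apply/eqP; rewrite -subr_eq; apply/eqP.
have := @deriv0_constant_rV R _ (fun t => g t *m pe - t *: (g 0 *m pu)) T.
rewrite scale0r subr0; apply => // s sT.
have [_ /(is_derive_mulmx pe)] := Hg s sT; rewrite triple_pe (solves_pu Hg sT) => ds.
have d2 : is_derive s 1 (fun s : R => s *: (g 0 *m pu)) (g 0 *m pu).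
  apply: is_derive_rV => i.
  rewrite (_ : (fun s0 => _) = fun s0 : R => s0 * (g 0 *m pu) 0 i); last first.
    by apply/funext => r; rewrite mxE.
  by apply: is_derive_eq; rewrite /GRing.scale /= mulr1 mulr0 ?addr0 ?add0r.
by have := is_deriveB ds d2; rewrite subrr.
Qed.

Lemma solves_phi T g : solves w O T g -> forall i, forall t : R, 0 <= t <= T ->
  phi F i (g t *m px) (g t *m pe) = phi F i (g 0 *m px) (g 0 *m pe).
Proof.
move=> Hg i; apply: (@deriv0_constant R
  (fun t => phi F i (g t *m px) (g t *m pe))) => t tT.
have [[_ _ dM] dg] := Hg t tT.
have := is_derive_comp_c11 dg (phi_c11 FN GCP i (g t)).
rewrite dot_grad_phi /wfield triple_px triple_pe vfield_Jx//.
by rewrite [(- _ : 'rV_ _) 0 i]mxE addNr.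
Qed.

Lemma solves_sq T g : solves w O T g -> forall t : R, 0 <= t <= T ->
  sq F (g t *m px) (g t *m pe) = sq F (g 0 *m px) (g 0 *m pe).
Proof. by move=> Hg t tT; apply: eq_bigr => i _; rewrite (solves_phi Hg). Qed.

Lemma solves_eval T g : solves w O T g -> forall t : R, 0 <= t <= T ->
  eval_map (F (g t *m pe)) (g t *m px) = eval_map (F (g 0 *m pe)) (g 0 *m px).
Proof. by move=> Hg t tT; apply/rowP => i; exact: solves_phi Hg i t tT. Qed.

Lemma solves_rho T g : solves w O T g -> forall t : R, 0 <= t <= T ->
  is_derive t 1 (fun s => rho (g s *m px)) (sq F (g 0 *m px) (g 0 *m pe) *
    last_multiplier F GC Grho (g t *m px) (g t *m pe) (g t *m pu)).
Proof.
move=> Hg t tT; have [[Ut _ dM] dg] := Hg t tT.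
have := is_derive_comp_c11 (is_derive_mulmx px dg) (rhoP Ut).
by rewrite /wfield triple_px (vfield_rho GC (g t *m pu) dM) (solves_sq Hg tT).
Qed.

(** Reachability in time 1.  The origin, where the field is not defined, is
    joined to itself for all parameters. *)
Definition joined x a y b := x = 0 /\ y = 0 \/ exists g,
  [/\ solves w O 1 g, g 0 = triple x a (b - a) & g 1 = triple y b (b - a)].

Lemma vfieldN x e u : vfield F GC Grho x e (- u) = - vfield F GC Grho x e u.
Proof.
have E : row_mx (- u *m Je GC x e) 0 = - row_mx (u *m Je GC x e) (0 : 'rV[R]_1).
  by rewrite opp_row_mx oppr0 mulNmx.
by rewrite /vfield /multiplier E mulNmx scalerN mulNmx.
Qed.

(** Time and the velocity of the parameter are reversed. *)
Lemma joined_sym x a y b : joined x a y b -> joined y b x a.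
Proof.
move=> [[-> ->]|[g [Hg g0 g1]]]; [by left | right].
pose flip z : Z := triple (z *m px) (z *m pe) (- (z *m pu)).
exists (fun t => flip (g (1 - t))); split; last 2 first.
- by rewrite subr0 g1 /flip triple_px triple_pe triple_pu opprB.
- by rewrite subrr g0 /flip triple_px triple_pe triple_pu opprB.
move=> t /andP[t0 t1]; have t01 : 0 <= 1 - t <= 1 by apply/andP; split; lra.
have [Ot dg] := Hg _ t01; split.
  by rewrite /regular /= /flip triple_px triple_pe; exact: Ot.
have dr := is_derive_reverse dg.
rewrite {1}/wfield /flip triple_px triple_pe triple_pu vfieldN.
apply: is_derive_triple.
- by have := is_derive_mulmx px dr; rewrite mulNmx triple_px.
- by have := is_derive_mulmx pe dr; rewrite mulNmx triple_pe.
by have := is_deriveN (is_derive_mulmx pu dr); rewrite mulNmx triple_pu opprK.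
Qed.

Lemma joined_neq0 x a y b : joined x a y b -> (x = 0) <-> (y = 0).
Proof.
move=> [[-> ->]//|[g [Hg g0 g1]]].
have [] := Hg 0; first by rewrite lexx ler01.
have [] := Hg 1; first by rewrite lexx ler01.
move=> [_ y0 _] _ [_ x0 _] _; move: y0 x0; rewrite g0 g1 !triple_px => y0 x0.
by split=> h; [move: x0; rewrite h eqxx | move: y0; rewrite h eqxx].
Qed.

Lemma joined_unique x a y y' b : joined x a y b -> joined x a y' b -> y = y'.
Proof.
move=> H H'; have [x0|x0] := eqVneq x 0.
  by rewrite ((joined_neq0 H).1 x0) ((joined_neq0 H').1 x0).
case: H H' => [[x0' _]|[g [Hg g0 g1]]]; first by rewrite x0' eqxx in x0.
case=> [[x0' _]|[g' [Hg' g'0 g'1]]]; first by rewrite x0' eqxx in x0.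
have := flow_unique (fun z Oz i => wfield_lip FN GCP rhoP i Oz) Hg Hg' (etrans g0 (esym g'0)).
by move=> /(congr1 (mulmx^~ px)); rewrite g1 g'1 !triple_px.
Qed.

Lemma joined_eval x a y b : (forall e, fixes_origin (F e)) ->
  joined x a y b -> eval_map (F a) x = eval_map (F b) y.
Proof.
move=> F0 [[-> ->]|[g [Hg g0 g1]]]; first by rewrite !F0.
have := solves_eval Hg (_ : 0 <= 1 <= 1).
rewrite g0 g1 !triple_px !triple_pe => ->//.
by rewrite ler01 lexx.
Qed.

(** Away from the origin solvability over the whole time interval is an open
    condition, and the end point depends continuously on the data. *)
Lemma joined_near x a y b (eta : R) : x != 0 -> joined x a y b -> 0 < eta ->
  exists2 d, 0 < d & forall x' a' b', `|x' - x| < d -> `|a' - a| < d -> `|b' - b| < d ->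
    exists y', `|y' - y| < eta /\ joined x' a' y' b'.
Proof.
move=> x0 [[x0' _]|[g [Hg g0 g1]]] eta0; first by rewrite x0' eqxx in x0.
have [d d0 Hd] := flow_stable (regular_open FN GCP rhoP Uo)
  (fun z Oz i => wfield_lip FN GCP rhoP i Oz) Hg eta0.
have d3 : 0 < d / 3 by rewrite divr_gt0.
exists (d / 3) => // x' a' b' hx ha hb.
have [|g' [g'0 Hg' g'1]] := Hd (triple x' a' (b' - a')).
  rewrite g0 tripleB; apply: (@le_lt_trans _ _ (2 * (d / 3))); last by lra.
  apply: norm_triple; [lra | lra |].
  rewrite (_ : b' - a' - (b - a) = b' - b - (a' - a)).
    by have := ler_normB (b' - b) (a' - a); lra.
  by apply/rowP => i; rewrite !mxE; ring.
exists (g' 1 *m px); split.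
  rewrite -(triple_px y b (b - a)) -g1 -mulmxBl.
  by apply: le_lt_trans (norm_px _) _.
right; exists g'; split=> //.
have u1 := solves_pu Hg' (_ : 0 <= 1 <= 1).
have e1 := solves_pe Hg' (_ : 0 <= 1 <= 1).
rewrite -[LHS]triple_eta u1 ?ler01 ?lexx// e1 ?ler01 ?lexx// g'0 triple_pe triple_pu.
by rewrite scale1r addrC subrK.
Qed.

End Connection.

(** * Trajectories near the origin *)

(** Points that violate an estimate for every constant [k] accumulate at a point
    of the compact set. *)
Lemma compact_net (R : realType) M (C : set 'rV[R]_M) (B : R -> set 'rV[R]_M) :
  compact C -> (forall k, 0 < k -> exists2 z, C z & B k z) ->
  (forall k k', 0 < k -> k <= k' -> B k `<=` B k') ->
  exists (W : set_system 'rV[R]_M) a, [/\ UltraFilter W, C a,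
    (fun z : 'rV[R]_M => z) @ W --> a & forall k, 0 < k -> W (C `&` B k)].
Proof.
move=> Cc B0 Bmono.
have BF : ProperFilter (filter_from [set k : R | 0 < k] (fun k => C `&` B k)).
  apply: filter_from_proper; last by move=> k /= /B0[z Cz Bz]; exists z.
  apply: filter_from_filter; first by exists 1; rewrite /= ltr01.
  move=> k1 k2 /= k10 k20; exists (Num.min k1 k2); first by rewrite /= lt_min k10.
  have m0 : 0 < Num.min k1 k2 by rewrite lt_min k10.
  by move=> z [Cz Bz]; split; split=> //; apply: Bmono Bz => //;
    rewrite ge_min lexx ?orbT.
have [W [WU BW]] := ultraFilterLemma BF.
have WB k : 0 < k -> W (C `&` B k) by move=> k0; apply: BW; exists k.
have WC : W C by apply: filterS (WB 1 ltr01) => z [].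
move: Cc; rewrite compact_ultra => /(_ W WU WC)[a [Ca ca]].
by exists W, a.
Qed.

Lemma compact_bounded_fun (R : realType) M (C : set 'rV[R]_M) (phi : 'rV[R]_M -> R) :
  compact C -> (forall a, C a -> {for a, continuous phi}) ->
  exists2 b, 0 < b & forall a, C a -> `|phi a| <= b.
Proof.
move=> Cc phic; apply: contrapT => H.
have [||W [a [WU Ca ca WB]]] := @compact_net R M C (fun k => [set z | 1 < k * `|phi z|]) Cc.
- move=> k k0; apply: contrapT => N; apply: H; exists k^-1; first by rewrite invr_gt0.
  move=> a Ca; rewrite leNgt; apply/negP => h; apply: N; exists a => //=.
  by rewrite mulrC -ltr_pdivrMr// div1r.
- move=> k k' k0 kk z /= h; apply: lt_le_trans h _.
  by rewrite ler_wpM2r.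
have PW : ProperFilter W by exact: ultra_proper.
have FW : Filter W by exact: filter_filter.
have cp : (fun z => phi z) @ W --> phi a.
  exact: (@cvg_comp _ _ _ (fun z : 'rV[R]_M => z) phi _ _ _ ca (phic a Ca)).
have k0 : 0 < (`|phi a| + 1)^-1 by rewrite invr_gt0 ltr_wpDl.
have /cvgrPdist_lt/(_ _ ltr01) h := cp.
have /(@filter_ex _ W PW)[z [[_ /= h1] h2]] := @filterI _ W FW _ _ (WB _ k0) h.
move: h1; rewrite mulrC ltr_pdivlMr ?ltr_wpDl// mul1r.
have := ler_normB (phi a) (phi a - phi z); rewrite subKr.
by move: h2 => /= h2; lra.
Qed.

(** After the last time at which [phi] does not exceed [c] it grows with speed at
    most [b], for a time at most 1. *)
Lemma barrier (R : realType) (phi dphi : R -> R) (T c b : R) : 0 <= T <= 1 -> 0 <= b ->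
  (forall t : R, 0 <= t <= T -> is_derive t 1 phi (dphi t)) ->
  phi 0 <= c -> (forall t : R, 0 <= t <= T -> c <= phi t -> `|dphi t| <= b) ->
  phi T <= c + b.
Proof.
move=> /andP[T0 T1] b0 dp p0 H; have [pT|pT] := leP (phi T) c; first by lra.
pose S := [set t : R | 0 <= t <= T /\ phi t <= c].
have S0 : S 0 by split=> //; rewrite lexx T0.
have Ssup : has_sup S by split; [exists 0 | exists T => t [/andP[]]].
pose s := sup S.
have s0 : 0 <= s by apply: ub_le_sup => //; case: Ssup.
have sT : s <= T by apply: ge_sup; [exists 0 | move=> t [/andP[]]].
have pcont (t : R) : 0 <= t <= T -> {for t, continuous phi}.
  by move=> tT; exact: is_derive_continuous (dp t tT).
have ps : phi s <= c.
  rewrite leNgt; apply/negP => sc.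
  have : nbhs (phi s) [set r : R | c < r] by exact: lt_nbhsr.
  move=> /(pcont s (introT andP (conj s0 sT)))/nbhs_ballP[d /= d0 Hd].
  have [t [tT tc] td] := sup_adherent d0 Ssup.
  have ts : t <= s by apply: ub_le_sup => //; case: Ssup.
  have : c < phi t.
    by apply: Hd; rewrite -ball_normE /ball_ /= ger0_norm ?subr_ge0// -/s; rewrite -/s in td; lra.
  by rewrite ltNge tc.
have sT' : s < T.
  by rewrite lt_neqAle sT andbT; apply: contraTneq ps => ->; rewrite -ltNge.
have above (t : R) : s < t -> t <= T -> c < phi t.
  move=> st tT; rewrite ltNge; apply/negP => tc.
  have : t <= s.
    by apply: ub_le_sup; [case: Ssup | split=> //; rewrite tT (le_trans s0) ?ltW].
  by rewrite leNgt st.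
have dp' x : x \in `]s, T[ -> is_derive x 1 phi (dphi x).
  rewrite in_itv /= => /andP[sx xT]; apply: dp; rewrite (ltW xT) andbT.
  exact: le_trans s0 (ltW sx).
have pc : {within `[s, T], continuous phi}.
  apply: continuous_in_subspaceT => x; rewrite inE /= in_itv /= => /andP[sx xT].
  by apply: pcont; rewrite xT (le_trans s0).
have [x] := MVT sT' dp' pc.
rewrite in_itv /= => /andP[sx xT] E.
have xT' : 0 <= x <= T by rewrite (ltW xT) andbT (le_trans s0) ?ltW.
have h : dphi x <= b.
  by apply: le_trans (ler_norm _) (H x xT' _); apply/ltW/above => //; exact: ltW.
have : dphi x * (T - s) <= b * 1 by nra.
by lra.
Qed.

Lemma cvg_image (R : realType) M (V : topologicalType) (W : set_system 'rV[R]_M)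
    (z : 'rV[R]_M) (f : 'rV[R]_M -> V) :
  (fun z : 'rV[R]_M => z) @ W --> z -> {for z, continuous f} -> (fun z => f z) @ W --> f z.
Proof. by move=> cz cf; exact: (@cvg_comp _ _ _ _ _ _ _ _ cz cf). Qed.

Section Control.
Context {R : realType} {d : nat} (U : set 'rV[R]_d) (rho : 'rV[R]_d -> R)
  (Grho : 'rV[R]_d -> 'rV[R]_d).
Context (HU : control_function U rho) (rhoP : forall a, U a -> c11 rho Grho a).

Lemma rho_continuous a : U a -> {for a, continuous rho}.
Proof. by move=> /rhoP/c11_loc_lipschitz/loc_lipschitz_continuous. Qed.

Lemma rho0 : rho 0 = 0.
Proof. by have [[_ U0] _ _ r0 _] := HU; apply/(r0 0 U0). Qed.

Lemma rho_gt0 x : U x -> x != 0 -> 0 < rho x.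
Proof.
have [_ _ rge r0 _] := HU => Ux x0; rewrite lt_neqAle rge// andbT eq_sym.
by apply: contra_neq x0 => /(r0 x Ux).
Qed.

(** Properness makes the sublevel sets shrink to the origin. *)
Lemma rho_small (eta : R) : 0 < eta -> exists2 s, 0 < s &
  forall x, U x -> rho x <= s -> `|x| < eta.
Proof.
move=> eta0; have [[_ U0] _ rge r0 rc] := HU.
have Cc : compact (U `&` rho @^-1` `[0, 1]%classic).
  by apply: rc; [move=> t /=; rewrite in_itv /= => /andP[] | exact: segment_compact].
apply: contrapT => H.
have [||W [a [WU [Ua _] ca WB]]] := @compact_net R d _
    (fun k => [set x | [/\ U x, rho x <= k & eta <= `|x|]]) Cc.
- move=> k k0; apply: contrapT => N; apply: H.
  exists (Num.min k 1); first by rewrite lt_min k0 ltr01.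
  move=> x Ux; rewrite le_min => /andP[xk x1]; rewrite ltNge; apply/negP => h; apply: N.
  by exists x; split=> //=; rewrite in_itv /= rge.
- by move=> k k' _ kk x [Ux xk ex]; split=> //; exact: le_trans kk.
have PW : ProperFilter W by exact: ultra_proper.
have FW : Filter W by exact: filter_filter.
have cr : (fun x => rho x) @ W --> rho a.
  exact: (@cvg_comp _ _ _ (fun x : 'rV[R]_d => x) rho _ _ _ ca (rho_continuous Ua)).
have a0 : a = 0.
  apply/(r0 _ Ua)/eqP; rewrite eq_le rge// andbT.
  apply/ler_addgt0Pr => e e0; rewrite add0r.
  by apply: (ultra_cvg_le cr); apply: (@filterS _ W FW) (WB _ e0) => x [_ []].
have : eta <= `|a|.
  rewrite -lerN2; apply: (@ultra_cvg_le R _ W WU (fun x => - `|x|)).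
    by apply: cvgN; apply: cvg_norm.
  by apply: (@filterS _ W FW) (WB _ ltr01) => x [_ [_ _ h]] /=; rewrite lerN2.
by rewrite a0 normr0 leNgt eta0.
Qed.

End Control.

Section Lyapunov.
Context {R : realType} {K : ground} {n p N : nat} (F : kfamily R K n p).
Context (GC : 'I_p -> bmultinom (kdim K n) N -> 'I_(kdim K 1) ->
  kspace R K 1 -> kspace R K 1).
Context (U : set (kspace R K n)) (rho : kspace R K n -> R)
  (Grho : kspace R K n -> kspace R K n).
Context (FN : forall e, degree_lt N (F e))
  (GCP : forall j m q e, c11 (fun e => coeffs N (F e) j m q) (GC j m q) e)
  (rhoP : forall a, U a -> c11 rho Grho a) (HU : control_function U rho)
  (F0 : forall e, fixes_origin (F e)).

Local Notation Z := 'rV[R]_(kdim K n + (kdim K 1 + kdim K 1)).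
Implicit Types (x y : kspace R K n) (a b e u : kspace R K 1) (z : Z).

Local Notation w := (wfield F GC Grho).
Local Notation O := (@regular _ _ _ _ N F U Grho).

Lemma sq_ge0 x e : 0 <= sq F x e.
Proof. by apply: sumr_ge0 => i _; exact: sqr_ge0. Qed.

Lemma sq_small (r eps : R) : 0 < eps -> exists2 d, 0 < d &
  forall x e, `|x| < d -> `|e| <= r -> sq F x e < eps.
Proof.
move=> eps0.
pose C := [set z : Z | `|z| <= 1 + Num.max 0 r].
have Cc : compact C.
  apply: (@compact_rV _ _ _ (1 + Num.max 0 r)) => //.
  apply: (closed_comp _ (@closed_le _ _)) => x _; exact: norm_continuous.
apply: contrapT => H.
have [||W [z [WU _ cz WB]]] := @compact_net R _ C (fun k => [set z |
    [/\ `|z *m px| <= k, `|z *m pe| <= r & eps <= sq F (z *m px) (z *m pe)]]) Cc.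
- move=> k k0; apply: contrapT => N'; apply: H.
  exists (Num.min k 1); first by rewrite lt_min k0 ltr01.
  move=> x e; rewrite lt_min => /andP[xk x1] er; rewrite ltNge; apply/negP => h; apply: N'.
  have m0 : 0 <= Num.max 0 r by rewrite le_max lexx.
  have mr : r <= Num.max 0 r by rewrite le_max lexx orbT.
  exists (triple x e 0); last by rewrite /= triple_px triple_pe; split=> //; exact: ltW.
  by apply: norm_triple; rewrite ?normr0; lra.
- by move=> k k' _ kk x [xk er h]; split=> //; exact: le_trans kk.
have PW : ProperFilter W by exact: ultra_proper.
have FW : Filter W by exact: filter_filter.
have cx : (fun z : Z => z *m px) @ W --> z *m px.
  apply: (@cvg_image R _ _ W z (fun z : Z => z *m px) cz).
  exact: mulmx_continuous.
have x0 : z *m px = 0.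
  apply/eqP; rewrite -normr_le0; apply/ler_addgt0Pr => e e0; rewrite add0r.
  apply: (@ultra_cvg_le R _ W WU (fun z : Z => `|z *m px|)); first exact: cvg_norm.
  by apply: (@filterS _ W FW) (WB _ e0) => y [_ []].
have cs : (fun z : Z => sq F (z *m px) (z *m pe)) @ W --> sq F (z *m px) (z *m pe).
  apply: (@cvg_image R _ _ W z (fun z : Z => sq F (z *m px) (z *m pe)) cz).
  exact: loc_lipschitz_continuous (sq_lip FN GCP z).
have : eps <= sq F (z *m px) (z *m pe).
  rewrite -lerN2; apply: (@ultra_cvg_le R _ W WU (fun z : Z => - sq F (z *m px) (z *m pe))).
    exact: cvgN.
  by apply: (@filterS _ W FW) (WB _ ltr01) => y [_ [_ _ h]] /=; rewrite lerN2.
rewrite x0 /sq big1 ?leNgt ?eps0// => i _; rewrite /phi F0 mxE expr0n.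
by [].
Qed.

Definition shell (r c s : R) : set Z := [set z |
  [/\ U (z *m px), c <= rho (z *m px) <= s, `|z *m pe| <= r & `|z *m pu| <= 2 * r]].

Lemma shell_compact r c s : 0 <= c -> compact (shell r c s).
Proof.
move=> c0; have [_ _ rge r0 rc] := HU.
have Cc : compact (U `&` rho @^-1` `[c, s]%classic).
  apply: rc; last exact: segment_compact.
  by move=> t /=; rewrite in_itv /= => /andP[ct _]; exact: le_trans ct.
have [b [_ Cb]] := compact_bounded Cc.
rewrite compact_ultra => W WU WC.
have PW : ProperFilter W by exact: ultra_proper.
have FW : Filter W by exact: filter_filter.
have [z cz] : exists z : Z, (fun z => z) @ W --> z.
  apply: (@ultra_cvg_rV R _ W WU _ _ (Num.max (`|b| + 1) (2 * Num.max r 0))).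
  apply: (@filterS _ W FW) WC => y [Uy yc yr yu] /=.
  have m1 : r <= Num.max r 0 by rewrite le_max lexx.
  have m0 : 0 <= Num.max r 0 by rewrite le_max lexx orbT.
  rewrite -[y]triple_eta; apply: norm_triple; rewrite le_max; apply/orP; [left|right|right].
  - apply: (Cb (`|b| + 1)); last by split=> //=; rewrite in_itv.
    by have := ler_norm b; lra.
  - by lra.
  - by lra.
have cx : (fun z : Z => z *m px) @ W --> z *m px.
  apply: (@cvg_image R _ _ W z (fun z : Z => z *m px) cz).
  exact: mulmx_continuous.
have ce : (fun z : Z => z *m pe) @ W --> z *m pe.
  apply: (@cvg_image R _ _ W z (fun z : Z => z *m pe) cz).
  exact: mulmx_continuous.
have cu : (fun z : Z => z *m pu) @ W --> z *m pu.
  apply: (@cvg_image R _ _ W z (fun z : Z => z *m pu) cz).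
  exact: mulmx_continuous.
have [x [[Ux xc] xlim]] : exists x, (U `&` rho @^-1` `[c, s]%classic) x /\
    (fun z : Z => z *m px) @ W --> x.
  move: (Cc); rewrite compact_ultra => h.
  have [||x [Cx Hx]] := h ((fun z : Z => z *m px) @ W) _ _.
  - exact: fmap_ultra.
  - by apply: (@filterS _ W FW) WC => y [Uy yc _ _]; split=> //=; rewrite in_itv.
  by exists x.
have xE : x = z *m px.
  by apply: (@cvg_unique _ (@norm_hausdorff _ _) ((fun z : Z => z *m px) @ W) _ _ _ xlim cx).
exists z; split=> //; split.
- by rewrite -xE.
- by move: xc => /=; rewrite in_itv /= xE.
- apply: (@ultra_cvg_le R _ W WU (fun z : Z => `|z *m pe|)); first exact: cvg_norm.
  by apply: (@filterS _ W FW) WC => y [].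
apply: (@ultra_cvg_le R _ W WU (fun z : Z => `|z *m pu|)); first exact: cvg_norm.
by apply: (@filterS _ W FW) WC => y [].
Qed.

Lemma shell_interior r c s z : U (z *m px) -> c < rho (z *m px) < s ->
  `|z *m pe| < r -> `|z *m pu| < 2 * r -> nbhs z (shell r c s).
Proof.
move=> Uz /andP[zc zs] ze zu.
have [[Uo _] _ _ _ _] := HU.
have FF : Filter (nbhs z) by exact: nbhs_filter.
have cx : {for z, continuous (fun z : Z => z *m px)} by exact: mulmx_continuous.
have cr : {for z, continuous (fun z : Z => rho (z *m px))}.
  by apply: continuous_comp => //; exact: rho_continuous rhoP _ Uz.
have ce : {for z, continuous (fun z : Z => `|z *m pe|)}.
  by apply: continuous_comp; [exact: mulmx_continuous | exact: norm_continuous].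
have cu : {for z, continuous (fun z : Z => `|z *m pu|)}.
  by apply: continuous_comp; [exact: mulmx_continuous | exact: norm_continuous].
have n1 : nbhs z [set z | U (z *m px)] by apply: cx; exact: open_nbhs_nbhs.
have n2 := cr _ (lt_nbhsr zc); have n3 := cr _ (lt_nbhsl zs).
have n4 := ce _ (lt_nbhsl ze); have n5 := cu _ (lt_nbhsl zu).
have nn := @filterI _ _ FF _ _ n1 (@filterI _ _ FF _ _ (@filterI _ _ FF _ _ n2 n3)
  (@filterI _ _ FF _ _ n4 n5)).
apply: (@filterS _ _ FF) nn => y [h1 [[/= h2 h3] [/= h4 h5]]].
by split; rewrite ?ltW// h3.
Qed.

Definition nondegenerate (r s : R) := forall x e,
  U x -> 0 < rho x <= s -> `|e| <= r -> \det (@Mmat _ _ _ _ N F Grho x e) != 0.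

Lemma shell_regular r c s : nondegenerate r s -> 0 < c -> shell r c s `<=` O.
Proof.
move=> nd c0 z [Uz /andP[cz zs] ze zu]; split=> //.
  by apply/eqP => x0; move: cz; rewrite x0 (rho0 HU) leNgt c0.
by apply: nd => //; rewrite zs (lt_le_trans c0).
Qed.

Lemma last_multiplier_bounded r c s : nondegenerate r s -> 0 < c ->
  exists2 b, 0 < b & forall z, shell r c s z ->
    `|last_multiplier F GC Grho (z *m px) (z *m pe) (z *m pu)| <= b.
Proof.
move=> nd c0; apply: (@compact_bounded_fun R _ (shell r c s)
  (fun z => last_multiplier F GC Grho (z *m px) (z *m pe) (z *m pu))).
  by apply: shell_compact; exact: ltW.
move=> z /(shell_regular nd c0) Oz; apply: loc_lipschitz_continuous.
exact: (@multiplier_lip _ _ _ _ _ _ _ _ _ _ FN GCP rhoP z _ Oz).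
Qed.

(** Along a trajectory [rho] grows at most by a multiple of the squared norm of
    the value of the map, which is constant and small for a start near the
    origin; and it cannot tend to 0, where that value would have to vanish. *)
Lemma joined_small r s1 eta : 0 < s1 -> nondegenerate r s1 -> 0 < eta ->
  exists2 d, 0 < d & forall x a b, `|x| < d -> `|a| < r -> `|b| < r ->
    exists2 y, `|y| < eta & joined F GC U Grho x a y b.
Proof.
move=> s10 nd1 eta0; have [[Uo U0] _ rge r0 rc] := HU.
have [s3 s30 Hs3] := rho_small HU rhoP eta0.
pose s := Num.min s1 s3.
have s0 : 0 < s by rewrite lt_min s10.
have s2 : 0 < s / 2 by rewrite divr_gt0.
have nd : nondegenerate r s.
  move=> x e Ux /andP[x0 xs]; apply: nd1 => //; rewrite x0 (le_trans xs)//.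
  by rewrite ge_min lexx.
have small_rho x : U x -> rho x <= s -> `|x| < eta.
  by move=> Ux xs; apply: Hs3 => //; rewrite (le_trans xs)// ge_min lexx orbT.
have [B B0 HB] := last_multiplier_bounded nd s2.
have s4 : 0 < s / 4 by rewrite divr_gt0.
have [d1 d10 Hd1] := @sq_small r (s / 4 / B) (divr_gt0 s4 B0).
have [d2 d20 Hd2] := (nbhs_rVP _ _).1 (open_nbhs_nbhs (conj Uo U0)).
have /(nbhs_rVP _ _)[d3 d30 Hd3] : nbhs (0 : kspace R K n) [set x : kspace R K n | rho x < s / 2].
  apply: (rho_continuous rhoP U0 (t := [set t | t < s / 2])).
  by apply: lt_nbhsl; rewrite (rho0 HU).
exists (Num.min d1 (Num.min d2 d3)); first by rewrite !lt_min d10 d20.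
move=> x a b; rewrite !lt_min => /and3P[xd1 xd2 xd3] ar br.
have Ux : U x by apply: Hd2; rewrite subr0.
have xs2 : rho x < s / 2 by apply: Hd3; rewrite subr0.
have [->|x0] := eqVneq x 0; first by exists 0; [rewrite normr0 | left].
have rx0 := rho_gt0 HU Ux x0.
have sB : sq F x a * B < s / 4 by rewrite -ltr_pdivlMr//; apply: Hd1 => //; exact: ltW.
(* Below the level [c] the value of the map is smaller than at the start. *)
have [c [c0 cx Hc]] : exists c, [/\ 0 < c, c < rho x & forall y e, U y -> rho y <= c ->
    `|e| <= r -> sq F x a != 0 -> sq F y e < sq F x a].
  have [q0|q0] := eqVneq (sq F x a) 0.
    by exists (rho x / 2); split=> //; [rewrite divr_gt0 | rewrite ltr_pdivrMr// ltr_pMr// ltr1n].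
  have qgt : 0 < sq F x a by rewrite lt_neqAle eq_sym q0 sq_ge0.
  have [d4 d40 Hd4] := @sq_small r _ qgt.
  have [c4 c40 Hc4] := rho_small HU rhoP d40.
  exists (Num.min c4 (rho x / 2)); split.
  - by rewrite lt_min c40 divr_gt0.
  - by rewrite gt_min; apply/orP; right; rewrite ltr_pdivrMr// ltr_pMr// ltr1n.
  move=> y e Uy yc er _; apply: Hd4 => //; apply: Hc4 => //.
  by rewrite (le_trans yc)// ge_min lexx.
pose C := shell r c s.
have CO : C `<=` O by exact: shell_regular.
have bar : `|b - a| < 2 * r by have := ler_normB b a; lra.
have Cz : C (triple x a (b - a)).
  rewrite /C /shell /= triple_px triple_pe triple_pu; split=> //; try exact: ltW.
  by rewrite (ltW cx) (le_trans (ltW xs2))//; lra.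
have lip z (Oz : O z) i := wfield_lip FN GCP rhoP i Oz.
have Cc : compact C by apply: shell_compact; exact: ltW.
have [|g g0 Hg] := flow_exists lip Cc CO Cz.
  move=> T g /[dup] T01 /andP[T0 T1] g0 Hg.
  have HgO : solves w O T g by move=> t tT; have [Ct dg] := Hg t tT; split=> //; exact: CO.
  have TT : 0 <= T <= T by rewrite T0 lexx.
  have [CT _] := Hg T TT.
  have rT t : 0 <= t <= T -> sq F (g t *m px) (g t *m pe) = sq F x a.
    by move=> tT; rewrite (solves_sq FN GCP HgO tT) g0 triple_px triple_pe.
  have dr (t : R) (tT : 0 <= t <= T) := solves_rho FN GCP rhoP HgO tT.
  rewrite g0 triple_px triple_pe in dr.
  have [UT /andP[cT sT] eT uT] := CT.
  apply: shell_interior => //.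
  - apply/andP; split.
      rewrite lt_neqAle cT andbT; apply/eqP => cE.
      have [q0|q0] := eqVneq (sq F x a) 0.
        have h : rho (g T *m px) = rho (g 0 *m px).
          apply: (@deriv0_constant R (fun t => rho (g t *m px)) T) => // t tT.
          by have := dr t tT; rewrite q0 mul0r.
        by move: cx; rewrite cE h g0 triple_px ltxx.
      have := Hc _ _ UT (_ : rho (g T *m px) <= c) eT q0.
      by rewrite (rT T TT) ltxx -cE => h; have := h (lexx _).
    (* Where [rho] is at least [s / 2], its speed is at most [sq * B], less than [s / 4]. *)
    suff : rho (g T *m px) <= s / 2 + s / 4 by lra.
    apply: (barrier T01 (dphi := fun t => sq F x a *
      last_multiplier F GC Grho (g t *m px) (g t *m pe) (g t *m pu))) => //.
    - lra.
    - by rewrite g0 triple_px ltW.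
    move=> t tT st; rewrite normrM (ger0_norm (sq_ge0 _ _)).
    apply: le_trans (ltW sB); rewrite ler_wpM2l ?sq_ge0//; apply: HB.
    by have [[Ut /andP[ct ts] et ut] _] := Hg t tT; split=> //; rewrite st ts.
  - rewrite (solves_pe HgO TT) g0 triple_pe triple_pu.
    rewrite (_ : a + T *: (b - a) = (1 - T) *: a + T *: b); last first.
      by rewrite scalerBr scalerBl scale1r addrAC addrA.
    apply: le_lt_trans (ler_normD _ _) _; rewrite !normrZ !ger0_norm ?subr_ge0//.
    have mr : Num.max `|a| `|b| < r by rewrite gt_max ar.
    have ma : `|a| <= Num.max `|a| `|b| by rewrite le_max lexx.
    have mb : `|b| <= Num.max `|a| `|b| by rewrite le_max lexx orbT.
    apply: le_lt_trans mr; set m := Num.max _ _ in ma mb *.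
    rewrite [leRHS](_ : m = (1 - T) * m + T * m); last by ring.
    by apply: lerD; apply: ler_wpM2l; rewrite ?subr_ge0.
  by rewrite (solves_pu HgO TT) g0 triple_pu.
have i11 : 0 <= (1 : R) <= 1 by rewrite ler01 lexx.
have HgO : solves w O 1 g by move=> t tT; have [Ct dg] := Hg t tT; split=> //; exact: CO.
exists (g 1 *m px).
  by have [[U1 /andP[_ h1] _ _] _] := Hg 1 i11; exact: small_rho.
right; exists g; split=> //.
rewrite -[LHS]triple_eta (solves_pu HgO i11) (solves_pe HgO i11) g0 triple_pe triple_pu.
by rewrite scale1r addrC subrK.
Qed.

End Lyapunov.

(** * Trivialisation by transport *)

Section Triviality.
Context {R : realType} {K : ground} {n p N : nat} (F : kfamily R K n p).
Context (GC : 'I_p -> bmultinom (kdim K n) N -> 'I_(kdim K 1) ->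
  kspace R K 1 -> kspace R K 1).
Context (U : set (kspace R K n)) (rho : kspace R K n -> R)
  (Grho : kspace R K n -> kspace R K n).
Context (FN : forall e, degree_lt N (F e))
  (GCP : forall j m q e, c11 (fun e => coeffs N (F e) j m q) (GC j m q) e)
  (rhoP : forall a, U a -> c11 rho Grho a) (HU : control_function U rho)
  (F0 : forall e, fixes_origin (F e)).

Implicit Types (x y : kspace R K n) (a b e : kspace R K 1).

Local Notation joined := (@joined _ _ _ _ _ F GC U Grho).
Local Notation nondegenerate := (@nondegenerate _ _ _ _ N F U rho Grho).

Let Uo : open U. Proof. by case: HU => [[]]. Qed.

Lemma joined_nbhs r s x a y b (eta : R) : 0 < s -> nondegenerate r s ->
  `|a| < r -> `|b| < r -> joined x a y b -> 0 < eta ->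
  exists2 d, 0 < d & forall x' a' b', `|x' - x| < d -> `|a' - a| < d -> `|b' - b| < d ->
    exists2 y', `|y' - y| < eta & joined x' a' y' b'.
Proof.
move=> s0 nd ar br xy eta0; have [x0|x0] := eqVneq x 0; last first.
  have [d d0 Hd] := joined_near FN GCP rhoP Uo x0 xy eta0.
  by exists d => // x' a' b' h1 h2 h3; have [y' []] := Hd x' a' b' h1 h2 h3; exists y'.
have y0 := (joined_neq0 xy).1 x0; rewrite x0 y0.
have [d d0 Hd] := joined_small FN GCP rhoP HU F0 s0 nd eta0.
exists (Num.min d (Num.min (r - `|a|) (r - `|b|))).
  by rewrite !lt_min d0 !subr_gt0 ar.
move=> x' a' b'; rewrite !lt_min subr0 => /andP[xd _] /and3P[_ ha _] /and3P[_ _ hb].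
have [||y' y'eta] := Hd x' a' b' xd.
- by have := ler_normD (a' - a) a; rewrite subrK; lra.
- by have := ler_normD (b' - b) b; rewrite subrK; lra.
by move=> Hy; exists y'; rewrite ?subr0.
Qed.

Definition admissible (T : set (kspace R K 1)) := forall e, T e ->
  exists r s, [/\ `|e| < r, 0 < s & nondegenerate r s].

Definition transport (T : set (kspace R K 1)) : set (kspace R K n * kspace R K 1) :=
  [set z | T z.2 /\ exists y, joined z.1 0 y z.2].

Definition endpoint (z : kspace R K n * kspace R K 1) : kspace R K n :=
  xget 0 [set y | joined z.1 0 y z.2].

Lemma endpointE x e y : joined x 0 y e -> endpoint (x, e) = y.
Proof.
move=> xy; rewrite /endpoint; case: xgetP => [y' _ /= xy'|/(_ y)//].
exact: (@joined_unique _ _ _ _ _ _ _ _ _ _ FN GCP rhoP _ _ _ _ _ xy' xy).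
Qed.

Lemma nbhs_pairP x e (d : R) (B : set (kspace R K n * kspace R K 1)) : 0 < d ->
  (forall x' e', `|x' - x| < d -> `|e' - e| < d -> B (x', e')) -> nbhs (x, e) B.
Proof.
move=> d0 H; exists ([set x' | `|x' - x| < d], [set e' | `|e' - e| < d]).
  by split; apply/nbhs_rVP; exists d.
by move=> [x' e'] /= [h1 h2]; exact: H.
Qed.

(** Transporting along the trajectories trivialises the deformation; the
    inverse homeomorphisms transport back. *)
Lemma admissible_trivial (T : set (kspace R K 1)) : open T -> admissible T ->
  topologically_trivial_along F T.
Proof.
move=> To TA.
have near_end x e y (eta : R) : T e -> joined x 0 y e -> 0 < eta -> exists2 d, 0 < d &
    forall x' e', `|x' - x| < d -> `|e' - e| < d -> T e' /\
      exists2 y', `|y' - y| < eta & joined x' 0 y' e'.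
  move=> Te xy eta0; have [r [s [er s0 nd]]] := TA e Te.
  have r0 : `|0 : kspace R K 1| < r by rewrite normr0 (le_lt_trans _ er).
  have [d d0 Hd] := joined_nbhs s0 nd r0 er xy eta0.
  have [d' d'0 Hd'] := (nbhs_rVP _ _).1 (open_nbhs_nbhs (conj To Te)).
  exists (Num.min d d'); first by rewrite lt_min d0.
  move=> x' e'; rewrite !lt_min => /andP[h1 _] /andP[h2 h3]; split; first exact: Hd'.
  by apply: Hd => //; rewrite subrr normr0.
exists (transport T), endpoint; split.
- rewrite openE => -[x e] [/= Te [y xy]]; have [d d0 Hd] := near_end _ _ _ _ Te xy ltr01.
  apply: (nbhs_pairP d0) => x' e' h1 h2; have [Te' [y' _ xy']] := Hd x' e' h1 h2.
  by split=> //; exists y'.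
- apply: continuous_in_subspaceT => -[x e]; rewrite inE => -[[/= Te [y xy]] _].
  move=> B; rewrite /= (endpointE xy) => /nbhs_rVP[eta eta0 HB].
  have [d d0 Hd] := near_end _ _ _ _ Te xy eta0.
  apply: (nbhs_pairP d0) => x' e' h1 h2 /=; have [Te' [y' hy xy']] := Hd x' e' h1 h2.
  by rewrite (endpointE xy'); exact: HB.
move=> e Te; have [r [s [er s0 nd]]] := TA e Te.
have r0 : `|0 : kspace R K 1| < r by rewrite normr0 (le_lt_trans _ er).
have back x y (eta : R) : joined x 0 y e -> 0 < eta -> exists2 d, 0 < d &
    forall y', `|y' - y| < d -> exists2 x', `|x' - x| < eta & joined x' 0 y' e.
  move=> /joined_sym xy eta0; have [d d0 Hd] := joined_nbhs s0 nd er r0 xy eta0.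
  exists d => // y' hy; have [||x' hx /joined_sym xy'] := Hd y' e 0 hy; try by rewrite subrr normr0.
  by exists x'.
pose k y := xget 0 [set x | joined x 0 y e].
have kE x y : joined x 0 y e -> k y = x.
  move=> xy; rewrite /k; case: xgetP => [x' _ /= xy'|/(_ x)//].
  exact: (@joined_unique _ _ _ _ _ _ _ _ _ _ FN GCP rhoP _ _ _ _ _ (joined_sym xy') (joined_sym xy)).
have imP y : ((fun x => endpoint (x, e)) @` [set x | transport T (x, e)]) y ->
    exists x, joined x 0 y e.
  by move=> [x [_ [y' xy']] <-]; rewrite (endpointE xy'); exists x.
split.
- have j0 : joined 0 0 0 e by left.
  by split; [split=> //; exists 0 | exact: endpointE].
- exists k; split.
  + apply: continuous_in_subspaceT => x; rewrite inE => -[/= _ [y xy]].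
    move=> B; rewrite (endpointE xy) => /nbhs_rVP[eta eta0 HB].
    have [d d0 Hd] := near_end _ _ _ _ Te xy eta0.
    apply/nbhs_rVP; exists d => // x' h1 /=.
    have [|_ [y' hy xy']] := Hd x' e h1; first by rewrite subrr normr0.
    by rewrite (endpointE xy'); exact: HB.
  + apply: continuous_in_subspaceT => y; rewrite inE => /imP[x xy].
    move=> B; rewrite (kE _ _ xy) => /nbhs_rVP[eta eta0 HB].
    have [d d0 Hd] := back _ _ _ xy eta0.
    apply/nbhs_rVP; exists d => // y' h1 /=; have [x' hx xy'] := Hd y' h1.
    by rewrite (kE _ _ xy'); exact: HB.
  + by move=> x [_ [y xy]]; rewrite (endpointE xy) (kE _ _ xy).
- rewrite openE => y /imP[x xy]; have [d d0 Hd] := back _ _ _ xy ltr01.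
  apply/nbhs_rVP; exists d => // y' h1; have [x' hx xy'] := Hd y' h1.
  by exists x'; [split=> //; exists y' | exact: endpointE].
by move=> x [_ [y xy]]; rewrite (endpointE xy); exact: (@joined_eval _ _ _ _ _ F GC U Grho FN GCP x 0 y e F0 xy).
Qed.

End Triviality.

(** * Nondegeneracy near the origin, and the theorem *)

Lemma star_connected (R : realType) d (A : set 'rV[R]_d) :
  (forall a (t : R), A a -> 0 <= t <= 1 -> A (t *: a)) -> connected A.
Proof.
move=> HA.
have -> : A = \bigcup_(a in A) ((fun t : R => t *: a) @` `[0, 1]%classic).
  apply/seteqP; split=> [a Aa|_ [a Aa] [t /= + <-]]; last first.
    by rewrite in_itv /= => t01; exact: HA.
  by exists a => //; exists 1; rewrite ?scale1r//= in_itv /= ler01 lexx.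
apply: bigcup_connected.
  by exists 0 => a _; exists 0; rewrite ?scale0r//= in_itv /= ler01 lexx.
move=> a _; apply: connected_continuous_connected; first exact: segment_connected.
by apply: continuous_subspaceT => t; exact: scalel_continuous.
Qed.

Lemma closed_ball_compact (R : realType) d (r : R) : compact [set a : 'rV[R]_d | `|a| <= r].
Proof.
apply: (@compact_rV _ _ _ r) => //.
by apply: (closed_comp _ (@closed_le _ _)) => x _; exact: norm_continuous.
Qed.

Section Nondegeneracy.
Context {R : realType} {K : ground} {n p N : nat} (F : kfamily R K n p).
Context (U : set (kspace R K n)) (rho : kspace R K n -> R)
  (Grho : kspace R K n -> kspace R K n).
Context (FN : forall e, degree_lt N (F e))
  (rhoP : forall a, U a -> c11 rho Grho a) (HU : control_function U rho).

Lemma jacobian_Amat x e : U x ->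
  jacobian (fun y => row_mx (eval_map (F e) y) (rho y)%:M) x = @Amat _ _ _ _ N F Grho x e.
Proof.
move=> Ux; pose G (k : 'I_(kdim K p + 1)) (y : kspace R K n) : kspace R K n :=
  match fintype.split k with inl j => grad_map (coeffs N (F e)) j y | inr _ => Grho y end.
rewrite (@c11_jacobian _ _ _ _ G).
  apply/matrixP => l k; rewrite mxE /G -[in RHS](splitK k).
  case: (fintype.split k) => j /=; first by rewrite row_mxEl mxE.
  by rewrite row_mxEr mxE ord1.
move=> k; rewrite /G -{1}(splitK k); case: (fintype.split k) => j /=.
  rewrite (_ : (fun y => _) = fun y => eval_map (F e) y 0 j).
    by apply: eval_map_c11; exact: FN.
  by apply/funext => y; rewrite row_mxEl.
rewrite (_ : (fun y => _) = rho); first exact: rhoP.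
by apply/funext => y; rewrite row_mxEr ord1 mxE eqxx.
Qed.

(** Transversality makes the zero fibres nondegenerate, and the absence of
    critical points takes care of the other ones. *)
Lemma Milnor_nondegenerate (r d : R) : uniform_Milnor_radius U rho F -> 0 <= r -> 0 < d ->
  (forall x e, x != 0 -> `|x| < d -> `|e| <= r ->
     \rank (jac_map (coeffs N (F e)) x) = kdim K p) ->
  exists2 s, 0 < s & @nondegenerate _ _ _ _ N F U rho Grho r s.
Proof.
move=> HM r0 d0 HJ; pose T := [set e : kspace R K 1 | `|e| <= r].
have [||| s0 s00 Hs0] := HM T.
- apply: star_connected => a t ar /andP[t0 t1]; rewrite /T /= normrZ ger0_norm//.
  by apply: le_trans ar; rewrite ler_piMl.
- exact: closed_ball_compact.
- by rewrite /T /= normr0.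
have [s1 s10 Hs1] := rho_small HU rhoP d0.
exists (Num.min s0 s1); first by rewrite lt_min s00.
move=> x e Ux /andP[x0]; rewrite le_min => /andP[xs0 xs1] er.
have xn0 : x != 0 by apply/eqP => xE; move: x0; rewrite xE (rho0 HU) ltxx.
apply: Mmat_det; first by apply: HJ => //; exact: Hs1.
move=> Fx; rewrite -jacobian_Amat//.
by apply: (Hs0 (rho x) e) => //; rewrite x0.
Qed.

(** By compactness of the ball the neighbourhood of the origin no longer depends on
    the parameter. *)
Lemma no_critical_ball (r : R) :
  (forall es : kspace R K 1, `|es| <= r -> exists2 d, 0 < d & forall (x : kspace R K n) e,
    x != 0 -> `|x| < d -> `|e - es| < d -> \rank (jac_map (coeffs N (F e)) x) = kdim K p) ->
  exists2 d, 0 < d & forall (x : kspace R K n) (e : kspace R K 1),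
    x != 0 -> `|x| < d -> `|e| <= r -> \rank (jac_map (coeffs N (F e)) x) = kdim K p.
Proof.
move=> H; apply: contrapT => N0.
have [||W [es [WU er ce WB]]] := @compact_net R _ _ (fun k => [set e : kspace R K 1 |
    exists x : kspace R K n, [/\ x != 0, `|x| < k &
      \rank (jac_map (coeffs N (F e)) x) <> kdim K p]]) (@closed_ball_compact R (kdim K 1) r).
- move=> k k0; apply: contrapT => N1; apply: N0; exists k => // x e x0 xk er.
  by apply: contrapT => h; apply: N1; exists e => //; exists x.
- by move=> k k' _ kk e [x [x0 xk h]]; exists x; split=> //; exact: lt_le_trans kk.
have PW : ProperFilter W by exact: ultra_proper.
have FW : Filter W by exact: filter_filter.
have [d d0 Hd] := H es er.
have nd : nbhs es [set e | `|e - es| < d] by apply/nbhs_rVP; exists d.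
have WN : W [set e | `|e - es| < d] := ce _ nd.
have /(@filter_ex _ W PW)[e [[_ [x [x0 xd h]]] ed]] := @filterI _ W FW _ _ (WB _ d0) WN.
by apply: h; exact: Hd.
Qed.

End Nondegeneracy.

Theorem proposition4p6 (R : realType) (K : ground) (n p : nat)
    (n_gt0 : (0 < n)%N) (p_gt0 : (0 < p)%N)
    (f : kmap R K n p) (F : kfamily R K n p)
    (U : set (kspace R K n)) (rho : kspace R K n -> R)
    (D : 'I_p -> set 'rV[R]_n) (P : 'I_p -> seq 'rV[rat]_n) :
  fixes_origin f ->
  is_deformation f F ->
  control_function U rho ->
  (forall j, is_Cface_diagram (D j)) ->
  (forall j, facet_weights (D j) (P j)) ->
  SIKND D P f ->
  (forall j e w, w \in P j ->
     ((weight_diagram w (D j))%:E <= weight_poly w (F e j - f j)%R)%E) ->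
  uniform_Milnor_radius U rho F ->
  (exists T : set (kspace R K 1),
     [/\ connected T, nbhs (0 : kspace R K 1) T & topologically_trivial_along F T]) /\
  ((forall j e w, w \in P j ->
      ((weight_diagram w (D j))%:E < weight_poly w (F e j - f j)%R)%E) ->
   topologically_trivial F).
Proof.
move=> _ Hdef HU HD HP Hf HF HM.
have [Fz F0 Fan] := Hdef; have [[Uo _] rhoan _ _ _] := HU.
have [N FN] := deformation_degree Hdef.
have [Grho rhoP] := analytic_c11 rhoan Uo.
have /choice[G HG] : forall t : 'I_p * bmultinom (kdim K n) N * 'I_(kdim K 1),
    exists G, forall e : kspace R K 1, c11 (fun e => coeffs N (F e) t.1.1 t.1.2 t.2) G e.
  move=> [[j m] q]; have [G HG] := analytic_c11 (Fan j (bmnm m) q) openT.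
  exists G => e; have := HG e I.
  rewrite (_ : (fun e => _) = (fun e => coeffs N (F e) j m q))//.
  by apply/funext => e'; rewrite realifyE.
have GCP j m q e : c11 (fun e => coeffs N (F e) j m q) (G (j, m, q)) e.
  exact: (HG (j, m, q) e).
pose GC j m q := G (j, m, q).
have trivial_along T : open T -> (forall e, T e -> exists r s,
    [/\ `|e| < r, 0 < s & @nondegenerate _ _ _ _ N F U rho Grho r s]) ->
    topologically_trivial_along F T.
  exact: (@admissible_trivial _ _ _ _ _ F GC U rho Grho FN GCP rhoP HU F0 T).
split.
  have es0 j m : D j (exponent R m) -> mcoeff m (F 0 j) = mcoeff m (f j).
    by rewrite Fz.
  have [d d0 Hd] := no_critical n_gt0 p_gt0 Hdef HD HP Hf HF FN es0.
  have d2 : 0 < d / 2 by rewrite divr_gt0.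
  have d2d : d / 2 < d by lra.
  have [|s s0 nd] := Milnor_nondegenerate FN rhoP HU HM (ltW d2) d0.
    by move=> x e x0 xd er; apply: Hd => //; rewrite subr0 (le_lt_trans er).
  exists [set e | `|e| < d / 2]; split.
  - apply: star_connected => a t /= ar /andP[t0 t1]; rewrite normrZ ger0_norm//.
    by apply: le_lt_trans ar; rewrite ler_piMl.
  - by apply/nbhs_rVP; exists (d / 2) => // e; rewrite subr0.
  apply: trivial_along; last by move=> e er; exists (d / 2), s.
  rewrite openE => e /= er; apply/nbhs_rVP; exists (d / 2 - `|e|); first by rewrite subr_gt0.
  by move=> e' h /=; have := ler_normD (e' - e) e; rewrite subrK; lra.
move=> Hstrict; apply: trivial_along; first exact: openT.
move=> e _.
have r0 : 0 <= `|e| + 1 by rewrite addr_ge0.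
have [|d d0 Hd] := @no_critical_ball _ _ _ _ N F (`|e| + 1).
  move=> es _; apply: (no_critical n_gt0 p_gt0 Hdef HD HP Hf HF FN) => j m Djm.
  have [J _ /(_ (F es j - f j))[_ Hsupp]] := supp_upper K n_gt0 (HD j) (HP j).
  apply/eqP; rewrite -subr_eq0 -mcoeffB; apply/negPn/negP => h.
  by apply: (Hsupp _ m h Djm) => w wP; exact: Hstrict.
have [|s s0 nd] := Milnor_nondegenerate FN rhoP HU HM r0 d0; first exact: Hd.
by exists (`|e| + 1), s; split=> //; rewrite ltrDl.
Qed.
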